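(* Let $U,V,W\subset\mathbb{C}$ be nonempty compact sets. **a)** For all $\varepsilon>0$ and $p,q\in[1,\infty]$ with $p^{-1}+q^{-1}=1$, $$\Sigma_{{\rm fin},\varepsilon}^p\ :=\ \bigcup_{F\in M_{\rm fin}(U,V,W)}\operatorname{spec}_\varepsilon^pF\ =\ \Sigma_{+,\varepsilon}^p\cup\Sigma_{+,\varepsilon}^q .$$ **b)** If $p$ and $q$ are both favourable, in particular if $p=q=2$, this simplifies to $$\Sigma_{{\rm fin},\varepsilon}^p=\operatorname{spec}_\varepsilon^pA_+=\Sigma_{+,\varepsilon}^p=\Sigma_\varepsilon^p\cup G=\Sigma_\varepsilon^q\cup G=\Sigma_{+,\varepsilon}^q=\operatorname{spec}_\varepsilon^qB_+,$$ which holds for all $A_+,B_+\in\Psi E_+(U,V,W)$ and for each $G\in\{E_{\pm1},E_\cap,E_\cup,\Sigma_+\}$, with $E_{\pm1}=\varnothing$ if $w_*\le u^*$ and $u_*\le w^*$.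
   Context: $\mathbb{N}=\{1,2,\dots\}$, $\infty^{-1}:=0$, and $\mathbb{T}$ is the unit circle. $M(U,V,W)$ is the set of bi-infinite tridiagonal matrices $A=(a_{ij})_{i,j\in\mathbb{Z}}$ with $a_{i,i-1}\in U$, $a_{i,i}\in V$, $a_{i,i+1}\in W$ for all $i$, all other entries zero. $M_+(U,V,W)$ is the set of semi-infinite tridiagonal matrices $(a_{ij})_{i,j\in\mathbb{N}}$ with subdiagonal entries in $U$, diagonal entries in $V$, superdiagonal entries in $W$, all other entries zero. $M_n(U,V,W)$ is the set of $n\times n$ matrices of the same kind, and $M_{\rm fin}(U,V,W)=\bigcup_{n\in\mathbb{N}}M_n(U,V,W)$. They act as bounded operators on $\ell^p(\mathbb{Z})$, $\ell^p(\mathbb{N})$, $\mathbb{C}^n$ with the $p$-norm; $\|\cdot\|_p$ is the induced norm. Invertibility, spectra, Fredholmness and Fredholm index of the infinite ones do not depend on $p$. $A_+\in M_+(U,V,W)$ is pseudoergodic, $A_+\in \Psi E_+(U,V,W)$, if for every $n\in\mathbb N$, every $B\in M_n(U,V,W)$ and every $\varepsilon>0$ there is a submatrix $C$ of $A_+$ composed of rows and columns $k+1,\dots,k+n$ of $A_+$, for some integer $k\ge0$, with $\|B-C\|<\varepsilon$. $\operatorname{spec}_\varepsilon^pB:=\{\lambda\in\mathbb{C}:\|(B-\lambda I)^{-1}\|_p>\varepsilon^{-1}\}$, with $\|C^{-1}\|_p:=\infty$ if $C$ is not invertible. $\Sigma_\varepsilon^p:=\bigcup_{B\in M(U,V,W)}\operatorname{spec}_\varepsilon^pB$,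 $\Sigma_{+,\varepsilon}^p:=\bigcup_{C_+\in M_+(U,V,W)}\operatorname{spec}_\varepsilon^pC_+$. $\Sigma_+:=\bigcup_{C_+\in M_+(U,V,W)}\operatorname{spec}C_+$ (equal to $\operatorname{spec}B_+$ for every $B_+\in\Psi E_+(U,V,W)$). The triple $(U,V,W)$ is compatible if all operators in $M(U,V,W)$ are invertible (equivalently, all operators in $M_+(U,V,W)$ are Fredholm); then all $B_+\in M_+(U,V,W)$ are Fredholm with the same index $\kappa(U,V,W)\in\{-1,0,1\}$. Favourability is defined as follows: suppose that $(U,V,W)$ is compatible with $\kappa(U,V,W)=0$, equivalently that all operators in $M_+(U,V,W)$ are invertible; then $p\in[1,\infty]$ is called favourable (for the triple $(U,V,W)$) if, for all $A_+\in\Psi E_+(U,V,W)$, $\|A_+^{-1}\|_p=\max_{C_+\in M_+(U,V,W)}\|C_+^{-1}\|_p=\max_{B\in M(U,V,W)}\|B^{-1}\|_p$. $u_*=\min_{u\in U}|u|$, $u^*=\max_{u\in U}|u|$, $w_*=\min_{w\in W}|w|$, $w^*=\max_{w\in W}|w|$. For $u\in U,v\in V,w\in W$, $E(u,v,w)=\{ut+v+wt^{-1}:t\in\mathbb{T}\}$ is an ellipse, oriented counter-clockwise if $|u|>|w|$, clockwise if $|u|<|w|$; it is a line segment if $|u|=|w|$, in which case its interior is taken to be empty. $E_\cap$ is the set of $\lambda\in\mathbb{C}$ in the interior of all these ellipses; $E_1$ (resp. $E_{-1}$) is the set of $\lambda\in E_\cap$ circumnavigated clockwise (resp. counter-clockwise)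 by all these ellipses; $E_{\pm1}:=E_{-1}\cup E_1$; $E_\cup:=\bigcup_{u\in U,v\in V,w\in W}\operatorname{conv}E(u,v,w)$ (convex hulls). *)

(* Defs.v *)
From HB Require Import structures.
From mathcomp Require Import all_boot all_order all_algebra.
From mathcomp Require Import all_classical all_reals all_analysis.
From mathcomp Require Import complex.

Set Implicit Arguments.
Unset Strict Implicit.
Unset Printing Implicit Defensive.

Import Order.TTheory GRing.Theory Num.Theory.
Import numFieldNormedType.Exports.

Local Open Scope classical_set_scope.
Local Open Scope ring_scope.

(* The index type I below is [int] (bi-infinite), [nat] (semi-infinite,
   numbered from 0 instead of 1) or ['I_n] (finite). *)

Definition cabs (R : realType) (z : R[i]) : R := complex.Re `|z|.

(* Only exponents p with 1 <= p are used; -oo receives a junk value. *)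
Definition lpnorm (R : realType) (I : choiceType) (p : \bar R)
    (x : I -> R[i]) : \bar R :=
  match p with
  | r%:E => ((\esum_(i in [set: I]) (cabs (x i) `^ r)%:E) `^ r^-1)%E
  | +oo%E => ereal_sup [set (cabs (x i))%:E | i in [set: I]]
  | -oo%E => 0%E
  end.

Definition lp (R : realType) (I : choiceType) (p : \bar R) : set (I -> R[i]) :=
  [set x | (lpnorm p x < +oo)%E].

Definition opnorm (R : realType) (I : choiceType) (p : \bar R)
    (T : (I -> R[i]) -> (I -> R[i])) : \bar R :=
  ereal_sup [set lpnorm p (T x) | x in [set x | (lpnorm p x <= 1)%E]].

(* The rows of the matrices considered have finite support, so the finitely
   supported sum is the usual matrix-vector product. *)
Definition mxact (R : realType) (I : choiceType) (A : I -> I -> R[i])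
    (x : I -> R[i]) : I -> R[i] :=
  fun i => \sum_(j \in [set: I]) (A i j * x j).

(* Linearity of T on l^p is automatic, since A is linear. The values of T
   outside l^p are irrelevant. *)
Definition is_inverse (R : realType) (I : choiceType) (p : \bar R)
    (A : I -> I -> R[i]) (T : (I -> R[i]) -> (I -> R[i])) : Prop :=
  (opnorm p T < +oo)%E /\
  forall x, lp p x ->
    [/\ lp p (T x), T (mxact A x) = x & mxact A (T x) = x].

Definition invertible (R : realType) (I : choiceType) (p : \bar R)
    (A : I -> I -> R[i]) : Prop :=
  exists T, is_inverse p A T.

(* Any two inverses agree on l^p, so the value is independent of the choice. *)
Definition invnorm (R : realType) (I : choiceType) (p : \bar R)
    (A : I -> I -> R[i]) : \bar R :=
  match pselect (invertible p A) with
  | left e => opnorm p (projT1 (cid e))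
  | right _ => +oo%E
  end.

Definition mxshift (R : realType) (I : choiceType) (A : I -> I -> R[i])
    (lambda : R[i]) : I -> I -> R[i] :=
  fun i j => A i j - (if i == j then lambda else 0).

Definition pspec (R : realType) (I : choiceType) (eps : R) (p : \bar R)
    (A : I -> I -> R[i]) : set R[i] :=
  [set lambda | ((eps^-1)%:E < invnorm p (mxshift A lambda))%E].

(* Invertibility, the spectrum and the Fredholm index do not depend on the
   exponent for the infinite band matrices considered; where the notion carries
   no exponent it is taken on l^2. *)
Definition spec (R : realType) (I : choiceType) (A : I -> I -> R[i]) :
    set R[i] :=
  [set lambda | ~ invertible 2%:E (mxshift A lambda)].

Definition ker_dim (R : realType) (I : choiceType) (p : \bar R)
    (A : I -> I -> R[i]) (n : nat) : Prop :=
  exists e : 'I_n -> I -> R[i],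
    (forall k, lp p (e k) /\ mxact A (e k) = fun=> 0) /\
    forall x, lp p x -> mxact A x = (fun=> 0) ->
      exists! c : 'rV[R[i]]_n, x = fun i => \sum_(k < n) c ord0 k * e k i.

(* The classes of the f k form a basis of l^p / range A. *)
Definition coker_dim (R : realType) (I : choiceType) (p : \bar R)
    (A : I -> I -> R[i]) (m : nat) : Prop :=
  exists f : 'I_m -> I -> R[i],
    (forall k, lp p (f k)) /\
    forall y, lp p y ->
      exists! c : 'rV[R[i]]_m, exists2 x, lp p x &
        y = fun i => mxact A x i + \sum_(k < m) c ord0 k * f k i.

Definition fredholm_index (R : realType) (I : choiceType) (p : \bar R)
    (A : I -> I -> R[i]) (k : int) : Prop :=
  exists n m : nat,
    [/\ ker_dim p A n, coker_dim p A m & k = n%:Z - m%:Z].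

Definition tridiagonal (R : realType) (I : choiceType) (pos : I -> int)
    (U V W : set R[i]) (A : I -> I -> R[i]) : Prop :=
  forall i j,
    [/\ pos i = pos j + 1 -> U (A i j),
        pos i = pos j -> V (A i j),
        pos j = pos i + 1 -> W (A i j)
      & 1 < `|pos i - pos j| -> A i j = 0].

Definition M_bi (R : realType) (U V W : set R[i]) : set (int -> int -> R[i]) :=
  tridiagonal id U V W.

Definition M_plus (R : realType) (U V W : set R[i]) :
    set (nat -> nat -> R[i]) :=
  tridiagonal Posz U V W.

Definition M_n (R : realType) (n : nat) (U V W : set R[i]) :
    set 'M[R[i]]_n :=
  [set F : 'M[R[i]]_n | tridiagonal (fun i : 'I_n => Posz i) U V W F].

(* All norms on n x n matrices are equivalent, so the use of the 2-norm to
   measure closeness is immaterial. *)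
Definition PsiE_plus (R : realType) (U V W : set R[i]) :
    set (nat -> nat -> R[i]) :=
  [set A | M_plus U V W A /\
    forall n : nat, (0 < n)%N ->
    forall B : 'M[R[i]]_n, M_n U V W B ->
    forall eps : R, 0 < eps ->
    exists k : nat,
      let C := \matrix_(i < n, j < n) A (k + i)%N (k + j)%N in
      (opnorm 2%:E (mxact (B - C)%R) < eps%:E)%E].

Definition Sigma_fin (R : realType) (U V W : set R[i]) (eps : R)
    (p : \bar R) : set R[i] :=
  \bigcup_(n in [set n | (0 < n)%N])
    \bigcup_(F in @M_n R n U V W) pspec eps p F.

Definition Sigma_eps (R : realType) (U V W : set R[i]) (eps : R)
    (p : \bar R) : set R[i] :=
  \bigcup_(B in M_bi U V W) pspec eps p B.

Definition Sigma_plus_eps (R : realType) (U V W : set R[i]) (eps : R)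
    (p : \bar R) : set R[i] :=
  \bigcup_(C in M_plus U V W) pspec eps p C.

Definition Sigma_plus (R : realType) (U V W : set R[i]) : set R[i] :=
  \bigcup_(C in M_plus U V W) spec C.

Definition compatible (R : realType) (U V W : set R[i]) : Prop :=
  forall B, M_bi U V W B -> invertible 2%:E B.

Definition has_kappa (R : realType) (U V W : set R[i]) (k : int) : Prop :=
  forall B, M_plus U V W B -> fredholm_index 2%:E B k.

Definition is_max (R : realType) (S : set (\bar R)) (m : \bar R) : Prop :=
  S m /\ ubound S m.

Definition favourable (R : realType) (U V W : set R[i]) (p : \bar R) : Prop :=
  forall A, PsiE_plus U V W A ->
    is_max [set invnorm p C | C in M_plus U V W] (invnorm p A) /\
    is_max [set invnorm p B | B in M_bi U V W] (invnorm p A).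

(* Resolvent norms at lambda are inverse norms for the triple
   (U, V - lambda, W). Favourability only makes sense for a compatible triple
   of index 0, so in the context of pseudospectra an exponent is favourable when
   it is so for each of these shifted triples that is of this kind. *)
Definition favourable_shifts (R : realType) (U V W : set R[i])
    (p : \bar R) : Prop :=
  forall lambda : R[i],
    let V' := [set v - lambda | v in V] in
    compatible U V' W -> has_kappa U V' W 0 -> favourable U V' W p.

Definition ellipse (R : realType) (u v w : R[i]) : set R[i] :=
  [set u * t + v + w * t^-1 | t in [set t : R[i] | `|t| = 1]].

(* Convexity over the field R[i] in the library uses weights t with
   0 <= t <= 1 in the partial order of R[i], that is, real weights. *)
Definition conv_hull (R : realType) (S : set R[i]^o) : set R[i]^o :=
  smallest (@convex_set R[i] R[i]^o) S.

(* For |u| = |w| the hull is a segment (or a point), so this is empty. *)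
Definition ellipse_interior (R : realType) (u v w : R[i]) : set R[i] :=
  interior (conv_hull (ellipse u v w)).

Definition E_cap (R : realType) (U V W : set R[i]) : set R[i] :=
  [set lambda | forall u v w, U u -> V v -> W w ->
     ellipse_interior u v w lambda].

(* E(u,v,w) is oriented clockwise iff |u| < |w| and counter-clockwise iff
   |u| > |w|. *)
Definition E_1 (R : realType) (U V W : set R[i]) : set R[i] :=
  [set lambda | E_cap U V W lambda /\
     forall u w, U u -> W w -> cabs u < cabs w].

Definition E_m1 (R : realType) (U V W : set R[i]) : set R[i] :=
  [set lambda | E_cap U V W lambda /\
     forall u w, U u -> W w -> cabs w < cabs u].

Definition E_pm1 (R : realType) (U V W : set R[i]) : set R[i] :=
  E_m1 U V W `|` E_1 U V W.

Definition E_cup (R : realType) (U V W : set R[i]) : set R[i] :=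
  \bigcup_(u in U) \bigcup_(v in V) \bigcup_(w in W) conv_hull (ellipse u v w).

(* Attained when S is nonempty and compact. *)
Definition min_abs (R : realType) (S : set R[i]) : R :=
  inf [set cabs z | z in S].

Definition max_abs (R : realType) (S : set R[i]) : R :=
  sup [set cabs z | z in S].

(* Main.v *)
Require Import Defs.
From HB Require Import structures.
From mathcomp Require Import all_boot all_order all_algebra.
From mathcomp Require Import all_classical all_reals all_analysis.
From mathcomp Require Import complex.
From mathcomp Require Import ring lra zify.

(** Fix lambda, replace V by V - lambda and put d = 1/eps: one compares bounds
    d for the inverses of finite, half-line and bi-infinite tridiagonal matrices.

    Part a).  If all finite matrices have inverses bounded by d, weak limits of
    solutions of the finite sections invert every half-line matrix; reflection
    combined with transposition preserves (U, V, W) and exchanges p and q.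
    Conversely, if F x is too small for a finite block F, the vector
    (x, 0, r x, 0, r^2 x, ...) with |r| < 1 is a near-null vector of a half-line
    matrix built from copies of F, possibly after reflecting F, which is where
    the exponent q comes in.

    Part b).  If all bi-infinite matrices are invertible, then gluing a null
    vector of a half-line matrix to one of a transposed half-line matrix gives a
    null vector of a bi-infinite matrix, so one of the two kinds does not exist
    (Coburn).  A compactness argument then yields three cases: all half-line
    matrices are uniformly invertible, all have a null vector, or all their
    transposes do.  In the last two cases the Toeplitz matrices show that lambda
    lies in E_{-1} or E_1; in the first one, the favourable case, no point of the
    gap sets G occurs.  Independence of the exponent follows from the exponential
    off-diagonal decay of inverses (Combes-Thomas).  For p = q = 2 the gluing is
    quantitative, as a matrix and its transpose have inverses of the same norm. *)

Set Implicit Arguments.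
Unset Strict Implicit.
Unset Printing Implicit Defensive.

Import Order.TTheory GRing.Theory Num.Theory.
Import numFieldNormedType.Exports.

Local Open Scope classical_set_scope.
Local Open Scope ring_scope.

(** Every matrix is stored as three coefficient sequences on Z together with an index set, so that
    finite, half-line and bi-infinite matrices share one theory. The obstacle is that p = 1 and p =
    oo are included: finitely supported vectors are not dense in l^oo, and only coordinatewise
    limits of solutions are available. Solvability with a norm bound survives such limits; hence
    injectivity is expressed as solvability of the transpose.

    In the periodic vector the row between two copies of x reads r^k (u x_{n-1} + r w x_0). It can
    be made arbitrarily small with |r| < 1 exactly when |u x_{n-1}| <= |w x_0|, and reflecting F
    exchanges the two ends.

    Index theory is done with null vectors. Extended by zero, a null vector of a half-line matrix is
    a multiple of column -1 of the inverse of a bi-infinite extension; this is rigid enough to carry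
    null vectors from one half-line matrix to all others. *)

Section ModulusAndNorm.
Variable R : realType.
Local Notation C := R[i].

(** * Moduli of complex numbers *)

Lemma cabsE (z : C) : (cabs z)%:C%C = `|z|.
Proof. by rewrite /cabs normc_def. Qed.

Lemma cabs_ge0 (z : C) : 0 <= cabs z.
Proof. by rewrite /cabs normc_def /= sqrtr_ge0. Qed.

Lemma cabsM (y z : C) : cabs (y * z) = cabs y * cabs z.
Proof. by apply: complexI; rewrite rmorphM /= !cabsE normrM. Qed.

Lemma cabs0 : cabs (0 : C) = 0.
Proof. by rewrite /cabs normr0. Qed.

Lemma cabs1 : cabs (1 : C) = 1.
Proof. by rewrite /cabs normr1. Qed.

Lemma cabsN (z : C) : cabs (- z) = cabs z.
Proof. by rewrite /cabs normrN. Qed.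

Lemma cabsD (y z : C) : cabs (y + z) <= cabs y + cabs z.
Proof. by rewrite -lecR rmorphD /= !cabsE ler_normD. Qed.

Lemma cabsB (y z : C) : cabs (y - z) <= cabs y + cabs z.
Proof. by rewrite -(cabsN z) cabsD. Qed.

Lemma cabs_eq0 (z : C) : (cabs z == 0) = (z == 0).
Proof. by rewrite -(inj_eq (@complexI R)) /= cabsE normr_eq0. Qed.

Lemma cabs_gt0 (z : C) : (0 < cabs z) = (z != 0).
Proof. by rewrite lt_def cabs_ge0 andbT cabs_eq0. Qed.

Lemma cabsV (z : C) : cabs z^-1 = (cabs z)^-1.
Proof. by apply: complexI; rewrite fmorphV /= !cabsE normfV. Qed.

Lemma cabsX (z : C) n : cabs (z ^+ n) = cabs z ^+ n.
Proof. by apply: complexI; rewrite rmorphXn /= !cabsE normrX. Qed.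

Lemma cabs_real (r : R) : cabs r%:C%C = `|r|.
Proof. by rewrite /cabs normc_def /= expr0n /= addr0 sqrtr_sqr. Qed.

Lemma cabs_conj (z : C) : cabs z^*%C = cabs z.
Proof. by rewrite /cabs normcJ. Qed.

Lemma cabs_lt (z : C) (r : R) : (cabs z < r) = (`|z| < r%:C%C).
Proof. by rewrite -ltcR cabsE. Qed.

Lemma cabs_sum (I : Type) (s : seq I) (P : pred I) (f : I -> C) :
  cabs (\sum_(i <- s | P i) f i) <= \sum_(i <- s | P i) cabs (f i).
Proof.
elim/big_ind2 : _ => [|x1 y1 x2 y2 h1 h2|//]; first by rewrite cabs0.
by rewrite (le_trans (cabsD _ _))// lerD.
Qed.

Lemma cabs_sub_lower (y z : C) : cabs y - cabs z <= cabs (y - z).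
Proof. by rewrite lerBlDr (le_trans _ (cabsD _ _))// subrK. Qed.

(** * Norm bounds, conjugate exponents and Hoelder duality *)

Lemma ler_poweR (r : R) (a b : \bar R) : 0 <= r -> (0 <= a)%E -> (a <= b)%E ->
  (a `^ r <= b `^ r)%E.
Proof.
move=> r0 a0 ab; apply: gt0_ler_poweR => //; rewrite in_itv /= leey andbT//.
exact: le_trans ab.
Qed.

Lemma powR_le (r a b : R) : 0 <= r -> 0 <= a -> a <= b -> a `^ r <= b `^ r.
Proof.
move=> r0 a0 ab; apply: ge0_ler_powR => //; rewrite nnegrE//.
exact: le_trans ab.
Qed.

(** A real bound replaces the norm itself, which keeps the arithmetic of extended reals out of the
    estimates. *)
Definition nb (I : choiceType) (p : \bar R) (x : I -> C) (M : R) : Prop :=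
  (lpnorm p x <= M%:E)%E.

Definition conj_exp (p q : \bar R) : Prop :=
  [/\ (1 <= p)%E, (1 <= q)%E & (p^-1 + q^-1 = 1)%E].

Lemma conj_exp_sym p q : conj_exp p q -> conj_exp q p.
Proof. by case=> p1 q1 e; split=> //; rewrite addeC. Qed.

Lemma conj_exp1y : conj_exp 1%E +oo%E.
Proof. by split; rewrite ?leey// inve1 invey adde0. Qed.

Lemma conj_exp2 : conj_exp 2%:E 2%:E.
Proof.
split; rewrite ?lee_fin ?ler1n// inver pnatr_eq0 /= -EFinD.
by congr (_%:E); field.
Qed.

Lemma conj_exp_ex p : (1 <= p)%E -> exists q, conj_exp p q.
Proof.
case: p => [r||]; last 2 first.
- by move=> _; exists 1%E; apply/conj_exp_sym/conj_exp1y.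
- by rewrite leeNy_eq.
rewrite lee_fin le_eqVlt => /predU1P[<-|r1]; first by exists +oo%E; apply: conj_exp1y.
exists ((1 - r^-1)^-1)%:E.
have r0 : 0 < r by lra.
have ri : 0 < r^-1 < 1 by rewrite invr_gt0 r0 invf_lt1.
split; rewrite ?lee_fin; [lra|by rewrite invf_ge1; lra|].
rewrite !inver !gt_eqF ?invr_gt0; [|lra..].
by rewrite -EFinD invrK; congr (_%:E); ring.
Qed.

Variant conj_exp_spec : \bar R -> \bar R -> Prop :=
| ConjExp1y : conj_exp_spec 1%:E +oo%E
| ConjExpy1 : conj_exp_spec +oo%E 1%:E
| ConjExpFin (r s : R) of 1 < r & 1 < s & r^-1 + s^-1 = 1 :
    conj_exp_spec r%:E s%:E.

Lemma conj_expP p q : conj_exp p q -> conj_exp_spec p q.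
Proof.
case: p => [r||] [p1 q1]; last 2 first.
- rewrite invey add0e => /eqP; rewrite inve_eq1 => /eqP ->; exact: ConjExpy1.
- by move: p1; rewrite leeNy_eq.
case: q q1 => [s||] q1; last 2 first.
- rewrite invey adde0 => /eqP; rewrite inve_eq1 => /eqP ->; exact: ConjExp1y.
- by move: q1; rewrite leeNy_eq.
move: p1 q1; rewrite !lee_fin => r1 s1.
rewrite !inver !gt_eqF; [|lra..] => -[e].
have r0 : 0 < r^-1 by rewrite invr_gt0; lra.
have s0 : 0 < s^-1 by rewrite invr_gt0; lra.
by constructor => //; rewrite -invf_lt1; lra.
Qed.

Section NormBound.
Variable I : choiceType.
Implicit Types (x y : I -> C) (p q : \bar R) (M : R).

Lemma nb_esumP (r : R) x M : 0 < r -> 0 <= M ->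
  nb r%:E x M <->
  (\esum_(i in [set: I]) (cabs (x i) `^ r)%:E <= (M `^ r)%:E)%E.
Proof.
move=> r0 M0; rewrite /nb /lpnorm; set S := esum _ _.
have S0 : (0 <= S)%E by apply: esum_ge0 => i _; rewrite lee_fin powR_ge0.
split=> h.
- have := ler_poweR (ltW r0) (poweR_ge0 _ _) h.
  by rewrite -poweRrM mulVf ?gt_eqF// poweRe1.
- have ri : 0 <= r^-1 by rewrite invr_ge0 ltW.
  have := ler_poweR ri S0 h.
  by rewrite poweR_EFin -powRrM mulfV ?gt_eqF// powRr1.
Qed.

Lemma nb_sumP (r : R) x M : 0 < r -> 0 <= M ->
  nb r%:E x M <->
  forall J : seq I, uniq J -> \sum_(i <- J) cabs (x i) `^ r <= M `^ r.
Proof.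
move=> r0 M0; apply: (iff_trans (nb_esumP _ r0 M0)).
split=> [h J uJ|h].
  rewrite -lee_fin (le_trans _ h)// -sumEFin fsbig_seq//.
  by apply: ereal_sup_ubound; exists [set` J].
apply: ge_ereal_sup => _ [A [/finite_seqP[J ->] _] <-].
have -> : [set` J] = [set` undup J] by apply/seteqP; split=> i /=; rewrite mem_undup.
by rewrite -fsbig_seq ?undup_uniq// sumEFin lee_fin h// undup_uniq.
Qed.

Lemma nb_supP x M : nb +oo%E x M <-> forall i, cabs (x i) <= M.
Proof.
rewrite /nb /=; split=> [h i|h].
  by rewrite -lee_fin (le_trans _ h)//; apply: ereal_sup_ubound; exists i.
by apply: ge_ereal_sup => _ [i _ <-]; rewrite lee_fin.
Qed.

End NormBound.

Implicit Types (x y z : int -> C) (p q : \bar R) (M N : R).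

Lemma nb_ge0 p x M : (1 <= p)%E -> nb p x M -> 0 <= M.
Proof.
case: p => [r||]//.
  move=> _; rewrite /nb -(lee_fin 0); apply: le_trans; exact: poweR_ge0.
by move=> _ /nb_supP/(_ 0); apply: le_trans; exact: cabs_ge0.
Qed.

Lemma nb_le p x M N : M <= N -> nb p x M -> nb p x N.
Proof. by move=> MM h; rewrite /nb (le_trans h)// lee_fin. Qed.

Lemma nb_approx p x M : (forall e, 0 < e -> nb p x (M + e)) -> nb p x M.
Proof. by move=> h; apply/lee_addgt0Pr => e e0; rewrite -EFinD; exact: h. Qed.

Lemma ltr1e_gt0 (r : R) : (1 <= r%:E)%E -> 0 < r.
Proof. by rewrite lee_fin; apply: lt_le_trans. Qed.

Lemma nb_point p x M i : (1 <= p)%E -> nb p x M -> cabs (x i) <= M.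
Proof.
move=> p1 h; have M0 := nb_ge0 p1 h.
case: p p1 h => [r||]// p1; last by move/nb_supP.
have r0 := ltr1e_gt0 p1.
move/(nb_sumP _ r0 M0)/(_ [:: i] isT); rewrite big_seq1 => h.
have ri : 0 <= r^-1 by rewrite invr_ge0 ltW.
have := powR_le ri (powR_ge0 _ _) h.
by rewrite -!powRrM mulfV ?gt_eqF// !powRr1 ?cabs_ge0.
Qed.

Lemma nb_hoelder p q x y M N (J : seq int) : conj_exp p q ->
  nb p x M -> nb q y N -> uniq J ->
  \sum_(i <- J) cabs (x i) * cabs (y i) <= M * N.
Proof.
move=> cj hx hy uJ; have [p1 q1 _] := cj.
have M0 := nb_ge0 p1 hx; have N0 := nb_ge0 q1 hy.
case: (conj_expP cj) hx hy p1 q1 => [||r s r1 s1 rs] hx hy p1 q1.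
- have := proj1 (nb_sumP x ltr01 M0) hx J uJ; rewrite powRr1// => h.
  rewrite (le_trans _ (ler_wpM2r N0 h))// mulr_suml ler_sum// => i _.
  by rewrite powRr1 ?cabs_ge0// ler_wpM2l ?cabs_ge0// (proj1 (nb_supP _ _) hy).
- have := proj1 (nb_sumP y ltr01 N0) hy J uJ; rewrite powRr1// => h.
  rewrite (le_trans _ (ler_wpM2l M0 h))// mulr_sumr ler_sum// => i _.
  by rewrite powRr1 ?cabs_ge0// ler_wpM2r ?cabs_ge0// (proj1 (nb_supP _ _) hx).
have r0 := ltr1e_gt0 p1; have s0 := ltr1e_gt0 q1.
have [M0'|M0'] := eqVneq M 0.
  rewrite big1 ?M0' ?mul0r// => i _; have := nb_point i p1 hx; rewrite M0' => h.
  by rewrite (le_anti (introT andP (conj h (cabs_ge0 _)))) mul0r.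
have [N0'|N0'] := eqVneq N 0.
  rewrite big1 ?N0' ?mulr0// => i _; have := nb_point i q1 hy; rewrite N0' => h.
  by rewrite (le_anti (introT andP (conj h (cabs_ge0 _)))) mulr0.
have Mp : 0 < M by rewrite lt_def M0' M0.
have Np : 0 < N by rewrite lt_def N0' N0.
have hX := proj1 (nb_sumP x r0 M0) hx J uJ.
have hY := proj1 (nb_sumP y s0 N0) hy J uJ.
(* Young's inequality for [cabs (x i) / M] and [cabs (y i) / N], multiplied back by [M * N]; this is
   why zero bounds were treated apart. *)
have young i : cabs (x i) * cabs (y i) <=
    M * N * ((cabs (x i) `^ r) / (M `^ r) / r + (cabs (y i) `^ s) / (N `^ s) / s).
  have a0 : 0 <= cabs (x i) / M by rewrite divr_ge0 ?cabs_ge0.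
  have b0 : 0 <= cabs (y i) / N by rewrite divr_ge0 ?cabs_ge0.
  have := conjugate_powR a0 b0 r0 s0 rs.
  rewrite !powRM ?cabs_ge0 ?invr_ge0//.
  rewrite -(powR_inv1 M0) -(powR_inv1 N0) -!powRrM !mulN1r !powRN !powRr1// => h.
  rewrite -(ler_pM2l (mulr_gt0 Mp Np)) in h.
  apply: le_trans h; rewrite le_eqVlt; apply/orP; left; apply/eqP; field.
  by rewrite M0' N0'.
apply: (le_trans (ler_sum _ (fun i _ => young i))).
rewrite -mulr_sumr big_split /= -!mulr_suml.
have Mr : 0 < M `^ r by rewrite powR_gt0.
have Ns : 0 < N `^ s by rewrite powR_gt0.
rewrite -[leRHS]mulr1 ler_wpM2l ?mulr_ge0// -rs lerD//.
  by rewrite ler_pdivrMr// mulVf ?gt_eqF// ler_pdivrMr// mul1r.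
by rewrite ler_pdivrMr// mulVf ?gt_eqF// ler_pdivrMr// mul1r.
Qed.

Lemma ler_sum_sub (T : eqType) (J K : seq T) (f : T -> R) : uniq J -> uniq K ->
  (forall i, 0 <= f i) -> \sum_(i <- K | i \in J) f i <= \sum_(i <- J) f i.
Proof.
move=> uJ uK f0.
have pe : perm_eq [seq i <- K | i \in J] [seq i <- J | i \in K].
  by apply: uniq_perm; rewrite ?filter_uniq// => i; rewrite !mem_filter andbC.
rewrite -big_filter (perm_big _ pe) /= big_filter [leRHS](bigID (mem K)) /=.
by rewrite lerDl sumr_ge0.
Qed.

(** Converse of Hoelder's inequality, tested on finitely supported vectors. The extremal test
    vectors are an indicator for p = 1, a unit vector for p = oo and a multiple of |x|^(r-1)
    otherwise. *)
Lemma nb_dual p q x M : conj_exp p q -> 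
  (forall (J : seq int) y, uniq J -> nb q y 1 -> (forall i, i \notin J -> y i = 0) ->
     \sum_(i <- J) cabs (x i) * cabs (y i) <= M) ->
  nb p x M.
Proof.
move=> cj h; have [p1 q1 _] := cj.
have nb0 : nb q (fun _ : int => 0 : C) 1.
  case: q q1 {cj h} => [s||]// q1; last by apply/nb_supP => i; rewrite cabs0 ler01.
  have s0 := ltr1e_gt0 q1; apply/nb_sumP => // J _; rewrite big1 ?powR1// ?ler01//.
  by move=> i _; rewrite cabs0 powR0 ?gt_eqF.
have M0 : 0 <= M by have := h [::] _ isT nb0 (fun _ _ => erefl); rewrite big_nil.
case: (conj_expP cj) h p1 q1 => [||r s r1 s1 rs] h p1 q1.
- apply/(nb_sumP _ ltr01 M0) => J uJ; rewrite powRr1//.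
  have := h J (fun i => (i \in J)%:R) uJ.
  have -> : \sum_(i <- J) cabs (x i) * cabs (i \in J)%:R = \sum_(i <- J) cabs (x i) `^ 1.
    by apply: eq_big_seq => i ->; rewrite cabs1 mulr1 powRr1 ?cabs_ge0.
  apply; last by move=> i /negbTE ->.
  by apply/nb_supP => i; case: (_ \in _); rewrite ?cabs1 ?cabs0.
- apply/nb_supP => i; have := h [:: i] (fun j => (j == i)%:R) isT.
  rewrite big_seq1 eqxx cabs1 mulr1; apply; last by move=> j; rewrite inE => /negbTE ->.
  apply/(nb_sumP _ ltr01 ler01) => J uJ; rewrite powR1.
  have [iJ|iJ] := boolP (i \in J).
    rewrite (bigD1_seq i)//= eqxx cabs1 powR1 big1 ?addr0// => j /negbTE ->.
    by rewrite cabs0 powR0 ?oner_eq0.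
  rewrite big_seq big1// => j jJ; have /negbTE -> : j != i by apply: contraNneq iJ => <-.
  by rewrite cabs0 powR0 ?oner_eq0.
have r0 := ltr1e_gt0 p1; have s0 := ltr1e_gt0 q1.
apply/(nb_sumP _ r0 M0) => J uJ.
set S := \sum_(i <- J) _.
have S0 : 0 <= S by apply: sumr_ge0 => i _; exact: powR_ge0.
have [->|Sn0] := eqVneq S 0; first exact: powR_ge0.
have Sp : 0 < S by rewrite lt_def Sn0.
have rsE : (r - 1) * s = r.
  have e : s^-1 = (r - 1) / r.
    rewrite -[LHS](addKr r^-1) rs; by field; rewrite gt_eqF.
  by rewrite -[s]invrK e; field; rewrite ?gt_eqF//; lra.
(* Equality case of Hoelder; the denominator normalizes the s-norm to 1, because (r - 1) s = r. *)
pose y i : C := (if i \in J then cabs (x i) `^ (r - 1) / S `^ s^-1 else 0)%:C%C.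
have yE i : i \in J -> cabs (y i) = cabs (x i) `^ (r - 1) / S `^ s^-1.
  by move=> iJ; rewrite cabs_real iJ ger0_norm// divr_ge0// powR_ge0.
have nby : nb s%:E y 1.
  apply/(nb_sumP _ s0 ler01) => K uK; rewrite powR1.
  have yS i : cabs (y i) `^ s = if i \in J then cabs (x i) `^ r / S else 0.
    case: ifPn => iJ; last by rewrite /y (negbTE iJ) cabs_real normr0 powR0// gt_eqF.
    rewrite yE// powRM ?invr_ge0 ?powR_ge0//.
    rewrite -(powR_inv1 (powR_ge0 _ _)) -!powRrM rsE mulN1r mulrC.
    have -> : s^-1 * (- s) = -1 by rewrite mulrN mulVf// gt_eqF.
    by rewrite powR_inv1// mulrC.
  under eq_bigr do rewrite yS.
  rewrite -big_mkcond /= -mulr_suml ler_pdivrMr// mul1r.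
  by apply: ler_sum_sub => // i; exact: powR_ge0.
have := h J y uJ nby; rewrite big_seq.
under eq_bigr => i iJ do rewrite yE// mulrA mulr_powRB1 ?cabs_ge0//.
rewrite -big_seq -mulr_suml -/S => hS.
have SE : S / S `^ s^-1 = S `^ r^-1.
  have -> : r^-1 = 1 - s^-1 by rewrite -rs addrK.
  by rewrite powRB ?Sn0 ?implybT// powRr1.
have {}hS : S `^ r^-1 <= M.
  by rewrite -SE; apply: hS => i iJ; rewrite /y (negbTE iJ).
have := powR_le (ltW r0) (powR_ge0 _ _) hS.
by rewrite -powRrM mulVf ?gt_eqF// powRr1.
Qed.

End ModulusAndNorm.

(** * Consequences of duality for norm bounds *)

Section NormProperties.
Variable R : realType.
Local Notation C := R[i].
Implicit Types (x y z : int -> C) (p q : \bar R) (M N : R) (J : seq int).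

(** By duality this and the next lemmas reduce to termwise estimates of finite sums, with no case
    distinction on p. *)
Lemma nb_dom p x y M : (1 <= p)%E -> (forall i, cabs (x i) <= cabs (y i)) ->
  nb p y M -> nb p x M.
Proof.
move=> p1 xy ny; have [q cj] := conj_exp_ex p1.
apply: (nb_dual cj) => J s uJ ns _; rewrite -[M]mulr1.
apply: le_trans (nb_hoelder cj ny ns uJ).
by apply: ler_sum => i _; rewrite ler_wpM2r ?cabs_ge0.
Qed.

Lemma nb_add p x y M N : (1 <= p)%E -> nb p x M -> nb p y N ->
  nb p (fun i => x i + y i) (M + N).
Proof.
move=> p1 nx ny; have [q cj] := conj_exp_ex p1.
apply: (nb_dual cj) => J s uJ ns _; rewrite -[M + N]mulr1 mulrDl.
apply: le_trans (lerD (nb_hoelder cj nx ns uJ) (nb_hoelder cj ny ns uJ)).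
rewrite -big_split /=; apply: ler_sum => i _.
by rewrite -mulrDl ler_wpM2r ?cabs_ge0// cabsD.
Qed.

Lemma nb_scale p (c : C) x M : (1 <= p)%E -> nb p x M ->
  nb p (fun i => c * x i) (cabs c * M).
Proof.
move=> p1 nx; have [q cj] := conj_exp_ex p1.
apply: (nb_dual cj) => J s uJ ns _; rewrite -[M]mulr1.
apply: le_trans (ler_wpM2l (cabs_ge0 c) (nb_hoelder cj nx ns uJ)).
by rewrite mulr_sumr; apply: ler_sum => i _; rewrite cabsM mulrA.
Qed.

Lemma nb_scale_le p (c : int -> C) (k : R) x M : (1 <= p)%E -> 
  (forall i, cabs (c i) <= k) -> nb p x M ->
  nb p (fun i => c i * x i) (k * M).
Proof.
move=> p1 ck nx; have k0 : 0 <= k := le_trans (cabs_ge0 _) (ck 0).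
have := nb_scale k%:C%C p1 nx; rewrite cabs_real ger0_norm//.
apply: nb_dom => // i; rewrite !cabsM cabs_real ger0_norm//.
by rewrite ler_wpM2r ?cabs_ge0.
Qed.

(** A test vector in the unit ball of l^q has entries of modulus at most 1, so the l^1 norm
    dominates all others. *)
Lemma nb_l1 p x M : (1 <= p)%E ->
  (forall J, uniq J -> \sum_(i <- J) cabs (x i) <= M) -> nb p x M.
Proof.
move=> p1 h; have [q cj] := conj_exp_ex p1; have [_ q1 _] := cj.
apply: (nb_dual cj) => J s uJ ns _; apply: le_trans (h J uJ).
apply: ler_sum => i _; rewrite -[leRHS]mulr1 ler_wpM2l ?cabs_ge0//.
exact: nb_point q1 ns.
Qed.

Lemma nb_fin p x J : (1 <= p)%E -> uniq J -> (forall i, i \notin J -> x i = 0) ->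
  nb p x (\sum_(i <- J) cabs (x i)).
Proof.
move=> p1 uJ xJ; apply: nb_l1 => // K uK.
rewrite (bigID (mem J)) /= [X in _ + X]big1 ?addr0; last first.
  by move=> i /xJ ->; rewrite cabs0.
by apply: ler_sum_sub => // i; exact: cabs_ge0.
Qed.

Definition delta (k : int) : int -> C := fun i => (i == k)%:R.

Lemma nb_delta p k : (1 <= p)%E -> nb p (delta k) 1.
Proof.
move=> p1; have := @nb_fin p (delta k) [:: k] p1 isT.
rewrite big_seq1 /delta eqxx cabs1; apply => i.
by rewrite inE => /negbTE ->.
Qed.

Lemma nb_zero p M : (1 <= p)%E -> 0 <= M -> nb p (fun _ : int => 0 : C) M.
Proof.
by move=> p1 M0; apply: nb_l1 => // J _; rewrite big1// => i _; rewrite cabs0.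
Qed.

Lemma nb_eq0 p x : (1 <= p)%E -> nb p x 0 -> forall i, x i = 0.
Proof.
move=> p1 h i; apply/eqP; rewrite -cabs_eq0 eq_le cabs_ge0 andbT.
exact: nb_point h.
Qed.

(** Lower semicontinuity under coordinatewise approximation: the dual pairing sees finitely many
    coordinates only. *)
Lemma nb_lim p x M : (1 <= p)%E -> 
  (forall J e, 0 < e -> exists2 z, nb p z M & 
     forall i, i \in J -> cabs (x i - z i) <= e) ->
  nb p x M.
Proof.
move=> p1 h; have [q cj] := conj_exp_ex p1; have [_ q1 _] := cj.
apply: (nb_dual cj) => J s uJ ns _.
apply/ler_addgt0Pr => e e0.
pose S := \sum_(i <- J) cabs (s i) + 1.
have S0 : 0 < S by rewrite ltr_wpDl// sumr_ge0// => i _; exact: cabs_ge0.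
have [z nz xz] := h J (e / S) (divr_gt0 e0 S0).
have := nb_hoelder cj nz ns uJ; rewrite mulr1 => hz.
apply: (@le_trans _ _ (\sum_(i <- J) (cabs (z i) * cabs (s i) + e / S * cabs (s i)))).
  rewrite big_seq [leRHS]big_seq; apply: ler_sum => i iJ; rewrite -mulrDl.
  rewrite ler_wpM2r ?cabs_ge0//; have := cabsD (x i - z i) (z i).
  rewrite subrK => /le_trans; apply; rewrite [leRHS]addrC lerD2r; exact: xz.
rewrite big_split /= lerD// -mulr_sumr mulrAC ler_pdivrMr// ler_wpM2l ?(ltW e0)//.
by rewrite lerDl.
Qed.

Lemma nb_comp p (f : int -> int) x M : (1 <= p)%E -> injective f ->
  nb p x M -> nb p (x \o f) M.
Proof.
move=> p1 fi h; have M0 := nb_ge0 p1 h.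
case: p p1 h => [r||]// p1; last first.
  by move/nb_supP => h; apply/nb_supP => i; exact: h.
have r0 := ltr1e_gt0 p1; move/(nb_sumP _ r0 M0) => h.
apply/(nb_sumP _ r0 M0) => J uJ.
by have := h (map f J); rewrite big_map map_inj_uniq//; exact.
Qed.

Lemma nb_sum p (T : Type) (s : seq T) (f : T -> int -> C) (M : T -> R) : 
  (1 <= p)%E -> (forall t, nb p (f t) (M t)) -> 
  nb p (fun i => \sum_(t <- s) f t i) (\sum_(t <- s) M t).
Proof.
move=> p1 h; elim: s => [|t s IH].
  rewrite big_nil; apply: nb_dom (nb_zero p1 (lexx 0)) => // i.
  by rewrite big_nil.
rewrite big_cons; apply: nb_dom (nb_add p1 (h t) IH) => // i.
by rewrite big_cons.
Qed.

(** Meaningful only when the norm is finite. *)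
Definition lpn p x : R := fine (lpnorm p x).

Lemma lpnE p x M : (1 <= p)%E -> nb p x M -> (lpn p x)%:E = lpnorm p x.
Proof.
move=> p1 h; rewrite /lpn fineK// ge0_fin_numE.
  by apply: le_lt_trans h _; exact: ltry.
case: p p1 {h} => [r||]// _; first exact: poweR_ge0.
rewrite /lpnorm; apply: le_trans (ereal_sup_ubound _); last by exists 0.
by rewrite lee_fin cabs_ge0.
Qed.

Lemma nb_lpn p x M : (1 <= p)%E -> nb p x M -> nb p x (lpn p x).
Proof. by move=> p1 h; rewrite /nb (lpnE p1 h). Qed.

Lemma lpn_le p x M : (1 <= p)%E -> nb p x M -> lpn p x <= M.
Proof. by move=> p1 h; rewrite -lee_fin (lpnE p1 h). Qed.

Lemma lpn_ge0 p x M : (1 <= p)%E -> nb p x M -> 0 <= lpn p x.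
Proof. by move=> p1 /(nb_lpn p1)/(nb_ge0 p1). Qed.

Definition rest (D : set int) x : int -> C := fun i => if i \in D then x i else 0.

Lemma nb_rest p D x M : (1 <= p)%E -> nb p x M -> nb p (rest D x) M.
Proof.
move=> p1; apply: nb_dom => // i; rewrite /rest; case: ifP => // _.
by rewrite cabs0 cabs_ge0.
Qed.

(** A ratio [th] between two norms may be checked on each level set of [b]: for finite p the p-th
    powers add up over the blocks, and for p = oo each index lies in one block. This controls
    near-null vectors assembled from scaled pieces. *)
Lemma nb_blocks p (b : int -> int) (th : R) x y K : (1 <= p)%E -> 0 <= th ->
  (forall k M, nb p (rest [set i | b i = k] x) M ->
               nb p (rest [set i | b i = k] y) (th * M)) ->
  nb p x K -> nb p y (th * K).
Proof.
move=> p1 th0 h nx; have K0 := nb_ge0 p1 nx.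
have nxk k := nb_rest [set i | b i = k] p1 nx.
case: p p1 h nx nxk => [r||]// p1 h nx nxk; last first.
  apply/nb_supP => i; have /nb_supP/(_ i) := h _ _ (nxk (b i)).
  by rewrite /rest mem_set.
have r0 := ltr1e_gt0 p1.
have rE : r != 0 by rewrite gt_eqF.
have thK : 0 <= th * K by rewrite mulr_ge0.
pose tx i := th%:C%C * x i.
have ntx : nb r%:E tx (th * K).
  by have := nb_scale th%:C%C p1 nx; rewrite cabs_real ger0_norm.
have esum_rest k (z : int -> C) : \esum_(i in [set: int]) (cabs (rest [set i | b i = k] z i) `^ r)%:E
    = \esum_(i in [set i | b i = k]) (cabs (z i) `^ r)%:E.
  rewrite [RHS]esum_mkcond; apply: eq_esum => i _; rewrite /rest.
  by case: ifP => // _; rewrite cabs0 powR0.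
have esum_split (z : int -> C) : \esum_(i in [set: int]) (cabs (z i) `^ r)%:E
    = \esum_(k in [set: int]) \esum_(i in [set i | b i = k]) (cabs (z i) `^ r)%:E.
  rewrite esum_esum; last by move=> *; rewrite lee_fin powR_ge0.
  apply/esym; rewrite (reindex_esum setT _ (fun i => (b i, i)))//.
  by split=> [i _ //|i j _ _ [_ ->]//|[k i] [/= _ <-]]; exists i.
apply/(nb_esumP _ r0 thK); apply: le_trans (proj1 (nb_esumP _ r0 thK) ntx).
rewrite !esum_split; apply: le_esum => k _; rewrite -!esum_rest.
have L0 := lpn_ge0 p1 (nxk k).
have := h k _ (nb_lpn p1 (nxk k)).
move/(nb_esumP _ r0 (mulr_ge0 th0 L0)) => /le_trans; apply.
set L := lpn _ _ in L0 *.
(* Past this case [th] is invertible, so a block of [x] can be recovered from that of [tx]. *)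
have [->|thn0] := eqVneq th 0.
  by rewrite mul0r powR0//; apply: esum_ge0 => i _; rewrite lee_fin powR_ge0.
have thp : 0 < th by rewrite lt_def thn0.
set S := esum _ _.
have S0 : (0 <= S)%E by apply: esum_ge0 => i _; rewrite lee_fin powR_ge0.
have Sfin : S \is a fin_num.
  rewrite ge0_fin_numE//; apply: le_lt_trans (ltry ((th * K) `^ r)).
  exact/(nb_esumP _ r0 thK)/nb_rest.
pose s := fine S; have sE : S = s%:E by rewrite fineK.
have s0 : 0 <= s by rewrite -lee_fin -sE.
have nS : nb r%:E (rest [set i | b i = k] tx) (s `^ r^-1).
  apply/nb_esumP; rewrite ?powR_ge0// -powRrM mulVf// powRr1// -sE.
  exact: lexx.
have nL : nb r%:E (rest [set i | b i = k] x) (s `^ r^-1 / th).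
  have := nb_scale (th^-1)%:C%C p1 nS; rewrite cabs_real ger0_norm ?invr_ge0// mulrC.
  apply: nb_dom => // i; rewrite /rest /tx; case: ifP => _; last by rewrite cabs0 cabs_ge0.
  by rewrite mulrA -rmorphM /= mulVf// mul1r.
have := lpn_le p1 nL; rewrite -/L ler_pdivlMr// mulrC => hL.
have := powR_le (ltW r0) (mulr_ge0 th0 L0) hL.
by rewrite -powRrM mulVf// powRr1// sE lee_fin.
Qed.

Section Push.
Variables (K : choiceType) (pos : K -> int).
Hypothesis pos_inj : injective pos.

(** Extension by zero along [pos], by which vectors over all three index types become vectors over
    [int]. *)
Definition push (g : K -> C) : int -> C := fun i =>
  match pselect (exists k, pos k = i) with
  | left e => g (projT1 (cid e))
  | right _ => 0
  end.

Lemma pushE (g : K -> C) k : push g (pos k) = g k.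
Proof.
rewrite /push; case: pselect => [e|[]]; last by exists k.
by case: cid => k' /= /pos_inj ->.
Qed.

Lemma push0 (g : K -> C) i : ~ range pos i -> push g i = 0.
Proof.
move=> h; rewrite /push; case: pselect => // e; exfalso; apply: h.
by case: e => k <-; exists k.
Qed.

Lemma nb_push p (g : K -> C) M : (1 <= p)%E -> 0 <= M -> nb p (push g) M <-> nb p g M.
Proof.
move=> p1 M0; case: p p1 => [r||]// p1; last first.
  split=> /nb_supP h; apply/nb_supP => i; first by rewrite -pushE.
  case: (pselect (range pos i)) => [[k _ <-]|ni]; first by rewrite pushE.
  by rewrite push0// cabs0.
have r0 := ltr1e_gt0 p1; apply: (iff_trans (nb_esumP _ r0 M0)).
apply: (iff_trans _ (iff_sym (nb_esumP _ r0 M0))).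
suff -> : \esum_(i in [set: int]) (cabs (push g i) `^ r)%:E
   = \esum_(i in [set: K]) (cabs (g i) `^ r)%:E by [].
transitivity (\esum_(i in range pos) (cabs (push g i) `^ r)%:E).
  rewrite [RHS]esum_mkcond; apply: eq_esum => i _; case: ifPn => // /negP ni.
  by rewrite push0 ?cabs0 ?powR0 ?gt_eqF// => h; apply: ni; rewrite inE.
rewrite (reindex_esum setT (range pos) pos) /=.
  by apply: eq_esum => k _; rewrite pushE.
split=> [k _|k l _ _ /pos_inj//|i [k _ <-]]; [by exists k|by exists k].
Qed.

End Push.
End NormProperties.

(** * Tridiagonal operators, transposes and bounded inverses *)

Section Tridiagonal.
Variable R : realType.
Local Notation C := R[i].
Implicit Types (x y z s : int -> C) (p q : \bar R) (J : seq int) (I : set int).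

(** Coefficients are indexed by the row, on all of Z: [lo a i] stands in column i - 1 and [up a i]
    in column i + 1. Half-line and finite matrices are compressions to an index set that is given
    separately. *)
Record tri := Tri { lo : int -> C; di : int -> C; up : int -> C }.

Definition act (a : tri) x : int -> C := fun i =>
  lo a i * x (i - 1) + di a i * x i + up a i * x (i + 1).

Definition tr (a : tri) : tri :=
  Tri (fun i => up a (i - 1)) (di a) (fun i => lo a (i + 1)).

Definition bnd (a : tri) (c : R) : Prop :=
  forall i, [/\ cabs (lo a i) <= c, cabs (di a i) <= c & cabs (up a i) <= c].

Definition supp I x : Prop := forall i, ~ I i -> x i = 0.

Definition FSolve p I (a : tri) (d : R) : Prop :=
  forall y J, uniq J -> (forall i, i \notin J -> y i = 0) -> supp I y ->
  exists x, [/\ supp I x, forall i, I i -> act a x i = y i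
              & nb p x (d * lpn p y)].

(* [Good p q I a d] encodes that the compression of [a] to [I] is invertible on
   l^p with inverse bounded by [d]; it involves finitely supported right-hand
   sides only, and for p the transpose on l^q takes the role of injectivity. *)
Definition Good p q I (a : tri) (d : R) : Prop :=
  FSolve p I a d /\ FSolve q I (tr a) d.

(** [K] only records that [x] has finite norm; the bound [d] does not depend on it. *)
Definition BB p I (a : tri) (d : R) : Prop :=
  forall x K M, supp I x -> nb p x K -> nb p (rest I (act a x)) M ->
  nb p x (d * M).

Lemma trK a : tr (tr a) = a.
Proof.
case: a => l v u; rewrite /tr /=; congr Tri; apply/funext => i.
  by rewrite subrK.
by rewrite addrK.
Qed.

Lemma Good_tr p q I a d : Good p q I a d -> Good q p I (tr a) d.
Proof. by case=> h1 h2; split; rewrite ?trK. Qed.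

Lemma bnd_tr a c : bnd a c -> bnd (tr a) c.
Proof. by move=> h i; split; [have [] := h (i - 1)|have [] := h i|have [] := h (i + 1)]. Qed.

Lemma bnd_ge0 a c : bnd a c -> 0 <= c.
Proof. by move=> /(_ 0) [h _ _]; apply: le_trans h; exact: cabs_ge0. Qed.

Lemma actD a x y i : act a (fun j => x j + y j) i = act a x i + act a y i.
Proof. by rewrite /act; ring. Qed.

Lemma actZ a c x i : act a (fun j => c * x j) i = c * act a x i.
Proof. by rewrite /act; ring. Qed.

Lemma actB a x y i : act a (fun j => x j - y j) i = act a x i - act a y i.
Proof. by rewrite /act; ring. Qed.

Lemma act0 a i : act a (fun=> 0) i = 0.
Proof. by rewrite /act; ring. Qed.

Lemma act_sum (T : Type) (r : seq T) a (f : T -> int -> C) i :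
  act a (fun j => \sum_(t <- r) f t j) i = \sum_(t <- r) act a (f t) i.
Proof.
elim: r => [|t r IH]; first by rewrite /act !big_nil; ring.
by rewrite big_cons -IH -actD; congr (_ + _ + _); rewrite big_cons.
Qed.

Lemma restE I x i : I i -> rest I x i = x i.
Proof. by move=> h; rewrite /rest mem_set. Qed.

Lemma rest_out I x i : ~ I i -> rest I x i = 0.
Proof. by move=> h; rewrite /rest memNset. Qed.

Lemma supp_setT x : supp setT x.
Proof. by move=> i []. Qed.

Lemma supp_rest I x : supp I (rest I x).
Proof. by move=> i /rest_out. Qed.

Lemma rest_supp I x i : supp I x -> rest I x i = x i.
Proof.
by move=> h; case: (pselect (I i)) => hi; [rewrite restE|rewrite rest_out// h].
Qed.

(** Turns a sum of moduli into the modulus of a sum: the entries of a test vector are rotated until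
    all products are nonnegative. *)
Lemma phase (a b : C) : exists2 b', cabs b' = cabs b & a * b' = (cabs a * cabs b)%:C%C.
Proof.
have [->|a0] := eqVneq a 0; first by exists b; rewrite // mul0r cabs0 mul0r.
exists ((cabs b)%:C%C * `|a| / a).
  rewrite !cabsM cabsV cabs_real ger0_norm ?cabs_ge0// -cabsE cabs_real ger0_norm ?cabs_ge0//.
  by rewrite mulfK ?cabs_eq0.
by rewrite rmorphM /= !cabsE mulrC divfK// mulrC.
Qed.

Lemma nb_dualC p q x M : conj_exp p q ->
  (forall J y, uniq J -> nb q y 1 -> (forall i, i \notin J -> y i = 0) ->
     cabs (\sum_(i <- J) x i * y i) <= M) ->
  nb p x M.
Proof.
move=> cj h; have [p1 q1 _] := cj; apply: (nb_dual cj) => J y uJ ny yJ.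
pose f i := s2val (cid2 (phase (x i) (y i))).
have f1 i : cabs (f i) = cabs (y i) by rewrite /f; case: cid2.
have f2 i : x i * f i = (cabs (x i) * cabs (y i))%:C%C by rewrite /f; case: cid2.
have := h J f uJ; under eq_bigr do rewrite f2.
rewrite -rmorph_sum /= cabs_real ger0_norm; last first.
  by apply: sumr_ge0 => i _; rewrite mulr_ge0 ?cabs_ge0.
apply; first by apply: nb_dom ny => // i; rewrite f1.
by move=> i /yJ yi; apply/eqP; rewrite -cabs_eq0 f1 yi cabs0.
Qed.

Lemma cabs_hoelder p q x y M N J : conj_exp p q -> nb p x M -> nb q y N -> uniq J ->
  cabs (\sum_(i <- J) x i * y i) <= M * N.
Proof.
move=> cj nx ny uJ; apply: le_trans (nb_hoelder cj nx ny uJ).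
by apply: le_trans (cabs_sum _ _ _) _; apply: ler_sum => i _; rewrite cabsM.
Qed.

Definition win (N : nat) : seq int := [seq k%:Z - N%:Z | k <- iota 0 (2 * N).+1].

Lemma win_uniq N : uniq (win N).
Proof. by rewrite map_inj_uniq ?iota_uniq// => k l; lia. Qed.

Lemma mem_win N i : (i \in win N) = (- N%:Z <= i <= N%:Z).
Proof.
apply/mapP/idP => [[k]|h]; first by rewrite mem_iota; lia.
by exists (absz (i + N%:Z)); [rewrite mem_iota; lia|lia].
Qed.

Lemma sub_win J : exists N0, forall N, (N0 <= N)%N -> forall i, i \in J -> i \in win N.
Proof.
elim: J => [|j J [N0 h]]; first by exists 0%N.
exists (maxn N0 (absz j)) => N hN i; rewrite inE => /predU1P[->|]; last by apply: h; lia.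
by rewrite mem_win; lia.
Qed.

Lemma big_sub J L (f : int -> C) : uniq J -> uniq L -> (forall i, i \in J -> i \in L) ->
  (forall i, i \notin J -> f i = 0) -> \sum_(i <- L) f i = \sum_(i <- J) f i.
Proof.
move=> uJ uL JL f0; rewrite (bigID (mem J)) /= [X in _ + X]big1 ?addr0//.
rewrite -big_filter; apply: perm_big; apply: uniq_perm; rewrite ?filter_uniq// => i.
by rewrite mem_filter; case: (boolP (i \in J)) => //= /JL ->.
Qed.

Lemma sum_win J N (f g : int -> C) : uniq J -> (forall i, i \in J -> i \in win N) ->
  (forall i, i \notin J -> g i = 0) -> f =1 g -> \sum_(i <- win N) f i = \sum_(i <- J) g i.
Proof.
by move=> uJ JN gJ fg; rewrite -(big_sub uJ (win_uniq N) JN gJ); apply: eq_bigr => i _.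
Qed.

Lemma sum_deltas J y i : uniq J -> (forall k, k \notin J -> y k = 0) ->
  \sum_(k <- J) y k * delta R k i = y i.
Proof.
move=> uJ yJ; have [iJ|iJ] := boolP (i \in J); last first.
  rewrite yJ// big_seq big1// => k kJ; rewrite /delta; case: eqP => [ik|]; last by rewrite mulr0.
  by rewrite ik kJ in iJ.
rewrite (bigD1_seq i)//= /delta eqxx mulr1 big1 ?addr0// => k.
by rewrite eq_sym => /negbTE ->; rewrite mulr0.
Qed.

Lemma sum_telescope_win (g : int -> C) N :
  \sum_(i <- win N) (g i - g (i + 1)) = g (- N%:Z) - g (N%:Z + 1).
Proof.
rewrite big_map.
transitivity (\sum_(0 <= k < (2 * N).+1) (g (k%:Z - N%:Z) - g (k.+1%:Z - N%:Z))).
  rewrite /index_iota subn0; apply: eq_bigr => k _; congr (_ - g _); lia.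
rewrite (telescope_sumr_eq (fun k => - g (k%:Z - N%:Z)))//; last first.
  by move=> k _; rewrite opprK addrC.
by rewrite opprK addrC; congr (g _ - g _); lia.
Qed.

(** Summation by parts over [-N, N] leaves boundary terms made of products of neighbouring entries
    of [x] and [s]. These are summable by Hoelder, hence small for arbitrarily large N. *)
Lemma pairing_approx p q a c x s K L : conj_exp p q -> bnd a c ->
  nb p x K -> nb q s L -> forall (e : R) N0, 0 < e -> exists2 N, (N0 <= N)%N &
  cabs (\sum_(i <- win N) x i * act (tr a) s i - \sum_(i <- win N) act a x i * s i) <= e.
Proof.
move=> cj ba nx ns e N0 e0; have [p1 q1 _] := cj.
(* The boundary term: the difference of the two summands at i is [g i - g (i + 1)]. *)
pose g i := up a (i - 1) * x i * s (i - 1) - lo a i * x (i - 1) * s i.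
have E N : \sum_(i <- win N) x i * act (tr a) s i - \sum_(i <- win N) act a x i * s i
    = g (- N%:Z) - g (N%:Z + 1).
  rewrite -sum_telescope_win -sumrB; apply: eq_bigr => i _.
  by rewrite /act /tr /g /= !addrK; ring.
suff [N hN h] : exists2 N, (N0 <= N)%N & cabs (g (- N%:Z) - g (N%:Z + 1)) <= e.
  by exists N; rewrite ?E.
(* Otherwise the boundary terms are at least [e] for all N >= N0, and sufficiently many of them
   exceed the Hoelder bound 4 c K L: two ends with two products each. *)
apply: contrapT => hn; pose t N := cabs (g (- N%:Z)) + cabs (g (N%:Z + 1)).
have ht N : (N0 <= N)%N -> e <= t N.
  move=> hN; rewrite leNgt; apply/negP => lt; apply: hn; exists N => //.
  by apply: le_trans (cabsB _ _) _; exact: ltW.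
have K0 := nb_ge0 p1 nx; have L0 := nb_ge0 q1 ns; have c0 := bnd_ge0 ba.
have hg i : cabs (g i) <= c * (cabs (x i) * cabs (s (i - 1))) + c * (cabs (x (i - 1)) * cabs (s i)).
  apply: le_trans (cabsB _ _) _; rewrite !cabsM -!mulrA lerD// ler_wpM2r ?mulr_ge0 ?cabs_ge0//.
    by have [] := ba (i - 1).
  by have [] := ba i.
have bound (f : int -> int) n : injective f ->
    \sum_(N <- iota 0 n) cabs (g (f N%:Z)) <= c * (K * L) + c * (K * L).
  move=> fi; have fi' : injective (fun i => f i - 1) by move=> i j /addIr /fi.
  apply: (@le_trans _ _ (\sum_(i <- [seq N%:Z | N <- iota 0 n])
     (c * (cabs (x (f i)) * cabs (s (f i - 1))) + c * (cabs (x (f i - 1)) * cabs (s (f i)))))).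
    by rewrite big_map; apply: ler_sum => N _; exact: hg.
  have uJ : uniq [seq N%:Z | N <- iota 0 n] by rewrite map_inj_uniq ?iota_uniq// => ? ? [].
  rewrite big_split /= -!mulr_sumr lerD// ler_wpM2l//.
    exact: (nb_hoelder cj (nb_comp p1 fi nx) (nb_comp q1 fi' ns) uJ).
  exact: (nb_hoelder cj (nb_comp p1 fi' nx) (nb_comp q1 fi ns) uJ).
have tot n : \sum_(N <- iota 0 n) t N <= 4%:R * (c * (K * L)).
  rewrite big_split /=.
  have := bound (fun i => - i) n oppr_inj.
  have := bound (fun i => i + 1) n (addIr 1).
  lra.
have low n : n%:R * e <= \sum_(N <- iota 0 (N0 + n)) t N.
  rewrite iotaD big_cat /= add0n -[leLHS]add0r lerD//.
    by apply: sumr_ge0 => N _; rewrite addr_ge0 ?cabs_ge0.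
  have -> : n%:R * e = \sum_(N <- iota N0 n) e.
    by rewrite big_const_seq count_predT size_iota iter_addr addr0 mulr_natl.
  rewrite big_seq [leRHS]big_seq; apply: ler_sum => N; rewrite mem_iota => /andP[h _].
  exact: ht.
have X0 : 0 <= 4%:R * (c * (K * L)) / e by rewrite divr_ge0 ?(ltW e0)// !mulr_ge0.
have := archi_boundP X0; set n := Num.bound _; rewrite ltr_pdivrMr// => h.
by have := le_lt_trans (le_trans (low n) (tot _)) h; rewrite ltxx.
Qed.

(** Exact duality <x, A^T s> = <A x, s>: both right-hand sides have finite support, so the pairings
    are constant on large windows. *)
Lemma pairing p q I a c x s K L y z J J' : conj_exp p q -> bnd a c ->
  nb p x K -> nb q s L -> supp I x -> supp I s ->
  (forall i, I i -> act (tr a) s i = y i) -> (forall i, I i -> act a x i = z i) ->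
  uniq J -> uniq J' -> (forall i, i \notin J -> y i = 0) ->
  (forall i, i \notin J' -> z i = 0) ->
  \sum_(i <- J) x i * y i = \sum_(i <- J') z i * s i.
Proof.
move=> cj ba nx ns sx ss ey ez uJ uJ' yJ zJ'.
apply/eqP; rewrite -subr_eq0 -cabs_eq0 eq_le cabs_ge0 andbT.
apply/ler_addgt0Pr => e e0; rewrite add0r.
have [N1 h1] := sub_win J; have [N2 h2] := sub_win J'.
have [N hN0] := pairing_approx cj ba nx ns (maxn N1 N2) e0.
have -> : \sum_(i <- win N) x i * act (tr a) s i = \sum_(i <- J) x i * y i.
  apply: sum_win uJ (h1 N _) _ _ => [|i /yJ ->|i]; [lia|by rewrite mulr0|].
  by case: (pselect (I i)) => Ii; [rewrite ey|rewrite sx ?mul0r].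
have -> // : \sum_(i <- win N) act a x i * s i = \sum_(i <- J') z i * s i.
apply: sum_win uJ' (h2 N _) _ _ => [|i /zJ' ->|i]; [lia|by rewrite mul0r|].
by case: (pselect (I i)) => Ii; [rewrite ez|rewrite ss ?mulr0].
Qed.

(** For a test vector y solve A^T s = y; then <x, y> = <A x, s> is at most M d. *)
Lemma fsolve_BB p q I a c d : conj_exp p q -> bnd a c -> 0 <= d ->
  FSolve q I (tr a) d -> BB p I a d.
Proof.
move=> cj ba d0 h x K M sx nx nM; have [p1 q1 _] := cj.
apply: (nb_dualC cj) => J y uJ ny yJ.
pose y' := rest I y.
have y'J i : i \notin J -> y' i = 0 by rewrite /y' /rest => /yJ ->; rewrite if_same.
have [s [ss es ns]] := h y' J uJ y'J (@supp_rest _ _).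
have {}ns : nb q s d.
  apply: nb_le ns; rewrite -[leRHS]mulr1 ler_wpM2l//; apply: lpn_le => //.
  exact: nb_rest.
have -> : \sum_(i <- J) x i * y i = \sum_(i <- J) x i * y' i.
  apply: eq_bigr => i _; case: (pselect (I i)) => Ii; first by rewrite /y' restE.
  by rewrite sx// !mul0r.
apply/ler_addgt0Pr => e e0.
have [N1 h1] := sub_win J.
have [N hN0] := pairing_approx cj ba nx ns N1 e0.
have -> : \sum_(i <- win N) x i * act (tr a) s i = \sum_(i <- J) x i * y' i.
  apply: sum_win uJ (h1 N hN0) _ _ => [i /y'J ->|i]; first by rewrite mulr0.
  by case: (pselect (I i)) => Ii; [rewrite es|rewrite sx ?mul0r].
have -> : \sum_(i <- win N) act a x i * s i = \sum_(i <- win N) rest I (act a x) i * s i.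
  apply: eq_bigr => i _; case: (pselect (I i)) => Ii; first by rewrite restE.
  by rewrite ss// !mulr0.
move=> he; have := cabs_hoelder cj nM ns (win_uniq N); rewrite mulrC => hm.
have := le_trans (cabs_sub_lower _ _) he; lra.
Qed.

Lemma Good_BB p q I a c d : conj_exp p q -> bnd a c -> 0 <= d ->
  Good p q I a d -> BB p I a d.
Proof. by move=> cj ba d0 [_ h]; exact: fsolve_BB h. Qed.

Lemma BB_inj p I a d x K : (1 <= p)%E -> BB p I a d -> supp I x -> nb p x K ->
  (forall i, I i -> act a x i = 0) -> forall i, x i = 0.
Proof.
move=> p1 h sx nx e; apply: (nb_eq0 p1); rewrite -[0](mulr0 d); apply: h sx nx _.
apply: nb_dom (nb_zero p1 (lexx _)) => // i; rewrite /rest; case: ifPn => //.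
by rewrite inE => /e ->.
Qed.

(** Given a lower bound, solving for unit vectors suffices. The transpose is solved by transposing
    the matrix of these solutions: the lower bound makes it a two-sided inverse, and duality
    transfers the norm bound. *)
Lemma BB_Good p q I a d : conj_exp p q -> 0 <= d -> BB p I a d ->
  (forall k, I k -> exists x, [/\ supp I x, forall i, I i -> act a x i = delta R k i
                                & exists K, nb p x K]) ->
  Good p q I a d.
Proof.
move=> cj d0 hB hS; have [p1 q1 _] := cj.
have [zf zfP] : exists zf : int -> int -> C, forall k, I k ->
    [/\ supp I (zf k), forall i, I i -> act a (zf k) i = delta R k i
      & exists K, nb p (zf k) K].
  pose P k x := I k -> [/\ supp I x, forall i, I i -> act a x i = delta R k i
      & exists K, nb p x K].
  have ex k : exists x, P k x.
    case: (pselect (I k)) => Ik; first by have [x] := hS k Ik; exists x.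
    by exists (fun=> 0) => /Ik.
  by exists (fun k => projT1 (cid (ex k))) => k; case: cid.
pose comb J y := fun i => \sum_(k <- J) rest I y k * zf k i.
have scomb J y : supp I (comb J y).
  move=> i Ii; rewrite /comb big1// => k _; case: (pselect (I k)) => Ik.
    by case: (zfP k Ik) => -> //; rewrite mulr0.
  by rewrite rest_out// mul0r.
have ncomb J y : exists K, nb p (comb J y) K.
  have ex k : exists K, nb p (fun i => rest I y k * zf k i) K.
    case: (pselect (I k)) => Ik.
      have [_ _ [K nK]] := zfP k Ik; exists (cabs (rest I y k) * K); exact: nb_scale.
    by exists 0; apply: nb_dom (nb_zero p1 (lexx _)) => // i; rewrite rest_out// mul0r.
  exists (\sum_(k <- J) projT1 (cid (ex k))).
  by apply: nb_sum => // k; case: cid.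
have acomb J y i : uniq J -> (forall i, i \notin J -> y i = 0) -> I i ->
    act a (comb J y) i = y i.
  move=> uJ yJ Ii; rewrite act_sum.
  rewrite -[RHS](sum_deltas _ uJ yJ); apply: eq_bigr => k _; rewrite actZ.
  case: (pselect (I k)) => Ik; first by rewrite restE//; have [_ -> //] := zfP k Ik.
  rewrite rest_out// mul0r /delta; case: eqP => [ik|]; last by rewrite mulr0.
  by case: Ik; rewrite -ik.
have bcomb J y M : uniq J -> (forall i, i \notin J -> y i = 0) -> nb p y M ->
    nb p (comb J y) (d * M).
  move=> uJ yJ ny; have [K nK] := ncomb J y; apply: hB (scomb J y) nK _.
  apply: nb_dom ny => // i; rewrite /rest; case: ifPn => [|_]; last by rewrite cabs0 cabs_ge0.
  by rewrite inE => Ii; rewrite acomb.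
split=> y J uJ yJ sy.
  exists (comb J y); split; [exact: scomb|by move=> i; exact: acomb|].
  exact: bcomb uJ yJ (nb_lpn p1 (nb_fin p1 uJ yJ)).
(* [zf k] is column k of the inverse, so this is the transposed inverse applied to [y]. *)
pose S := rest I (fun k => \sum_(j <- J) zf k j * y j).
exists S; split; first exact: supp_rest.
  move=> i Ii.
  (* The left inverse property: the combination of columns with right-hand side A e_i solves the
     same system as e_i, hence equals it. [rest] drops the neighbours of i outside [I]. *)
  have key j : rest I (fun k => zf k j) (i - 1) * up a (i - 1) + zf i j * di a i
       + rest I (fun k => zf k j) (i + 1) * lo a (i + 1) = (j == i)%:R.
    pose L := undup [:: i - 1; i; i + 1].
    pose Y := act a (delta R i).
    have YL k : k \notin L -> Y k = 0.
      rewrite mem_undup !inE !negb_or => /and3P[k1 k2 k3]; rewrite /Y /act /delta.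
      have -> : (k - 1 == i) = false by lia.
      have -> : (k == i) = false by lia.
      have -> : (k + 1 == i) = false by lia.
      by rewrite !mulr0 !addr0.
    have nY : nb p Y (\sum_(k <- L) cabs (Y k)) by apply: nb_fin => //; exact: undup_uniq.
    have diff0 := @BB_inj p I a d (fun j => comb L Y j - delta R i j).
    have /= := diff0 _ p1 hB.
    have [K nK] := ncomb L Y.
    have sd : supp I (delta R i).
      by move=> k Ik; rewrite /delta; case: eqP => // ki; case: Ik; rewrite ki.
    move/(_ (K + cabs (-1 : C) * 1)) => /(_ _ _ _ j).
    have -> : comb L Y j = rest I (fun k => zf k j) (i - 1) * up a (i - 1) + zf i j * di a i
       + rest I (fun k => zf k j) (i + 1) * lo a (i + 1).
      have uL : uniq [:: i - 1; i; i + 1] by rewrite /= !inE; lia.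
      rewrite /comb /L undup_id// !big_cons big_nil addr0 addrA.
      rewrite [rest I Y i]restE//.
      have r1 k : rest I Y k * zf k j = rest I (fun k => zf k j) k * Y k.
        by rewrite /rest; case: ifP; rewrite ?mul0r// mulrC.
      rewrite (r1 (i - 1)) (r1 (i + 1)) [Y i * _]mulrC.
      have Y1 : Y (i - 1) = up a (i - 1).
        rewrite /Y /act /delta subrK eqxx.
        have -> : (i - 1 - 1 == i) = false by lia.
        have -> : (i - 1 == i) = false by lia.
        by rewrite !mulr0 !add0r mulr1.
      have Y2 : Y i = di a i.
        rewrite /Y /act /delta eqxx.
        have -> : (i - 1 == i) = false by lia.
        have -> : (i + 1 == i) = false by lia.
        by rewrite !mulr0 add0r addr0 mulr1.
      have Y3 : Y (i + 1) = lo a (i + 1).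
        rewrite /Y /act /delta addrK eqxx.
        have -> : (i + 1 == i) = false by lia.
        have -> : (i + 1 + 1 == i) = false by lia.
        by rewrite !mulr0 !addr0 mulr1.
      by rewrite Y1 Y2 Y3.
    move=> h; apply/eqP; rewrite -subr_eq0; apply/eqP; apply: h.
    - by move=> k Ik; rewrite scomb// sd// subr0.
    - have := nb_add p1 nK (nb_scale (-1) p1 (@nb_delta R p i p1)).
      by apply: nb_dom => // k; rewrite mulN1r.
    - by move=> k Ik; rewrite actB acomb ?subrr// undup_uniq.
  have Sk k : S k = \sum_(j <- J) rest I (fun k => zf k j) k * y j.
    rewrite /S /rest; case: ifP => // _; rewrite big1// => j _.
    by rewrite mul0r.
  rewrite /act /tr /= !Sk ![_ * (\sum_(_ <- _) _)]mulr_sumr -!big_split /=.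
  rewrite -[RHS](sum_deltas _ uJ yJ); apply: eq_bigr => j _.
  rewrite /delta eq_sym -key (restE (I := I) _ Ii); ring.
have ny := nb_lpn q1 (nb_fin q1 uJ yJ).
(* The pairing of S with x is that of the solution for x with y, and this solution is bounded by d
   on l^p. *)
apply: (nb_dualC (conj_exp_sym cj)) => L x uL nx xL.
have -> : \sum_(k <- L) S k * x k = \sum_(j <- J) comb L x j * y j.
  under eq_bigr => k _.
    have -> : S k * x k = \sum_(j <- J) rest I x k * zf k j * y j.
      rewrite /S /rest; case: ifP => _; last first.
        by rewrite mul0r big1// => j _; rewrite !mul0r.
      rewrite mulr_suml; apply: eq_bigr => j _; ring.
    over.
  by rewrite exchange_big; apply: eq_bigr => j _; rewrite mulr_suml.
have := cabs_hoelder cj (bcomb _ _ _ uL xL nx) ny uJ.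
by rewrite mulr1.
Qed.

End Tridiagonal.

(** * Limits along an ultrafilter *)

Section Ultralimits.

Lemma ultra_exists : exists F : set_system nat, UltraFilter F /\ (\oo : set_system nat) `<=` F.
Proof. exact: ultraFilterLemma. Qed.

(** All bounded sequences converge along this one filter simultaneously, so no diagonal subsequences
    have to be extracted. *)
Definition ultra : set_system nat := projT1 (cid ultra_exists).

#[global] Instance ultra_ultra : UltraFilter ultra.
Proof. by rewrite /ultra; case: cid => ? []. Qed.

Definition ev (P : nat -> Prop) : Prop := ultra [set n | P n].

Lemma ev_mono (P Q : nat -> Prop) : (forall n, P n -> Q n) -> ev P -> ev Q.
Proof. by move=> PQ; apply: filterS. Qed.

Lemma ev_and (P Q : nat -> Prop) : ev P -> ev Q -> ev (fun n => P n /\ Q n).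
Proof. by move=> hP hQ; apply: filterI. Qed.

Lemma ev_all (P : nat -> Prop) : (forall n, P n) -> ev P.
Proof. by move=> h; apply: filterS filterT => n _; exact: h. Qed.

Lemma ev_dec (P : nat -> Prop) : ev P \/ ev (fun n => ~ P n).
Proof. exact: in_ultra_setVsetC. Qed.

Lemma ev_ge N : ev (fun n => (N <= n)%N).
Proof.
rewrite /ev /ultra; case: cid => F [_ sF] /=; apply: sF.
by exists N.
Qed.

Lemma ev_ex (P : nat -> Prop) : ev P -> exists n, P n.
Proof. by move=> /filter_ex [n]; exists n. Qed.

Lemma ev_seq (T : eqType) (J : seq T) (P : T -> nat -> Prop) :
  (forall i, i \in J -> ev (P i)) -> ev (fun n => forall i, i \in J -> P i n).
Proof.
elim: J => [|j J IH] h; first exact: ev_all.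
have hj := h j (mem_head _ _).
have {}IH := IH (fun i iJ => h i (mem_behead (s := j :: J) iJ)).
apply: ev_mono (ev_and hj IH) => n [h1 h2] i.
by rewrite inE => /predU1P[->|/h2].
Qed.

Section Limits.
Variable R : realType.
Local Notation C := R[i].

Definition ulim (s : nat -> C) (l : C) : Prop :=
  forall e : R, 0 < e -> ev (fun n => cabs (s n - l) <= e).

Lemma ulim_cst c : ulim (fun=> c) c.
Proof. by move=> e e0; apply: ev_all => _; rewrite subrr cabs0 ltW. Qed.

Lemma ulim_eq s t l : ev (fun n => s n = t n) -> ulim s l -> ulim t l.
Proof. by move=> h hs e e0; apply: ev_mono (ev_and h (hs e e0)) => n [<-]. Qed.

Lemma ulim_ev_cst s c : ev (fun n => s n = c) -> ulim s c.
Proof. by move=> h; apply: ulim_eq (ulim_cst c); apply: ev_mono h. Qed.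

Lemma ulim_unique s l l' : ulim s l -> ulim s l' -> l = l'.
Proof.
move=> h h'; apply/eqP; rewrite -subr_eq0 -cabs_eq0 eq_le cabs_ge0 andbT.
apply/ler_addgt0Pr => e e0; rewrite add0r.
have e2 : 0 < e / 2 by lra.
have [n [h1 h2]] := ev_ex (ev_and (h _ e2) (h' _ e2)).
have -> : l - l' = (s n - l') - (s n - l) by ring.
by apply: le_trans (cabsB _ _) _; lra.
Qed.

Lemma ulimD s t l m : ulim s l -> ulim t m -> ulim (fun n => s n + t n) (l + m).
Proof.
move=> hs ht e e0; have e2 : 0 < e / 2 by lra.
apply: ev_mono (ev_and (hs _ e2) (ht _ e2)) => n [h1 h2].
have -> : s n + t n - (l + m) = (s n - l) + (t n - m) by ring.
by apply: le_trans (cabsD _ _) _; lra.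
Qed.

Lemma ulimM s t l m : ulim s l -> ulim t m -> ulim (fun n => s n * t n) (l * m).
Proof.
move=> hs ht e e0; have l0 := cabs_ge0 l; have m0 := cabs_ge0 m.
pose B := cabs l + cabs m + 1; pose r := Num.min 1 (e / B).
have B0 : 0 < B by rewrite /B; lra.
have r0 : 0 < r by rewrite /r lt_min ltr01 divr_gt0.
have r1 : r <= 1 by rewrite /r ge_min lexx.
have rB : r * B <= e by rewrite -ler_pdivlMr// /r ge_min lexx orbT.
apply: ev_mono (ev_and (hs _ r0) (ht _ r0)) => n [h1 h2].
have -> : s n * t n - l * m = (s n - l) * (t n - m) + (s n - l) * m + l * (t n - m) by ring.
apply: le_trans (cabsD _ _) _; apply: le_trans (lerD (cabsD _ _) (lexx _)) _.
rewrite !cabsM; apply: le_trans rB; rewrite /B.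
have a0 := cabs_ge0 (s n - l); have b0 := cabs_ge0 (t n - m).
have : cabs (s n - l) * cabs (t n - m) <= r * 1 by rewrite ler_pM// (le_trans h2).
have : cabs (s n - l) * cabs m <= r * cabs m by rewrite ler_wpM2r.
have : cabs l * cabs (t n - m) <= cabs l * r by rewrite ler_wpM2l.
by nra.
Qed.

Lemma ulim_le s l M : ulim s l -> ev (fun n => cabs (s n) <= M) -> cabs l <= M.
Proof.
move=> h hM; apply/ler_addgt0Pr => e e0.
have [n [h1 h2]] := ev_ex (ev_and (h _ e0) hM).
have -> : l = s n - (s n - l) by ring.
by apply: le_trans (cabsB _ _) _; lra.
Qed.

(** An ultrafilter converges to each of its cluster points. *)
Lemma compact_ultra_point (T : topologicalType) (A : set T) (s : nat -> T) :
  compact A -> (forall n, A (s n)) ->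
  exists2 l, A l & forall N, nbhs l N -> ev (fun n => N (s n)).
Proof.
move=> cA sA; have FA : (s @ ultra) A by exact: (ev_all (P := fun n => A (s n)) sA).
have [l [Al cl]] := cA (s @ ultra) _ FA; exists l => // N lN; case: (ev_dec (fun n => N (s n))) => // nN.
by have [x [nx xN]] := cl [set x | ~ N x] N nN lN; case: nx.
Qed.

Lemma ulim_real_bounded (s : nat -> R) M : (forall n, `|s n| <= M) ->
  exists l, forall e, 0 < e -> ev (fun n => `|s n - l| <= e).
Proof.
move=> h; have hs n : `[- M, M]%classic (s n) by rewrite /= in_itv /= -ler_norml.
have [l _ hl] := compact_ultra_point (@segment_compact R (- M) M) hs.
exists l => e e0; have := hl _ (nbhsx_ballx l e e0); apply: ev_mono => n.
by rewrite /ball /= distrC; exact: ltW.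
Qed.

Lemma cabs_ReIm (z : C) : cabs z <= `|complex.Re z| + `|complex.Im z|.
Proof.
have -> : z = (complex.Re z)%:C%C + 'i%C * (complex.Im z)%:C%C by exact: complexE.
apply: le_trans (cabsD _ _) _; rewrite cabsM !cabs_real.
have -> : cabs ('i%C : C) = 1.
  by rewrite /cabs normc_def /= expr0n /= add0r expr1n sqrtr1.
by case: z => a b /=; rewrite mul1r !mul0r !mul1r !subr0 !addr0 !add0r.
Qed.

Lemma normr_Re (z : C) : `|complex.Re z| <= cabs z.
Proof. by rewrite -lecR cabsE normc_ge_Re. Qed.

Lemma normr_Im (z : C) : `|complex.Im z| <= cabs z.
Proof.
have := normr_Re (z * 'i%C); rewrite ReiNIm normrN cabsM.
have -> : cabs ('i%C : C) = 1.
  by rewrite /cabs normc_def /= expr0n /= add0r expr1n sqrtr1.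
by rewrite mulr1.
Qed.

Lemma ulim_bounded s M : ev (fun n => cabs (s n) <= M) -> exists l, ulim s l.
Proof.
move=> hM; pose t n := if cabs (s n) <= M then s n else 0.
have M0 : 0 <= M by have [n] := ev_ex hM; apply: le_trans; exact: cabs_ge0.
have ht n : cabs (t n) <= M by rewrite /t; case: ifP => // _; rewrite cabs0.
have [a ha] := ulim_real_bounded (fun n => le_trans (normr_Re (t n)) (ht n)).
have [b hb] := ulim_real_bounded (fun n => le_trans (normr_Im (t n)) (ht n)).
exists (Complex a b); apply: (@ulim_eq t).
  by apply: ev_mono hM => n hn; rewrite /t hn.
move=> e e0; have e2 : 0 < e / 2 by lra.
apply: ev_mono (ev_and (ha _ e2) (hb _ e2)) => n [h1 h2].
apply: le_trans (cabs_ReIm _) _; move: h1 h2; case: (t n) => u v /=; lra.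
Qed.

Lemma ev_small (e : R) : 0 < e -> ev (fun n => n.+1%:R^-1 <= e).
Proof.
move=> e0; have ei : 0 <= e^-1 by rewrite invr_ge0 ltW.
apply: ev_mono (ev_ge (Num.bound e^-1)) => n hn.
rewrite -[e]invrK lef_pV2 ?posrE ?ltr0n ?invr_gt0//.
apply: ltW; apply: lt_le_trans (archi_boundP ei) _; rewrite ler_nat.
exact: leq_trans hn (leqnSn n).
Qed.

Definition ucompact (S : set C) : Prop :=
  forall s : nat -> C, (forall n, S (s n)) -> exists2 l, S l & ulim s l.

Lemma ucompactP (S : set C) : compact (S : set R[i]^o) -> ucompact S.
Proof.
move=> cS s hs; have [l Sl hl] := compact_ultra_point cS hs; exists l => // e e0.
have e0' : 0 < e%:C%C :> C by rewrite ltcR.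
have := hl _ (nbhsx_ballx (l : R[i]^o) _ e0'); apply: ev_mono => n.
by rewrite /ball /= distrC => h; rewrite ltW// cabs_lt.
Qed.

Lemma ucompact_bounded (S : set C) : ucompact S -> exists c, forall z, S z -> cabs z <= c.
Proof.
move=> cS; apply: contrapT => hn.
have ex n : exists z, S z /\ n%:R < cabs z.
  apply: contrapT => h; apply: hn; exists n%:R => z Sz; rewrite leNgt; apply/negP => lt.
  by apply: h; exists z.
have [l _ hl] := cS (fun n => projT1 (cid (ex n))) (fun n => proj1 (projT2 (cid (ex n)))).
have l0 := cabs_ge0 l.
have [n [h1 h2]] := ev_ex (ev_and (hl 1 ltr01) (ev_ge (Num.bound (cabs l + 1)))).
move: h1; case: cid => z [Sz nz] /= h1.
have := archi_boundP (addr_ge0 l0 ler01); set N := Num.bound _ => hN.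
have : (N%:R : R) <= n%:R by rewrite ler_nat.
have := le_trans (cabs_sub_lower z l) h1; lra.
Qed.

Lemma ucompact_shift (S : set C) lam : ucompact S -> ucompact [set v - lam | v in S].
Proof.
move=> cS s hs; have hs' n : S (s n + lam) by have [v Sv <-] := hs n; rewrite subrK.
have [l Sl hl] := cS _ hs'; exists (l - lam); first by exists l.
by move=> e /hl; apply: ev_mono => n; rewrite opprB addrA.
Qed.

End Limits.
End Ultralimits.

(** * Solvability in the limit *)

Section LimitLemmas.
Variable R : realType.
Local Notation C := R[i].
Implicit Types (x y z s : int -> C) (p q : \bar R) (J : seq int) (I : set int) (a : tri R).

Definition tri_lim (an : nat -> tri R) a : Prop := forall i,
  [/\ ulim (fun n => lo (an n) i) (lo a i), ulim (fun n => di (an n) i) (di a i)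
    & ulim (fun n => up (an n) i) (up a i)].

Lemma tri_lim_cst a : tri_lim (fun=> a) a.
Proof. by move=> i; split; exact: ulim_cst. Qed.

Lemma tri_lim_tr an a : tri_lim an a -> tri_lim (fun n => tr (an n)) (tr a).
Proof.
by move=> h i; split; [have [] := h (i - 1)|have [] := h i|have [] := h (i + 1)].
Qed.

Lemma ulim_act an a (xn : nat -> int -> C) x i : tri_lim an a ->
  (forall i, ulim (fun n => xn n i) (x i)) ->
  ulim (fun n => act (an n) (xn n) i) (act a x i).
Proof.
move=> ha hx; have [h1 h2 h3] := ha i.
by apply: ulimD; [apply: ulimD|]; exact: ulimM.
Qed.

Lemma nb_ulim p (xn : nat -> int -> C) x M : (1 <= p)%E ->
  (forall i, ulim (fun n => xn n i) (x i)) -> ev (fun n => nb p (xn n) M) -> nb p x M.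
Proof.
move=> p1 hx hn; apply: (nb_lim p1) => J e e0.
have h i : i \in J -> ev (fun n => cabs (xn n i - x i) <= e) by move=> _; exact: hx.
have [n [h1 h2]] := ev_ex (ev_and hn (ev_seq h)); exists (xn n) => // i iJ.
by rewrite -cabsN opprB h2.
Qed.

(** The norm bound keeps each coordinate of the solutions bounded, hence convergent along the
    ultrafilter. An equation involves three coordinates only, so it passes to the limit. *)
Lemma solve_limit p (In : nat -> set int) I an a d (yn : nat -> int -> C) y M :
  (1 <= p)%E -> 0 <= d -> (forall i, ~ I i -> ev (fun n => ~ In n i)) ->
  (forall i, I i -> ev (fun n => In n i)) -> tri_lim an a ->
  ev (fun n => FSolve p (In n) (an n) d) ->
  ev (fun n => [/\ exists2 J, uniq J & forall i, i \notin J -> yn n i = 0,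
                   supp (In n) (yn n) & nb p (yn n) M]) ->
  (forall i, ulim (fun n => yn n i) (y i)) ->
  exists x, [/\ supp I x, forall i, I i -> act a x i = y i & nb p x (d * M)].
Proof.
move=> p1 d0 hI' hI ha hS hy hl.
have : ev (fun n => exists x, [/\ supp (In n) x, forall i, In n i -> act (an n) x i = yn n i
    & nb p x (d * M)]).
  apply: ev_mono (ev_and hS hy) => n [h [[J uJ yJ] sy ny]].
  have [x [sx ex nx]] := h (yn n) J uJ yJ sy; exists x; split=> //.
  by apply: nb_le nx; rewrite ler_wpM2l// lpn_le.
move=> hx.
pose P n x := [/\ supp (In n) x, forall i, In n i -> act (an n) x i = yn n i
    & nb p x (d * M)].
have [xn hxn] : exists xn : nat -> int -> C, ev (fun n => P n (xn n)).
  exists (fun n => if pselect (exists x, P n x) is left e then projT1 (cid e) else fun=> 0).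
  by apply: ev_mono hx => n ex; case: pselect => // e; case: cid.
have lx i : exists l, ulim (fun n => xn n i) l.
  apply: (ulim_bounded (M := d * M)); apply: ev_mono hxn => n [_ _ nx].
  exact: nb_point nx.
pose x i := projT1 (cid (lx i)).
have xP i : ulim (fun n => xn n i) (x i) by rewrite /x; case: cid.
exists x; split.
- move=> i Ii; apply: ulim_unique (xP i) _; apply: ulim_ev_cst.
  by apply: ev_mono (ev_and (hI' i Ii) hxn) => n [nI [h _ _]]; exact: h.
- move=> i Ii; apply: ulim_unique (ulim_act i ha xP) _.
  apply: (ulim_eq _ (hl i)).
  by apply: ev_mono (ev_and (hI i Ii) hxn) => n [nI [_ h _]]; rewrite h.
- by apply: nb_ulim xP _ => //; apply: ev_mono hxn => n [].
Qed.

Lemma fsolve_limit p (In : nat -> set int) I an a d :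
  (1 <= p)%E -> 0 <= d -> (forall i, ~ I i -> ev (fun n => ~ In n i)) ->
  (forall i, I i -> ev (fun n => In n i)) -> tri_lim an a ->
  ev (fun n => FSolve p (In n) (an n) d) -> FSolve p I a d.
Proof.
move=> p1 d0 hI' hI ha hS y J uJ yJ sy.
apply: (solve_limit (yn := fun=> y) p1 d0 hI' hI ha hS); last by move=> i; exact: ulim_cst.
(* [J] may leave [I]; only indices with nonzero [y] are known to lie in [I], hence eventually in
   [In n]. *)
pose J' := [seq i <- J | y i != 0].
have hJ' : ev (fun n => forall i, i \in J' -> In n i).
  apply: ev_seq => i; rewrite mem_filter => /andP[yi _]; apply: hI.
  by apply: contrapT => /sy yi0; rewrite yi0 eqxx in yi.
apply: ev_mono hJ' => n hn; split; first by exists J.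
  move=> i ni; have [//|yi] := eqVneq (y i) 0; case: ni; apply: hn.
  rewrite mem_filter yi /=; apply: contraT => /yJ yi0; by rewrite yi0 eqxx in yi.
exact: nb_lpn (nb_fin p1 uJ yJ).
Qed.

Lemma Good_limit p q (In : nat -> set int) I an a d :
  conj_exp p q -> 0 <= d -> (forall i, ~ I i -> ev (fun n => ~ In n i)) ->
  (forall i, I i -> ev (fun n => In n i)) -> tri_lim an a ->
  ev (fun n => Good p q (In n) (an n) d) -> Good p q I a d.
Proof.
move=> [p1 q1 _] d0 hI' hI ha hG; split.
  by apply: fsolve_limit p1 d0 hI' hI ha _; apply: ev_mono hG => n [].
apply: fsolve_limit q1 d0 hI' hI (tri_lim_tr ha) _; apply: ev_mono hG => n [].
by [].
Qed.

(** Removes the finite support of the right-hand side. Truncations need not converge in norm when p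
    = oo, but coordinatewise convergence is enough. *)
Lemma fsolve_solve p I a d y M : (1 <= p)%E -> 0 <= d -> FSolve p I a d ->
  supp I y -> nb p y M ->
  exists x, [/\ supp I x, forall i, I i -> act a x i = y i & nb p x (d * M)].
Proof.
move=> p1 d0 hS sy ny.
pose yn n := rest [set` win n] y.
apply: (@solve_limit p (fun=> I) I (fun=> a) a d yn) => //.
- by move=> i Ii; exact: ev_all.
- by move=> i Ii; exact: ev_all.
- exact: tri_lim_cst.
- exact: ev_all.
- apply: ev_all => n; split.
  + by exists (win n); [exact: win_uniq|by move=> i /negP ni; rewrite /yn rest_out].
  + by move=> i Ii; rewrite /yn /rest sy// if_same.
  + exact: nb_rest.
- move=> i; apply: ulim_ev_cst; apply: ev_mono (ev_ge (absz i)) => n hn.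
  by rewrite /yn restE //= mem_win; lia.
Qed.

End LimitLemmas.

(** * Off-diagonal decay and independence of the exponent *)

Section ExponentIndependence.
Variable R : realType.
Local Notation C := R[i].
Implicit Types (x y z : int -> C) (p q : \bar R) (J : seq int) (I : set int) (a : tri R).

Lemma expr_adjacent (rho : R) (e f : nat) : 1 <= rho -> (e <= f.+1)%N -> (f <= e.+1)%N ->
  `|rho ^+ e - rho ^+ f| <= (rho - 1) * rho ^+ f.
Proof.
move=> r1 ef fe; have r0 : 0 <= rho by lra.
have h n : 0 <= rho ^+ n by rewrite exprn_ge0.
have [->|[->|->]] : e = f \/ e = f.+1 \/ f = e.+1 by lia.
- by rewrite subrr normr0 mulr_ge0// subr_ge0.
- have -> : rho ^+ f.+1 - rho ^+ f = (rho - 1) * rho ^+ f by rewrite exprS; ring.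
  by rewrite ger0_norm// mulr_ge0// subr_ge0.
- have -> : rho ^+ e - rho ^+ e.+1 = - ((rho - 1) * rho ^+ e) by rewrite exprS; ring.
  rewrite normrN ger0_norm ?mulr_ge0// ?subr_ge0// ler_wpM2l ?subr_ge0//.
  by rewrite exprS ler_peMl.
Qed.

(* Combes-Thomas: conjugating by the bounded weight rho^min(|i-k|,N) perturbs
   the operator by O(rho - 1), uniformly in N. *)
Lemma inverse_decay p q I a c d (rho : R) k z K : conj_exp p q -> bnd a c -> 0 <= d ->
  BB p I a d -> 1 <= rho -> 4%:R * c * d * (rho - 1) <= 1 ->
  supp I z -> nb p z K -> (forall i, I i -> act a z i = delta R k i) ->
  forall i, cabs (z i) * rho ^+ (absz (i - k)) <= 2%:R * d.
Proof.
move=> cj ba d0 hB r1 hr sz nz ez i0; have [p1 q1 _] := cj.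
have c0 := bnd_ge0 ba.
have r0 : 0 < rho by lra.
(* The cap is |i0 - k|, so the weight at the index [i0] of interest is not cut. *)
pose m i := minn (absz (i - k)) (absz (i0 - k)).
pose D i : C := (rho ^+ m i)%:C%C.
have Dp i : 0 < rho ^+ m i by rewrite exprn_gt0.
have Dc i : cabs (D i) = rho ^+ m i by rewrite cabs_real ger0_norm// ltW.
have Dn0 i : D i != 0 by rewrite -cabs_gt0 Dc.
pose Dz i := D i * z i.
have nDz : nb p Dz (rho ^+ absz (i0 - k) * K).
  by apply: nb_scale_le => // i; rewrite Dc; apply: ler_weXn2l => //; exact: geq_minr.
set n := lpn p Dz.
have nn : nb p Dz n := nb_lpn p1 nDz.
have n0 : 0 <= n := lpn_ge0 p1 nDz.
have near i j (l : C) : (absz (i - j)%R <= 1)%N -> cabs l <= c ->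
    cabs (l * (D j - D i) / D j) <= c * (rho - 1).
  move=> ij lc; rewrite !cabsM cabsV Dc -mulrA; apply: ler_pM => //.
  - exact: cabs_ge0.
  - by rewrite divr_ge0 ?cabs_ge0// ltW.
  rewrite ler_pdivrMr// /D -rmorphB cabs_real distrC.
  by apply: expr_adjacent => //; rewrite /m; lia.
pose E1 i := (lo a i * (D (i - 1) - D i) / D (i - 1)) * Dz (i - 1).
pose E2 i := (up a i * (D (i + 1) - D i) / D (i + 1)) * Dz (i + 1).
have nE1 : nb p E1 (c * (rho - 1) * n).
  apply: nb_scale_le => //; last exact: (nb_comp p1 (addIr (-1)) nn).
  by move=> i; apply: near; [lia|have [] := ba i].
have nE2 : nb p E2 (c * (rho - 1) * n).
  apply: nb_scale_le => //; last exact: (nb_comp p1 (addIr 1) nn).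
  by move=> i; apply: near; [lia|have [] := ba i].
have actDz i : act a Dz i = D i * act a z i + E1 i + E2 i.
  rewrite /E1 /E2 /Dz !mulrA !divfK//.
  by rewrite /act; ring.
have sDz : supp I Dz by move=> i /sz zi; rewrite /Dz zi mulr0.
have nA : nb p (rest I (act a Dz)) (1 + c * (rho - 1) * n + c * (rho - 1) * n).
  apply: nb_dom (nb_add p1 (nb_add p1 (@nb_delta R p k p1) nE1) nE2) => // i.
  rewrite /rest; case: ifPn => [|_]; last by rewrite cabs0 cabs_ge0.
  rewrite inE => Ii; rewrite actDz ez//.
  suff -> : D i * delta R k i = delta R k i by [].
  rewrite /delta; case: eqP => [->|_]; last by rewrite mulr0.
  by rewrite mulr1 /D /m subrr absz0 min0n expr0.
have := hB _ _ _ sDz nDz nA => /(lpn_le p1); rewrite -/n => hn.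
(* The two perturbations contribute at most n / 2 by the choice of [rho], whence n <= d + n / 2. *)
have n2 : n <= 2%:R * d.
  have : d * (4%:R * (c * (rho - 1) * n)) <= n.
    have := ler_wpM2r n0 hr; rewrite mul1r; nra.
  by nra.
have := nb_point i0 p1 nn; rewrite cabsM Dc /m minnn mulrC => h.
exact: le_trans h n2.
Qed.

Lemma geometric_win (t : R) N : 0 <= t < 1 ->
  \sum_(i <- win N) t ^+ absz i <= 2%:R / (1 - t).
Proof.
move=> /andP[t0 t1].
suff -> : \sum_(i <- win N) t ^+ absz i = (1 + t - 2%:R * t ^+ N.+1) / (1 - t).
  have h : 0 <= t ^+ N.+1 by rewrite exprn_ge0.
  by rewrite ler_pM2r ?invr_gt0; lra.
have t1' : 1 - t != 0 by rewrite gt_eqF; lra.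
elim: N => [|N IH].
  have -> : win 0 = [:: 0] by rewrite /win /= subrr.
  by rewrite big_seq1 /= expr0 expr1; field.
have pe : perm_eq (win N.+1) [:: - (N.+1)%:Z, (N.+1)%:Z & win N].
  apply: uniq_perm; first exact: win_uniq.
    by rewrite 2!cons_uniq win_uniq in_cons !mem_win; lia.
  by move=> i; rewrite [LHS]mem_win 2!in_cons mem_win; lia.
rewrite (perm_big _ pe) 2!big_cons IH abszN !absz_nat (exprS _ N.+1).
move: (t ^+ N.+1) => T /=; field; exact: t1'.
Qed.

(** Schur's test along diagonals: the entries with i - k = m form a weighted translation of norm at
    most B t^|m|, and these norms are summed as a geometric series. *)
Lemma schur r I (zf : int -> int -> C) (B t M : R) J y : (1 <= r)%E -> 0 <= t < 1 -> 0 <= B ->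
  (forall k i, cabs (zf k i) <= B * t ^+ absz (i - k)) ->
  uniq J -> (forall i, i \notin J -> y i = 0) -> nb r y M ->
  nb r (fun i => \sum_(k <- J) y k * zf k i) (B * (2%:R / (1 - t)) * M).
Proof.
move=> r1 /andP[t0 t1] B0 hz uJ yJ ny; have M0 := nb_ge0 r1 ny.
apply: nb_lim => // L e e0.
have [N hN] : exists N, forall i k, i \in L -> k \in J -> i - k \in win N.
  have [N1 h1] := sub_win L; have [N2 h2] := sub_win J.
  exists (N1 + N2)%N => i k /(h1 _ (leqnn _)) + /(h2 _ (leqnn _)).
  by rewrite !mem_win; lia.
exists (fun i => \sum_(m <- win N) zf (i - m) i * y (i - m)).
  have h m : nb r (fun i => zf (i - m) i * y (i - m)) (B * t ^+ absz m * M).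
    apply: nb_scale_le => //; last exact: (nb_comp r1 (addIr (- m)) ny).
    by move=> i; have := hz (i - m) i; rewrite subKr.
  apply: nb_le (nb_sum (win N) r1 h).
  rewrite -mulr_suml -mulr_sumr ler_wpM2r// ler_wpM2l//.
  by apply: geometric_win; rewrite t0.
move=> i iL.
rewrite [X in X - _](_ : _ = \sum_(m <- win N) zf (i - m) i * y (i - m)).
  by rewrite subrr cabs0 ltW.
have iB : injective (fun m => i - m) by move=> m n /addrI /oppr_inj.
have uB : uniq [seq i - m | m <- win N] by rewrite map_inj_uniq ?win_uniq.
rewrite -(big_map (fun m => i - m) xpredT (fun k => zf k i * y k)).
rewrite (big_sub uJ uB).
- by apply: eq_bigr => k _; rewrite mulrC.
- move=> k kJ; apply/mapP; exists (i - k); first exact: hN.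
  by rewrite subKr.
- by move=> k /yJ ->; rewrite mulr0.
Qed.

(** The columns of the inverse decay at a rate that depends on [c] and [d] only, and a matrix with
    such decay is bounded on every l^r. The new bound is fixed before the operator, so it is uniform
    over a class. *)
Lemma fsolve_indep (c d : R) : 0 <= c -> 0 <= d -> exists2 d', 0 <= d' &
  forall p q r I a, conj_exp p q -> (1 <= r)%E -> bnd a c -> Good p q I a d ->
    FSolve r I a d'.
Proof.
move=> c0 d0; have cd : 0 <= c * d by rewrite mulr_ge0.
(* Then 4 c d (rho - 1) = c d / (c d + 1); the summand 1 covers c d = 0. *)
pose rho := 1 + (4%:R * (c * d + 1))^-1.
have ri : 0 < (4%:R * (c * d + 1))^-1 by rewrite invr_gt0; lra.
have r1 : 1 < rho by rewrite /rho; lra.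
have r0 : 0 < rho by lra.
have hr : 4%:R * c * d * (rho - 1) <= 1.
  rewrite /rho addrAC subrr add0r ler_pdivrMr; lra.
pose t := rho^-1.
have t1 : 0 <= t < 1 by rewrite invr_ge0 ltW//= invf_lt1.
exists (2%:R * d * (2%:R / (1 - t))).
  by case/andP: t1 => _ t1; rewrite !mulr_ge0// invr_ge0; lra.
move=> p q r I a cj r1' ba hG y J uJ yJ sy; have [p1 q1 _] := cj.
have hB := Good_BB cj ba d0 hG.
have ex k : exists z, [/\ supp I z, I k -> forall i, I i -> act a z i = delta R k i
    & forall i, cabs (z i) <= 2%:R * d * t ^+ absz (i - k)].
  case: (pselect (I k)) => Ik; last first.
    exists (fun=> 0); split=> // i; rewrite cabs0 mulr_ge0 ?mulr_ge0//.
    by rewrite exprn_ge0//; case/andP: t1.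
  have dk i : i \notin [:: k] -> delta R k i = 0 by rewrite inE /delta => /negbTE ->.
  have sd : supp I (delta R k).
    by move=> i Ii; rewrite /delta; case: eqP => // ik; case: Ii; rewrite ik.
  have [z [sz ez nz]] := proj1 hG (delta R k) [:: k] isT dk sd.
  exists z; split=> // i.
  have := inverse_decay cj ba d0 hB (ltW r1) hr sz nz ez i.
  by rewrite /t exprVn ler_pdivlMr// exprn_gt0.
pose zf k := projT1 (cid (ex k)).
have zfP k : [/\ supp I (zf k), I k -> forall i, I i -> act a (zf k) i = delta R k i
    & forall i, cabs (zf k i) <= 2%:R * d * t ^+ absz (i - k)] by rewrite /zf; case: cid.
exists (fun i => \sum_(k <- J) y k * zf k i); split.
- by move=> i Ii; rewrite big1// => k _; have [-> //] := zfP k; rewrite mulr0.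
- move=> i Ii; rewrite act_sum.
  rewrite -[RHS](sum_deltas _ uJ yJ); apply: eq_bigr => k _; rewrite actZ.
  case: (pselect (I k)) => Ik; first by have [_ -> //] := zfP k.
  by rewrite sy// !mul0r.
- apply: schur => //; first by rewrite mulr_ge0.
    by move=> k i; have [] := zfP k.
  exact: nb_lpn (nb_fin r1' uJ yJ).
Qed.

Lemma Good_indep (c d : R) : 0 <= c -> 0 <= d -> exists2 d', 0 <= d' &
  forall p q r s I a, conj_exp p q -> conj_exp r s -> bnd a c -> Good p q I a d ->
    Good r s I a d'.
Proof.
move=> c0 d0; have [d' d'0 h] := fsolve_indep c0 d0; exists d' => //.
move=> p q r s I a cj [r1 s1 _] ba hG; split; first exact: h hG.
exact: (h q p _ _ _ (conj_exp_sym cj) s1 (bnd_tr ba) (Good_tr hG)).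
Qed.

End ExponentIndependence.

(** * Reflections and translations *)

Section Symmetries.
Variable R : realType.
Local Notation C := R[i].
Implicit Types (x y z : int -> C) (p q : \bar R) (J : seq int) (I : set int) (a : tri R).

Definition shift (k : int) a : tri R :=
  Tri (fun i => lo a (i + k)) (fun i => di a (i + k)) (fun i => up a (i + k)).

Definition flip (k : int) a : tri R :=
  Tri (fun i => up a (k - i)) (fun i => di a (k - i)) (fun i => lo a (k - i)).

Lemma flip_tr k a : tr (flip k a) = flip k (tr a).
Proof.
by rewrite /tr /flip; congr Tri; apply/funext => i /=; congr (_ a _); lia.
Qed.

Lemma flipK k a : flip k (flip k a) = a.
Proof.
by case: a => l d u; rewrite /flip /=; congr Tri; apply/funext => i; rewrite subKr.
Qed.

Lemma act_shift k a x i : act (shift k a) x i = act a (fun j => x (j - k)) (i + k).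
Proof.
rewrite /act /= addrK.
have -> : i + k - 1 - k = i - 1 by lia.
by have -> : i + k + 1 - k = i + 1 by lia.
Qed.

Lemma act_flip k a x i : act (flip k a) x i = act a (fun j => x (k - j)) (k - i).
Proof.
rewrite /act /= subKr.
have -> : k - (k - i - 1) = i + 1 by lia.
have -> : k - (k - i + 1) = i - 1 by lia.
by ring.
Qed.

Lemma lpn_comp p (f : int -> int) x M : (1 <= p)%E -> involutive f -> nb p x M ->
  lpn p (x \o f) = lpn p x.
Proof.
move=> p1 fK nx; have fi := inv_inj fK.
apply/eqP; rewrite eq_le; apply/andP; split; apply: lpn_le => //.
  exact: nb_comp p1 fi (nb_lpn p1 nx).
have := nb_comp p1 fi (nb_lpn p1 (nb_comp p1 fi nx)).
by apply: nb_dom => // i /=; rewrite fK.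
Qed.

Lemma subKint (k : int) : involutive (fun i => k - i).
Proof. by move=> i; rewrite subKr. Qed.

Lemma fsolve_flip p I k a d : (1 <= p)%E -> FSolve p I a d ->
  FSolve p [set i | I (k - i)] (flip k a) d.
Proof.
move=> p1 h y J uJ yJ sy; have fi := inv_inj (@subKint k).
have uJ' : uniq [seq k - j | j <- J] by rewrite map_inj_uniq.
have yJ' i : i \notin [seq k - j | j <- J] -> y (k - i) = 0.
  move=> h'; apply: yJ; apply: contra h' => kJ; apply/mapP; exists (k - i) => //.
  by rewrite subKr.
have sy' : supp I (fun i => y (k - i)) by move=> i Ii; apply: sy; rewrite /= subKr.
have [x [sx ex nx]] := h _ _ uJ' yJ' sy'; exists (fun i => x (k - i)); split.
- by move=> i; exact: sx.
- move=> i /= Ii; rewrite act_flip.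
  have -> : (fun j => x (k - (k - j))) = x by apply/funext => j; rewrite subKr.
  by rewrite ex// subKr.
- have := nb_comp p1 fi nx.
  by rewrite (lpn_comp p1 (@subKint k) (nb_fin p1 uJ yJ)).
Qed.

Lemma Good_flip p q I k a d : conj_exp p q -> Good p q I a d ->
  Good p q [set i | I (k - i)] (flip k a) d.
Proof.
case=> p1 q1 _ [h1 h2]; split; first exact: fsolve_flip.
by rewrite flip_tr; exact: fsolve_flip.
Qed.

(** A translation is a product of two reflections, so invariance under reflections is enough. *)
Lemma shift_flip k a : shift k a = flip 0 (flip k a).
Proof. by rewrite /shift /flip /=; congr Tri; apply/funext => i; congr (_ a _); lia. Qed.

Lemma Good_shift p q I k a d : conj_exp p q -> Good p q I a d ->
  Good p q [set i | I (i + k)] (shift k a) d.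
Proof.
move=> cj h; rewrite shift_flip.
have := Good_flip 0 cj (Good_flip k cj h).
rewrite /= (_ : [set i | I (k - (0 - i))] = [set i | I (i + k)])//.
by apply/seteqP; split=> i /=; rewrite sub0r opprK addrC.
Qed.

End Symmetries.

(** * From finite blocks to near-null vectors on the half-line *)

Section FiniteSections.
Variable R : realType.
Local Notation C := R[i].
Implicit Types (x y z : int -> C) (p q : \bar R) (J : seq int) (I : set int) (a : tri R).
Implicit Types (U V W : set C).

(** The coefficients are constrained on all of Z, also outside the index set of a compression, so
    that shifts and periodic continuations stay in the class. *)
Definition Cls U V W a : Prop := forall i, [/\ U (lo a i), V (di a i) & W (up a i)].

Lemma Cls_tr U V W a : Cls U V W a -> Cls W V U (tr a).
Proof. by move=> h i; split; [have [] := h (i - 1)|have [] := h i|have [] := h (i + 1)]. Qed.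

Lemma Cls_flip U V W k a : Cls U V W a -> Cls W V U (flip k a).
Proof. by move=> h i; have [] := h (k - i). Qed.

Lemma Cls_shift U V W k a : Cls U V W a -> Cls U V W (shift k a).
Proof. by move=> h i; exact: h. Qed.

Definition Nat0 : set int := [set i | 0 <= i].
Definition Fin (n : nat) : set int := [set i | 0 <= i < n%:Z].

Lemma BB_ratio p I a d x K (th : R) : (1 <= p)%E -> 0 <= d -> d * th < 1 -> BB p I a d ->
  supp I x -> nb p x K -> nb p (rest I (act a x)) (th * lpn p x) -> forall i, x i = 0.
Proof.
move=> p1 d0 dth h sx nx nA; apply: (nb_eq0 p1).
have X0 := lpn_ge0 p1 nx; have := lpn_le p1 (h _ _ _ sx nx nA).
move=> hX; suff <- : lpn p x = 0 by exact: nb_lpn nx.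
apply/eqP; rewrite eq_le X0 andbT; nra.
Qed.

(** Failure is recorded as a ratio [th], because a ratio is insensitive to scaling and can be
    checked blockwise. *)
Lemma notBB_ratio p I a d : (1 <= p)%E -> 0 <= d -> ~ BB p I a d ->
  exists x th, [/\ supp I x, exists K, nb p x K, exists i, x i != 0,
                   0 <= th /\ d * th < 1 & nb p (rest I (act a x)) (th * lpn p x)].
Proof.
move=> p1 d0 h; apply: contrapT => hn; apply: h => x K M sx nx nM.
apply: contrapT => nd; apply: hn.
have M0 := nb_ge0 p1 nM; set X := lpn p x.
have nX : nb p x X := nb_lpn p1 nx.
have hX : d * M < X.
  by rewrite ltNge; apply/negP => le; apply: nd; apply: nb_le nX.
have Xp : 0 < X by apply: le_lt_trans hX; rewrite mulr_ge0.
exists x, (M / X); split=> //.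
- by exists K.
- apply: contrapT => x0.
  have z i : x i = 0 by apply/eqP; apply: contrapT => /negP xi; apply: x0; exists i.
  have : X <= 0 by apply: lpn_le => //; apply: nb_dom (nb_zero p1 (lexx 0)) => // i; rewrite z.
  by rewrite leNgt Xp.
- by split; [rewrite divr_ge0// ltW|rewrite mulrA ltr_pdivrMr// mul1r].
- by rewrite divfK// gt_eqF.
Qed.

(** Exact cancellation could require |r| = 1. Shrinking r by the factor 1 - t costs t |A|, which
    stays below eta. *)
Lemma damped_ratio (A B : C) (eta : R) : cabs A <= cabs B -> 0 < eta ->
  exists2 r : C, cabs r < 1 & cabs (A + r * B) <= eta.
Proof.
move=> AB e0; have A0 := cabs_ge0 A.
have [B0|B0] := eqVneq B 0.
  have -> : A = 0.
    by apply/eqP; rewrite -cabs_eq0 eq_le A0 andbT (le_trans AB)// B0 cabs0.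
  by exists 0; rewrite ?cabs0 ?ltr01// mul0r addr0 cabs0 ltW.
pose t := eta / (cabs A + eta).
have h0 : 0 < cabs A + eta by lra.
have t0 : 0 < t by rewrite divr_gt0.
have t1 : t <= 1 by rewrite ler_pdivrMr// mul1r; lra.
have Bp : 0 < cabs B by rewrite cabs_gt0.
exists (- ((1 - t)%:C%C * A / B)).
  rewrite cabsN !cabsM cabsV cabs_real ger0_norm ?subr_ge0// -mulrA.
  apply: (@le_lt_trans _ _ ((1 - t) * 1)); last lra.
  by rewrite ler_wpM2l ?subr_ge0// ler_pdivrMr// mul1r.
rewrite mulNr divfK// rmorphB rmorph1.
have -> : A - (1 - t%:C%C) * A = t%:C%C * A by ring.
rewrite cabsM cabs_real (ger0_norm (ltW t0)) /t mulrAC ler_pdivrMr//.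
by rewrite ler_pM2l//; lra.
Qed.

(** Arithmetic of blocks of length n + 1: n rows of the finite matrix and one separating row. *)
Lemma block_neg (k j : int) n : 0 <= j <= n%:Z -> k < 0 -> ~ 0 <= k * (n%:Z + 1) + j.
Proof. by move=> hj k0; nia. Qed.

Lemma block_sep (k l j : int) n : 0 <= j <= n%:Z -> l != k ->
  ~~ (0 <= k * (n%:Z + 1) + j - l * (n%:Z + 1) < n%:Z).
Proof. by move=> hj lk; apply/negP => h; case: (ltrP l k) => h'; nia. Qed.

Lemma block_lt (k j : int) n N : 0 <= j <= n%:Z -> 0 <= k ->
  - N%:Z <= k * (n%:Z + 1) + j <= N%:Z -> (0 <= absz k < 0 + N.+1)%N.
Proof. by move=> hj k0 h; nia. Qed.

(* The vector (x, 0, r x, 0, r^2 x, ...) is an approximate null vector of the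
   half-line matrix with diagonal blocks [a] separated by single rows. *)
Lemma periodic_notBB p U V W a n x (d th : R) (u w : C) : (1 <= p)%E -> 0 <= d ->
  Cls U V W a -> U u -> W w -> supp (Fin n) x -> (exists K, nb p x K) ->
  (exists i, x i != 0) -> 0 <= th -> d * th < 1 ->
  nb p (rest (Fin n) (act a x)) (th * lpn p x) ->
  cabs (u * x (n%:Z - 1)) <= cabs (w * x 0) ->
  exists2 b, Cls U V W b & ~ BB p Nat0 b d.
Proof.
move=> p1 d0 ca Uu Ww sx [K nx] [i0 xi0] th0 dth nA uw.
set X := lpn p x in nA; have nX : nb p x X := nb_lpn p1 nx.
have X0 : 0 < X.
  rewrite lt_def (lpn_ge0 p1 nx) andbT; apply/negP => /eqP X0.
  by have := nb_eq0 p1 (eq_ind _ (nb p x) nX _ X0) i0 => xi; rewrite xi eqxx in xi0.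
(* Part of the slack 1 - d th is reserved for the residual in the separating rows. *)
pose th' := th + (1 - d * th) / (2%:R * (d + 1)).
have hth : th < th' by rewrite ltrDl divr_gt0//; lra.
have dth' : d * th' < 1.
  suff : d * ((1 - d * th) / (2%:R * (d + 1))) < 1 - d * th by rewrite /th' mulrDr; lra.
  rewrite mulrA ltr_pdivrMr; last lra.
  rewrite mulrC ltr_pM2l; lra.
have eta0 : 0 < (th' - th) * X by rewrite mulr_gt0// subr_gt0.
have [r r1 hr] := damped_ratio uw eta0.
set e := _ + _ in hr.
have r0 := cabs_ge0 r.
pose m : int := n%:Z + 1.
have mp : 0 < m by rewrite /m; clear; lia.
have m0 : m != 0 by rewrite gt_eqF.
have blk (k j : int) : 0 <= j <= n%:Z -> ((k * m + j) %/ m)%Z = k /\ ((k * m + j) %% m)%Z = j.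
  move=> hj; have hj' : 0 <= j < `|m| by rewrite /m; clear -hj; lia.
  by rewrite divzMDl// divz_small// addr0 modzMDl modz_small.
have blkE (i : int) : exists k j, i = k * m + j /\ 0 <= j <= n%:Z.
  exists (i %/ m)%Z, (i %% m)%Z; split; first exact: divz_eq.
  by have := modz_ge0 i m0; have := ltz_mod i m0; rewrite /m; clear; lia.
(* Row n of each block is the separator: it couples to the last entry of its block through [u] and
   to the first entry of the next block through [w]. *)
pose b := Tri (fun i => if (i %% m)%Z == n%:Z then u else lo a (i %% m)%Z)
              (fun i => di a (i %% m)%Z)
              (fun i => if (i %% m)%Z == n%:Z then w else up a (i %% m)%Z).
pose z i := if 0 <= i then r ^+ absz (i %/ m)%Z * x (i %% m)%Z else 0.
have cb : Cls U V W b.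
  by move=> i; have [h1 h2 h3] := ca (i %% m)%Z; split=> //=; case: ifP.
have xn i : ~~ (0 <= i < n%:Z) -> x i = 0 by move=> /negP; exact: sx.
have zE (k j : int) : 0 <= k -> 0 <= j <= n%:Z -> z (k * m + j) = r ^+ absz k * x j.
  move=> k0 hj; have [h1 h2] := blk k j hj; rewrite /z h1 h2 ifT//.
  by case/andP: hj => j0 _; rewrite addr_ge0// mulr_ge0// ltW.
(* Residual of one block: that of [x], and [e] in the separating row. Block k carries r^k times
   it. *)
pose Y := fun j => rest (Fin n) (act a x) j + e * delta R n%:Z j.
have nY : nb p Y (th' * X).
  have := nb_add p1 nA (nb_scale e p1 (@nb_delta R p n%:Z p1)).
  by apply: nb_le; rewrite mulr1; lra.
have aE (k j : int) : 0 <= k -> 0 <= j <= n%:Z -> act b z (k * m + j) = r ^+ absz k * Y j.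
  move=> k0 hj; have [h1 h2] := blk k j hj.
  rewrite /act /= !h2 zE// /Y.
  have [jn|jn] := eqVneq j n%:Z.
    have -> : k * m + j + 1 = (k + 1) * m + 0 by rewrite jn /m; ring.
    rewrite zE; [|by clear -k0; lia|by clear; lia].
    have -> : absz (k + 1) = (absz k).+1 by clear -k0; lia.
    rewrite rest_out /Fin /=; last by rewrite jn; clear; lia.
    rewrite jn /delta eqxx mulr1 add0r (xn n%:Z) ?mulr0 ?addr0; last by clear; lia.
    have [n0|n0] := posnP n.
      have -> : z (k * m + n%:Z - 1) = 0.
        rewrite /z; case: ifP => // h; rewrite [x _]xn ?mulr0// n0; clear; lia.
      have x0z : x 0 = 0 by apply: xn; rewrite n0.
      have x1z : x (n%:Z - 1) = 0 by apply: xn; rewrite n0.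
      by rewrite /e x0z x1z; ring.
    have -> : k * m + n%:Z - 1 = k * m + (n%:Z - 1) by ring.
    rewrite zE; [|by []|by clear -n0; lia].
    by rewrite /e exprS; ring.
  have -> : k * m + j + 1 = k * m + (j + 1) by ring.
  rewrite zE; [|by []|by clear -hj jn; lia].
  rewrite restE /Fin /=; last by clear -hj jn; lia.
  rewrite /delta (negbTE jn) mulr0 addr0 /act.
  have [j0|j0] := eqVneq j 0.
    rewrite j0 addr0 (xn (0 - 1)) ?mulr0; last by clear; lia.
    suff -> : z (k * m - 1) = 0 by rewrite mulr0; ring.
    have [->|kn0] := eqVneq k 0; first by rewrite /z mul0r.
    have -> : k * m - 1 = (k - 1) * m + n%:Z by rewrite /m; ring.
    by rewrite zE ?(xn n%:Z) ?mulr0//; clear -k0 kn0; lia.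
  have -> : k * m + j - 1 = k * m + (j - 1) by ring.
  by rewrite zE; [ring|by []|by clear -hj j0; lia].
have szN : supp Nat0 z by move=> i /= h; rewrite /z ifF//; apply/negP.
(* [z] is a sum of shifted copies of [x] with weights r^k; the geometric series keeps its norm
   finite. *)
have nz : nb p z (X / (1 - cabs r)).
  apply: (nb_lim p1) => L ee ee0.
  have [N hN] := sub_win L; have {}hN := hN N (leqnn _).
  exists (fun i => \sum_(k <- iota 0 N.+1) r ^+ k * x (i - k%:Z * m)).
    have h k : nb p (fun i => r ^+ k * x (i - k%:Z * m)) (cabs r ^+ k * X).
      rewrite -cabsX; apply: nb_scale => //.
      exact: (nb_comp p1 (addIr _) nX).
    apply: nb_le (nb_sum _ p1 h); rewrite -mulr_suml mulrC ler_pM2l//.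
    have := @subrX1 _ (cabs r) N.+1; rewrite -(big_mkord xpredT (fun k => cabs r ^+ k)) => hs.
    rewrite /index_iota subn0 in hs.
    rewrite -[leRHS]mul1r ler_pdivlMr ?subr_gt0//.
    have : 0 <= cabs r ^+ N.+1 by rewrite exprn_ge0.
    by move: hs; lra.
  move=> i iL; have := hN i iL; rewrite mem_win => iN.
  suff -> : z i = \sum_(k <- iota 0 N.+1) r ^+ k * x (i - k%:Z * m) by rewrite subrr cabs0 ltW.
  have [k [j [iE hj]]] := blkE i.
  have other (l : nat) : l%:Z != k -> x (i - l%:Z * m) = 0.
    by move=> lk; apply: xn; rewrite iE; exact: (block_sep hj lk).
  have [k0|k0] := lerP 0 k; last first.
    rewrite /z ifF; last by apply/negP; rewrite iE; exact: (block_neg hj k0).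
    by rewrite big1// => l _; rewrite other ?mulr0//; clear -k0; lia.
  have kN : absz k \in iota 0 N.+1 by rewrite mem_iota; rewrite iE in iN; exact: (block_lt hj k0 iN).
  rewrite (bigD1_seq (absz k)) ?iota_uniq//= big1 ?addr0; last first.
    by move=> l lk; rewrite other ?mulr0//; clear -lk k0; lia.
  rewrite gez0_abs// {1}iE zE//; congr (_ * x _); rewrite iE; ring.
(* By [BB_ratio] it suffices to verify the ratio th', which is done on each block. *)
exists b => // hB; have z0 : forall i, z i = 0.
  apply: (BB_ratio p1 d0 dth' hB szN nz).
  apply: (@nb_blocks _ p (fun i => (i %/ m)%Z) _ z) (nb_lpn p1 nz) => //; first by lra.
  move=> k M nM; have M0 := nb_ge0 p1 nM.
  have th'0 : 0 <= th' by lra.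
  (* Blocks that carry nothing: the negative ones, and all after the first if r = 0. *)
  have zero : (k < 0) || (r ^+ absz k == 0) -> nb p
     (rest [set i | (i %/ m)%Z = k] (rest Nat0 (act b z))) (th' * M).
    move=> hk; apply: nb_dom (nb_zero p1 (mulr_ge0 th'0 M0)) => // i.
    rewrite {1}/rest; case: ifPn => //; rewrite inE /= => ik.
    rewrite /rest; case: ifPn => //; rewrite inE /Nat0 /= => i0'.
    have [k' [j [iE hj]]] := blkE i; have [h1 h2] := blk k' j hj.
    have kk : k' = k by rewrite -ik iE h1.
    rewrite iE kk; have k0 : 0 <= k.
      by rewrite -kk leNgt; apply/negP => k0; move: i0'; rewrite iE; exact: (block_neg hj k0).
    rewrite aE//; case/orP: hk => [|/eqP ->]; first by rewrite ltNge k0.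
    by rewrite mul0r.
  case: (boolP ((k < 0) || (r ^+ absz k == 0))) => [/zero//|].
  rewrite negb_or -leNgt => /andP[k0 rk].
  have rkp : 0 < cabs (r ^+ absz k) by rewrite cabs_gt0.
  have XM : X <= M / cabs (r ^+ absz k).
    apply: lpn_le => //; have := nb_scale (r ^+ absz k)^-1 p1 (nb_comp p1 (addIr (k * m)) nM).
    rewrite cabsV [_^-1 * M]mulrC; apply: nb_dom => // j /=.
    case: (boolP (0 <= j <= n%:Z)) => hj; last first.
      by rewrite (xn j) ?cabs0 ?cabs_ge0//; clear -hj; lia.
    rewrite addrC restE /=; last by have [] := blk k j hj.
    by rewrite zE// mulKf.
  have le1 : cabs (r ^+ absz k) * (th' * X) <= th' * M.
    by rewrite mulrC -mulrA ler_wpM2l// -ler_pdivlMr.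
  have nY' := nb_le le1 (nb_scale (r ^+ absz k) p1 (nb_comp p1 (addIr (- (k * m))) nY)).
  apply: nb_dom nY' => // i /=.
  rewrite {1}/rest; case: ifPn => [|_]; last by rewrite cabs0 cabs_ge0.
  rewrite inE /= => ik; rewrite /rest; case: ifPn => [|_]; last by rewrite cabs0 cabs_ge0.
  have [k' [j [iE hj]]] := blkE i; have [h1 h2] := blk k' j hj.
  have kk : k' = k by rewrite -ik iE h1.
  rewrite iE kk => _; rewrite aE//.
  by have -> : k * m + j - k * m = j by ring.
have := xi0; suff -> : x i0 = 0 by rewrite eqxx.
case: (boolP (0 <= i0 < n%:Z)) => hi; last exact: xn.
have := z0 (0 * m + i0); rewrite zE ?expr0 ?mul1r//; clear -hi; lia.
Qed.

Lemma supp_Fin_flip n x : supp (Fin n) x -> supp (Fin n) (fun i => x (n%:Z - 1 - i)).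
Proof. by move=> h i; rewrite /Fin /= => hi; apply: h; rewrite /Fin /=; lia. Qed.

Lemma Fin_flip n : [set i | Fin n (n%:Z - 1 - i)] = Fin n.
Proof. by apply/seteqP; split=> i; rewrite /Fin /=; lia. Qed.

(** Compare the two ends of a near-null vector of the block. If the end weighted by w dominates,
    continue it periodically; otherwise do so with the reflected block, whose class has U and W
    exchanged. *)
Lemma finite_BB p U V W (d : R) : (1 <= p)%E -> 0 <= d -> U !=set0 -> W !=set0 ->
  (forall b, Cls U V W b -> BB p Nat0 b d) ->
  (forall b, Cls W V U b -> BB p Nat0 b d) ->
  forall n a, Cls U V W a -> BB p (Fin n) a d.
Proof.
move=> p1 d0 [u Uu] [w Ww] h1 h2 n a ca; apply: contrapT => /(notBB_ratio p1 d0).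
move=> [x [th [sx nx x0 [th0 dth] nA]]].
case: (lerP (cabs (u * x (n%:Z - 1))) (cabs (w * x 0))) => [uw|/ltW uw].
  have [b cb] := periodic_notBB p1 d0 ca Uu Ww sx nx x0 th0 dth nA uw.
  by apply; exact: h1.
have [K nK] := nx.
have fi : injective (fun i : int => n%:Z - 1 - i) := inv_inj (@subKint (n%:Z - 1)).
have := @periodic_notBB p W V U (flip (n%:Z - 1) a) n (fun i => x (n%:Z - 1 - i)) d th w u
  p1 d0 (Cls_flip _ ca) Ww Uu (supp_Fin_flip sx).
case=> //.
- by exists K; exact: nb_comp.
- by have [i xi] := x0; exists (n%:Z - 1 - i); rewrite subKr.
- rewrite (lpn_comp p1 (@subKint (n%:Z - 1)) nK).
  have := nb_comp p1 fi nA; apply: nb_dom => // i /=.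
  case: (pselect (Fin n i)) => hi; last by rewrite rest_out// cabs0 cabs_ge0.
  have hi' : Fin n (n%:Z - 1 - i) by rewrite -(Fin_flip n) /= subKr.
  rewrite !restE// act_flip.
  by have -> : (fun j => x (n%:Z - 1 - (n%:Z - 1 - j))) = x by apply/funext => j; rewrite subKr.
- have -> : n%:Z - 1 - (n%:Z - 1) = 0 :> int by ring.
  by rewrite subr0.
- by move=> b cb; apply; exact: h2.
Qed.

End FiniteSections.

(** * Half-line operators: finite sections, null vectors, Coburn's lemma *)

Section HalfLine.
Variable R : realType.
Local Notation C := R[i].
Implicit Types (x y z : int -> C) (p q : \bar R) (J : seq int) (I : set int) (a b : tri R).
Implicit Types (U V W : set C).

(** An injective square matrix is invertible. [N] is the transposed block, since vectors are rows
    here. *)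
Lemma finite_solvable p n a d : (1 <= p)%E -> BB p (Fin n) a d ->
  forall k, Fin n k -> exists x, [/\ supp (Fin n) x,
     forall i, Fin n i -> act a x i = delta R k i & exists K, nb p x K].
Proof.
move=> p1 hB k hk.
pose vec (v : 'rV[C]_n) i := \sum_(j < n) v ord0 j * delta R (j : nat)%:Z i.
have vecE v (j : 'I_n) : vec v (j : nat)%:Z = v ord0 j.
  rewrite /vec (bigD1 j)//= /delta eqxx mulr1 big1 ?addr0// => l lj.
  rewrite eqz_nat; case: eqP => [e|]; last by rewrite mulr0.
  by rewrite -(inj_eq val_inj) /= e eqxx in lj.
have vecs v : supp (Fin n) (vec v).
  move=> i hi; rewrite /vec big1// => j _; rewrite /delta; case: eqP => [e|]; last by rewrite mulr0.
  by case: hi; rewrite /Fin /= e; have := ltn_ord j; clear; lia.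
have vecn v : nb p (vec v) (\sum_(i <- [seq j%:Z | j <- iota 0 n]) cabs (vec v i)).
  apply: nb_fin => //; first by rewrite map_inj_uniq ?iota_uniq// => ? ? [].
  move=> i hi; apply: vecs => h; move/negP: hi; apply; apply/mapP; exists (absz i).
    by rewrite mem_iota; move: h; rewrite /Fin /=; clear; lia.
  by move: h; rewrite /Fin /=; clear; lia.
pose N : 'M[C]_n := \matrix_(j, i) act a (delta R (j : nat)%:Z) (i : nat)%:Z.
have vecA v (i : 'I_n) : act a (vec v) (i : nat)%:Z = (v *m N) ord0 i.
  rewrite act_sum !mxE; apply: eq_bigr => j _; rewrite actZ mxE//.
have ordE i : Fin n i -> exists j : 'I_n, i = (j : nat)%:Z.
  rewrite /Fin /= => hi; have hj : (absz i < n)%N by clear -hi; lia.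
  by exists (Ordinal hj) => /=; clear -hi; lia.
have Ninj (v : 'rV[C]_n) : v *m N = 0 -> v = 0.
  move=> vN; apply/matrixP => i0 j; rewrite ord1 mxE -vecE.
  apply: (BB_inj p1 hB (vecs v) (vecn v)) => i /ordE[l ->].
  by rewrite vecA vN mxE.
have Nunit : N \in unitmx.
  rewrite -row_free_unit -kermx_eq0; apply/eqP/row_matrixP => i.
  by rewrite row0; apply: Ninj; rewrite -row_mul mulmx_ker row0.
have [l kl] := ordE k hk.
exists (vec (delta_mx ord0 l *m invmx N)); split.
- exact: vecs.
- move=> i /ordE[j ->]; rewrite vecA mulmxKV// mxE eqxx /= kl /delta eqz_nat.
  by rewrite -(inj_eq val_inj).
- by eexists; exact: vecn.
Qed.

(** Reflected blocks lead to half-line matrices over (W, V, U). These are transposes of matrices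
    over (U, V, W), so their lower bound on l^p comes from [Good q p]. *)
Lemma fin_of_plus p q U V W (c d : R) : conj_exp p q -> 0 <= d -> U !=set0 -> W !=set0 ->
  (forall a, Cls U V W a -> bnd a c) ->
  (forall a, Cls U V W a -> Good p q Nat0 a d) ->
  (forall a, Cls U V W a -> Good q p Nat0 a d) ->
  forall n a, Cls U V W a -> Good p q (Fin n) a d.
Proof.
move=> cj d0 U0 W0 hc h1 h2 n a ca; have [p1 q1 _] := cj.
have hB : BB p (Fin n) a d.
  apply: (finite_BB p1 d0 U0 W0 _ _ ca) => b cb.
    exact: Good_BB cj (hc b cb) d0 (h1 b cb).
  have cb' := Cls_tr cb.
  have bb : bnd b c by rewrite -(trK b); apply/bnd_tr/hc.
  apply: Good_BB cj bb d0 _; rewrite -(trK b); exact/Good_tr/h2.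
exact: BB_Good cj d0 hB (finite_solvable p1 hB).
Qed.

Lemma plus_of_fin p q U V W d : conj_exp p q -> 0 <= d ->
  (forall n a, (0 < n)%N -> Cls U V W a -> Good p q (Fin n) a d) ->
  forall a, Cls U V W a -> Good p q Nat0 a d /\ Good q p Nat0 a d.
Proof.
move=> cj d0 h a ca; have cj' := conj_exp_sym cj.
have h' n b : (0 < n)%N -> Cls U V W b -> Good q p (Fin n) b d.
  move=> n0 cb; have cf := Cls_flip (n%:Z - 1) (Cls_tr cb).
  have := Good_flip (n%:Z - 1) cj (h n _ n0 cf).
  by rewrite Fin_flip flipK => /Good_tr; rewrite trK.
have lim r s : conj_exp r s -> (forall n b, (0 < n)%N -> Cls U V W b -> Good r s (Fin n) b d) ->
    Good r s Nat0 a d.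
  move=> cjr hh; apply: (Good_limit (In := Fin) cjr d0 _ _ (tri_lim_cst a)).
  - by move=> i hi; apply: ev_all => n; move: hi; rewrite /Nat0 /Fin /=; clear; lia.
  - move=> i hi; apply: ev_mono (ev_ge (absz i).+1) => n; move: hi; rewrite /Nat0 /Fin /=.
    by clear; lia.
  - by apply: ev_mono (ev_ge 1) => n n0; exact: hh.
by split; apply: lim.
Qed.

Definition bounded x : Prop := exists M, nb +oo%E x M.

(** Null vectors are sought in l^oo, which is stable under uniformly bounded coordinatewise
    limits. *)
Definition kernel I a x : Prop :=
  [/\ supp I x, bounded x, exists i, x i != 0 & forall i, I i -> act a x i = 0].

Definition hker a : Prop := exists x, kernel Nat0 a x.

Definition binj U V W : Prop := forall a, Cls U V W a -> ~ exists x, kernel setT a x.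
Definition hinj U V W : Prop := forall a, Cls U V W a -> ~ hker a.

Lemma y1 : (1 <= +oo :> \bar R)%E.
Proof. exact: leey. Qed.

Lemma tri_lim_exists U V W (an : nat -> tri R) : ucompact U -> ucompact V -> ucompact W ->
  (forall n, Cls U V W (an n)) -> exists2 a, Cls U V W a & tri_lim an a.
Proof.
move=> cU cV cW h.
have hU i : exists2 l, U l & ulim (fun n => lo (an n) i) l.
  by apply: cU => n; have [] := h n i.
have hV i : exists2 l, V l & ulim (fun n => di (an n) i) l.
  by apply: cV => n; have [] := h n i.
have hW i : exists2 l, W l & ulim (fun n => up (an n) i) l.
  by apply: cW => n; have [] := h n i.
exists (Tri (fun i => s2val (cid2 (hU i))) (fun i => s2val (cid2 (hV i)))
            (fun i => s2val (cid2 (hW i)))) => i /=; by split; case: cid2.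
Qed.

(* Approximate null vectors either keep mass near the edge, and then converge to
   a null vector of the limit, or their translates converge to a null vector of
   a bi-infinite operator. *)
Lemma kernel_of_limit U V W (an : nat -> tri R) a (xn : nat -> int -> C) (en : nat -> R) :
  ucompact U -> ucompact V -> ucompact W -> binj U V W ->
  (forall n, Cls U V W (an n)) -> tri_lim an a ->
  (forall n, [/\ supp Nat0 (xn n), bounded (xn n) & exists i, xn n i != 0]) ->
  (forall n, 0 <= en n <= n.+1%:R^-1) ->
  (forall n, nb +oo%E (rest Nat0 (act (an n) (xn n))) (en n * lpn +oo%E (xn n))) ->
  hker a.
Proof.
move=> cU cV cW hb can ha hx he hn.
pose L n := lpn +oo%E (xn n).
have nL n : nb +oo%E (xn n) (L n) by have [_ [M nM] _] := hx n; exact: nb_lpn y1 nM.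
have L0 n : 0 < L n.
  have [_ _ [i xi]] := hx n; apply: lt_le_trans (nb_point i y1 (nL n)).
  by rewrite cabs_gt0.
(* An index where the sup norm is attained up to a factor 2; it locates the mass of the vector. *)
have exj n : exists j, L n / 2 <= cabs (xn n j).
  apply: contrapT => h; have := L0 n.
  suff : L n <= L n / 2 by have := L0 n; lra.
  apply: lpn_le; first exact: y1.
  apply/nb_supP => i; rewrite leNgt; apply/negP => lt; apply: h; exists i; exact: ltW.
pose j n := projT1 (cid (exj n)).
have hj n : L n / 2 <= cabs (xn n (j n)) by rewrite /j; case: cid.
have cj0 n : 0 < cabs (xn n (j n)) by have := hj n; have := L0 n; lra.
have jN n : 0 <= j n.
  rewrite leNgt; apply/negP => lt; have [sx _ _] := hx n; have := cj0 n.
  by rewrite sx ?cabs0 ?ltxx// /Nat0 /= leNgt lt.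
(* Normalized to the value 1 at [j n], which survives in the limit; the sup norm is then at most
   2. *)
pose xi n := (xn n (j n))^-1.
have hxi n : cabs (xi n) * L n <= 2%:R.
  rewrite /xi cabsV mulrC ler_pdivrMr//; have := hj n; lra.
pose z n i := xi n * xn n i.
have zb n i : cabs (z n i) <= 2%:R.
  apply: le_trans (hxi n); rewrite cabsM ler_wpM2l ?cabs_ge0//.
  exact: nb_point y1 (nL n).
have zj n : z n (j n) = 1 by rewrite /z mulVf// -cabs_gt0.
have zA n i : 0 <= i -> cabs (act (an n) (z n) i) <= 2%:R * n.+1%:R^-1.
  move=> i0; rewrite actZ cabsM.
  have /nb_supP/(_ i) := hn n; rewrite restE// -/(L n) => h.
  have /andP[e0 e1] := he n.
  apply: le_trans (ler_wpM2l (cabs_ge0 _) h) _.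
  rewrite mulrCA mulrC; apply: ler_pM => //.
  by rewrite mulr_ge0 ?cabs_ge0 ?ltW.
have lim0 (s : nat -> C) : ev (fun n => cabs (s n) <= 2%:R * n.+1%:R^-1) -> ulim s 0.
  move=> hs e e0; have e2 : 0 < e / 2%:R by lra.
  apply: ev_mono (ev_and hs (ev_small e2)) => n [h1 h2].
  rewrite subr0; apply: le_trans h1 _; move: h2; move: (n.+1%:R^-1 : R) => t; lra.
(* Either [j] is constant on a set of the ultrafilter, or it tends to infinity along it. *)
have [[k hk]|far] := pselect (exists k, ev (fun n => j n = k)).
  have lz i : exists l, ulim (fun n => z n i) l.
    by apply: (ulim_bounded (M := 2%:R)); apply: ev_all.
  pose x i := projT1 (cid (lz i)).
  have xP i : ulim (fun n => z n i) (x i) by rewrite /x; case: cid.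
  exists x; split.
  - move=> i hi; apply: ulim_unique (xP i) _; apply: ulim_ev_cst; apply: ev_all => n.
    by have [sx _ _] := hx n; rewrite /z sx ?mulr0.
  - by exists 2%:R; apply/nb_supP => i; apply: ulim_le (xP i) _; apply: ev_all.
  - exists k; have -> : x k = 1; last by rewrite oner_neq0.
    apply: ulim_unique (xP k) _; apply: ulim_ev_cst; apply: ev_mono hk => n <-.
    exact: zj.
  - move=> i hi; apply: ulim_unique (ulim_act i ha xP) _.
    by apply: lim0; apply: ev_all => n; exact: zA.
have far' m : ev (fun n => m%:Z <= j n).
  elim: m => [|m IH]; first exact: ev_all.
  have : ev (fun n => j n <> m%:Z).
    by case: (ev_dec (fun n => j n = m%:Z)) => // h; case: far; exists m%:Z.
  move=> h; apply: ev_mono (ev_and IH h) => n []; clear; lia.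
have [b cb hbl] := tri_lim_exists cU cV cW (fun n => Cls_shift (j n) (can n)).
pose y n i := z n (i + j n).
have ly i : exists l, ulim (fun n => y n i) l.
  by apply: (ulim_bounded (M := 2%:R)); apply: ev_all => n; exact: zb.
pose x i := projT1 (cid (ly i)).
have xP i : ulim (fun n => y n i) (x i) by rewrite /x; case: cid.
exfalso; apply: (hb b cb); exists x; split.
- by move=> i [].
- by exists 2%:R; apply/nb_supP => i; apply: ulim_le (xP i) _; apply: ev_all => n; exact: zb.
- exists 0; have -> : x 0 = 1; last by rewrite oner_neq0.
  apply: ulim_unique (xP 0) _; apply: ulim_ev_cst; apply: ev_all => n.
  by rewrite /y add0r.
- move=> i _; apply: ulim_unique (ulim_act i hbl xP) _; apply: lim0.
  apply: ev_mono (far' (absz i)) => n hni; rewrite act_shift.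
  have -> : (fun l => y n (l - j n)) = z n by apply/funext => l; rewrite /y subrK.
  by apply: zA; move: hni; clear; lia.
Qed.

Lemma BB_le p I a d d' : (1 <= p)%E -> d <= d' -> BB p I a d -> BB p I a d'.
Proof.
move=> p1 dd h x K M sx nx nM; apply: nb_le (h x K M sx nx nM).
by rewrite ler_wpM2r// (nb_ge0 p1 nM).
Qed.

(** Without a uniform bound there are near-null vectors of ratio at most 1 / (n + 1), and a limit of
    their matrices would have a null vector. *)
Lemma uniform_BB U V W : ucompact U -> ucompact V -> ucompact W -> binj U V W ->
  hinj U V W -> exists2 d, 0 <= d & forall a, Cls U V W a -> BB +oo%E Nat0 a d.
Proof.
move=> cU cV cW hb hh; apply: contrapT => hn.
pose P n (s : tri R * (int -> C) * R) := [/\ Cls U V W s.1.1, 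
  [/\ supp Nat0 s.1.2, bounded s.1.2 & exists i, s.1.2 i != 0],
  0 <= s.2 <= n.+1%:R^-1 &
  nb +oo%E (rest Nat0 (act s.1.1 s.1.2)) (s.2 * lpn +oo%E s.1.2)].
have ex n : exists s, P n s.
  have [a [ca na]] : exists a, Cls U V W a /\ ~ BB +oo%E Nat0 a n.+1%:R.
    apply: contrapT => h; apply: hn; exists n.+1%:R => // a ca; apply: contrapT => na.
    by apply: h; exists a.
  have n1 : (0 : R) <= n.+1%:R by rewrite ler0n.
  have [x [th [sx bx x0 [th0 dth] nA]]] := notBB_ratio y1 n1 na.
  exists (a, x, th); split=> //=; rewrite th0 /= -[leRHS]mul1r ler_pdivlMr ?ltr0n//.
  by rewrite mulrC ltW.
pose s n := projT1 (cid (ex n)).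
have sP n : P n (s n) by rewrite /s; case: cid.
have cs n : Cls U V W (s n).1.1 by have [] := sP n.
have [a ca ha] := tri_lim_exists cU cV cW cs.
apply: (hh a ca); apply: (kernel_of_limit cU cV cW hb cs ha (xn := fun n => (s n).1.2)
   (en := fun n => (s n).2)).
- by move=> n; have [] := sP n.
- by move=> n; have [] := sP n.
- by move=> n; have [] := sP n.
Qed.

Lemma Cls_bnd U V W : ucompact U -> ucompact V -> ucompact W ->
  exists2 c, 0 <= c & forall a, Cls U V W a -> bnd a c.
Proof.
move=> /ucompact_bounded[cu hu] /ucompact_bounded[cv hv] /ucompact_bounded[cw hw].
exists (Num.max 0 (Num.max cu (Num.max cv cw))); first by rewrite le_max lexx.
move=> a ca i; have [h1 h2 h3] := ca i.
by split; rewrite !le_max; rewrite ?(hu _ h1) ?(hv _ h2) ?(hw _ h3) ?orbT.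
Qed.

(** Surjectivity is obtained by a detour: lower bounds for both orientations give lower bounds for
    finite blocks, where they imply invertibility, and half-line solutions are limits of block
    solutions. *)
Lemma uniform_Good U V W : U !=set0 -> W !=set0 ->
  ucompact U -> ucompact V -> ucompact W -> binj U V W -> binj W V U ->
  hinj U V W -> hinj W V U ->
  exists2 d, 0 <= d & forall a, Cls U V W a -> Good +oo%E 1%E Nat0 a d.
Proof.
move=> U0 W0 cU cV cW b1 b2 h1 h2.
have [d1 d10 hd1] := uniform_BB cU cV cW b1 h1.
have [d2 d20 hd2] := uniform_BB cW cV cU b2 h2.
pose d := Num.max d1 d2.
have d0 : 0 <= d by rewrite le_max d10.
have cj : @conj_exp R +oo%E 1%E by apply/conj_exp_sym/conj_exp1y.
exists d => //; have hfin n a : (0 < n)%N -> Cls U V W a -> Good +oo%E 1%E (Fin n) a d.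
  move=> _ ca; have hB : BB +oo%E (Fin n) a d.
    apply: (finite_BB y1 d0 U0 W0 _ _ ca) => b cb.
      by apply: BB_le (hd1 b cb); rewrite ?y1// le_max lexx.
    by apply: BB_le (hd2 b cb); rewrite ?y1// le_max lexx orbT.
  exact: BB_Good cj d0 hB (finite_solvable y1 hB).
by move=> a ca; have [] := plus_of_fin cj d0 hfin ca.
Qed.

Section Glue.
Variables (a b : tri R) (u v w : C).

(* The half-line operator [a] on the indices i > 0, the reflection of [b] on the
   indices i < 0, and the row (u, v, w) in between. *)
Definition glue : tri R :=
  Tri (fun i => if 0 < i then lo a (i - 1) else if i < 0 then up b (- 1 - i) else u)
      (fun i => if 0 < i then di a (i - 1) else if i < 0 then di b (- 1 - i) else v)
      (fun i => if 0 < i then up a (i - 1) else if i < 0 then lo b (- 1 - i) else w).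

Lemma Cls_glue U V W : Cls U V W a -> Cls W V U b -> U u -> V v -> W w -> Cls U V W glue.
Proof.
move=> ca cb Uu Vv Ww i; have [a1 a2 a3] := ca (i - 1); have [b1 b2 b3] := cb (- 1 - i).
by split=> /=; case: ifP => // _; case: ifP.
Qed.

Definition gluev x y : int -> C := fun i => x (i - 1) + y (- 1 - i).

Variables x y : int -> C.
Hypotheses (sx : supp Nat0 x) (sy : supp Nat0 y).

Lemma act_glue i : act glue (gluev x y) i =
  if 0 < i then act a x (i - 1) else if i < 0 then act b y (- 1 - i)
  else u * y 0 + w * x 0.
Proof.
have x0 j : ~~ (0 <= j) -> x j = 0 by move/negP; exact: sx.
have y0 j : ~~ (0 <= j) -> y j = 0 by move/negP; exact: sy.
rewrite /act /glue /gluev /=; case: ifP => i0; last case: ifP => i1.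
- rewrite (y0 (- 1 - (i - 1))) ?(y0 (- 1 - i)) ?(y0 (- 1 - (i + 1))); [|clear -i0; lia..].
  have -> : i + 1 - 1 = i - 1 + 1 by clear; lia.
  by rewrite !addr0.
- rewrite (x0 (i - 1 - 1)) ?(x0 (i - 1)) ?(x0 (i + 1 - 1)); [|clear -i1; lia..].
  have -> : - 1 - (i + 1) = - 1 - i - 1 by clear; lia.
  have -> : - 1 - (i - 1) = - 1 - i + 1 by clear; lia.
  by rewrite !add0r; ring.
- have -> : i = 0 by clear -i0 i1; lia.
  rewrite (x0 (0 - 1 - 1)) ?(x0 (0 - 1)) ?(y0 (- 1 - 0)) ?(y0 (- 1 - (0 + 1))); [|clear; lia..].
  have -> : 0 + 1 - 1 = 0 :> int by clear; lia.
  have -> : - 1 - (0 - 1) = 0 :> int by clear; lia.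
  by rewrite !add0r !addr0 mulr0 addr0.
Qed.

End Glue.

Lemma supp_ge0 x i : supp Nat0 x -> x i != 0 -> 0 <= i.
Proof.
move=> sx; apply: contraNT => /negP h; apply/eqP; exact: sx.
Qed.

Lemma solve_linear2 (al be : C) : exists s r : C, [/\ al * s + be * r = 0 & (s != 0) || (r != 0)].
Proof.
have [b0|b0] := eqVneq be 0; last first.
  by exists (- be), al; split; [ring|rewrite oppr_eq0 b0].
by exists 0, 1; split; [rewrite b0; ring|rewrite oner_neq0 orbT].
Qed.

Lemma supp_scale I (c : C) x : supp I x -> supp I (fun i => c * x i).
Proof. by move=> h i /h ->; rewrite mulr0. Qed.

Lemma bounded_scale (c : C) x : bounded x -> bounded (fun i => c * x i).
Proof. by move=> [M h]; exists (cabs c * M); exact: nb_scale y1 h. Qed.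

Lemma nb_gluev p x y M N : (1 <= p)%E -> nb p x M -> nb p y N -> nb p (gluev x y) (M + N).
Proof.
move=> p1 nx ny; apply: (nb_add p1); first exact: (nb_comp p1 (addIr (- 1)) nx).
by apply: (nb_comp p1 (f := fun i => - 1 - i) _ ny); exact: inv_inj (@subKint (- 1)).
Qed.

(** Rescaling the two null vectors leaves two free coefficients, and the middle row imposes a single
    linear condition on them. *)
Lemma coburn U V W : U !=set0 -> V !=set0 -> W !=set0 -> binj U V W ->
  hinj U V W \/ hinj W V U.
Proof.
move=> [u Uu] [v Vv] [w Ww] hb; case: (pselect (hinj U V W)) => h; [by left|right].
move=> b cb [y [sy by_ [j yj] ey]]; apply: h => a ca [x [sx bx [i xi] ex]].
have [s [r [e sr]]] := solve_linear2 (u * y 0) (w * x 0).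
have sx' := supp_scale r sx; have sy' := supp_scale s sy.
apply: (hb _ (Cls_glue ca cb Uu Vv Ww)); exists (gluev (fun i => r * x i) (fun i => s * y i)).
split=> [k []//||| k _].
- have [M1 n1] := bounded_scale r bx; have [M2 n2] := bounded_scale s by_.
  by exists (M1 + M2); exact: nb_gluev y1 n1 n2.
- have i0 := supp_ge0 sx xi; have j0 := supp_ge0 sy yj.
  have [s0|s0] := eqVneq s 0.
    rewrite s0 eqxx /= in sr; exists (i + 1); rewrite /gluev addrK s0 mul0r addr0.
    by rewrite mulf_neq0.
  exists (- 1 - j); rewrite /gluev sx' ?add0r ?subKr ?mulf_neq0// /Nat0 /=.
  by clear -j0; lia.
- rewrite (act_glue _ _ _ _ _ sx' sy'); case: ifP => k0.
    by rewrite actZ ex ?mulr0// /Nat0 /=; clear -k0; lia.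
  case: ifP => k1; first by rewrite actZ ey ?mulr0// /Nat0 /=; clear -k1; lia.
  by rewrite -[RHS]e; ring.
Qed.

End HalfLine.

(** * Index trichotomy for half-line operators *)

Section Index.
Variable R : realType.
Local Notation C := R[i].
Implicit Types (x y z : int -> C) (p q : \bar R) (J : seq int) (I : set int) (a b : tri R).
Implicit Types (U V W : set C).

(** Stated at the exponent 2; by [inv_Good] and [Good_inv] any other exponent gives the same notion
    for bounded coefficients. *)
Definition inv I a : Prop := exists2 d, 0 <= d & Good 2%:E 2%:E I a d.

Definition biinv U V W : Prop := forall a, Cls U V W a -> inv [set: int] a.

Lemma inv_Good p q I a c : conj_exp p q -> 0 <= c -> bnd a c -> inv I a ->
  exists2 d, 0 <= d & Good p q I a d.
Proof.
move=> cj c0 ba [d d0 hG]; have [d' d'0 h] := Good_indep c0 d0.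
by exists d' => //; exact: (h _ _ _ _ _ _ (conj_exp2 R) cj ba hG).
Qed.

Lemma Good_inv p q I a c d : conj_exp p q -> 0 <= c -> bnd a c -> 0 <= d ->
  Good p q I a d -> inv I a.
Proof.
move=> cj c0 ba d0 hG; have [d' d'0 h] := Good_indep c0 d0.
by exists d' => //; exact: (h _ _ _ _ _ _ cj (conj_exp2 R) ba hG).
Qed.

Lemma biinv_swap U V W : biinv U V W -> biinv W V U.
Proof.
move=> h a ca; have [d d0 hG] := h _ (Cls_tr ca); exists d => //.
by rewrite -(trK a); exact: Good_tr.
Qed.

Lemma conj_expy1 : @conj_exp R +oo%E 1%E.
Proof. exact/conj_exp_sym/conj_exp1y. Qed.

Lemma inv_not_kernel I a c : 0 <= c -> bnd a c -> inv I a -> ~ exists x, kernel I a x.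
Proof.
move=> c0 ba ia [x [sx [M bx] [i xi] ex]].
have [d d0 hG] := inv_Good conj_expy1 c0 ba ia.
have hB := Good_BB conj_expy1 ba d0 hG.
by have := BB_inj (@y1 R) hB sx bx ex i => xi0; rewrite xi0 eqxx in xi.
Qed.

Lemma biinv_binj U V W : ucompact U -> ucompact V -> ucompact W -> biinv U V W -> binj U V W.
Proof.
move=> cU cV cW h a ca; have [c c0 hc] := Cls_bnd cU cV cW.
exact: inv_not_kernel c0 (hc a ca) (h a ca).
Qed.

Lemma inv_tr I a : inv I a -> inv I (tr a).
Proof. by move=> [d d0 h]; exists d => //; exact: Good_tr. Qed.

Lemma delta_supp I k : I k -> supp I (delta R k).
Proof. by move=> Ik i Ii; rewrite /delta; case: eqP => // ik; case: Ii; rewrite ik. Qed.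

Lemma delta_out k i : i \notin [:: k] -> delta R k i = 0.
Proof. by rewrite inE /delta => /negbTE ->. Qed.

Lemma act_rest_Nat0 a z i : 0 <= i -> act a (rest Nat0 z) i =
  act a z i - (if i == 0 then lo a 0 * z (- 1) else 0).
Proof.
move=> i0; rewrite /act (restE (I := Nat0) _ i0) (@restE _ Nat0 z (i + 1)); last first.
  by rewrite /Nat0 /=; clear -i0; lia.
case: eqP => [->|ni]; last by rewrite restE ?subr0// /Nat0 /=; clear -i0 ni; lia.
rewrite rest_out /Nat0 ?sub0r//=; ring.
Qed.

Lemma cond_pairing_delta x k : \sum_(i <- [:: k]) x i * delta R k i = x k.
Proof. by rewrite big_seq1 /delta eqxx mulr1. Qed.

Section Kernel.
Variables (U V W : set C) (a : tri R) (x : int -> C).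
Hypotheses (cU : ucompact U) (cV : ucompact V) (cW : ucompact W).
Hypotheses (hb : biinv U V W) (hh : hinj W V U) (ca : Cls U V W a) (kx : kernel Nat0 a x).

(** Extended by zero, a half-line null vector can violate row -1 only. *)
Lemma act_kernel i : act a x i = up a (- 1) * x 0 * delta R (- 1) i.
Proof.
have [sx _ _ ex] := kx.
have x0 j : ~~ (0 <= j) -> x j = 0 by move/negP; exact: sx.
rewrite /delta; case: eqP => [->|ni]; last case: (lerP 0 i) => i0.
- rewrite /act (x0 (- 1 - 1)) ?(x0 (- 1))//; have -> : -1 + 1 = 0 :> int by clear; lia.
  by rewrite !mulr0 !add0r mulr1.
- by rewrite ex// mulr0.
- rewrite /act (x0 (i - 1)) ?(x0 i) ?(x0 (i + 1)); [|clear -ni i0; lia..].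
  by rewrite !mulr0 !addr0.
Qed.

(** Otherwise [x] would be a bi-infinite null vector. *)
Lemma kernel_coef_neq0 : up a (- 1) * x 0 != 0.
Proof.
apply/eqP => e; have [sx bx x0 ex] := kx.
apply: (biinv_binj cU cV cW hb ca); exists x; split=> // [i []//|i _].
by rewrite act_kernel e mul0r.
Qed.

(* By index considerations C x = 0 makes the truncation of B^-1 e_0 solve C z = e_0:
   the row -1 of B^-1 vanishes on the half-line, because its restriction is a null
   vector of the transpose. *)
Lemma solve_delta0 p q : conj_exp p q -> exists z K,
  [/\ supp Nat0 z, nb p z K & forall i, 0 <= i -> act a z i = delta R 0 i].
Proof.
move=> cj; have [p1 q1 _] := cj; have [sx [Mx bx] x0 ex] := kx.
have [c c0 hc] := Cls_bnd cU cV cW; have ba := hc a ca.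
have [d d0 hG] := inv_Good conj_expy1 c0 ba (hb ca).
have T i : [set: int] i by [].
(* [eta] is row -1 of the bi-infinite inverse. *)
have [eta [_ eeta neta]] := proj2 hG (delta R (- 1)) [:: -1] isT (@delta_out _) (@supp_setT R _).
have out i : i \notin [:: -1] -> up a (- 1) * x 0 * delta R (- 1) i = 0.
  by move=> /delta_out ->; rewrite mulr0.
(* The pairing of [x] with e_{-1} is 0, since [x] lives on the half-line; it also equals the nonzero
   coefficient times [eta (- 1)]. *)
have eta1 : eta (- 1) = 0.
  have := pairing conj_expy1 ba bx neta (@supp_setT R _) (@supp_setT R _) eeta (fun i _ => act_kernel i)
    (J := [:: -1]) (J' := [:: -1]) isT isT (@delta_out _) out.
  rewrite cond_pairing_delta big_seq1 (sx (- 1))//.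
  have -> : delta R (- 1) (- 1) = 1 by rewrite /delta eqxx.
  move=> /esym/eqP; rewrite mulr1 mulf_eq0 (negbTE kernel_coef_neq0) /=.
  by move/eqP.
(* As [eta (- 1)] vanishes, the restriction of [eta] satisfies the transposed half-line equations
   and is zero by [hh]. *)
have eta0 : eta 0 = 0.
  case: (pselect (exists i, rest Nat0 eta i != 0)) => [[i hi]|h].
    exfalso; apply: (hh (Cls_tr ca)); exists (rest Nat0 eta); split.
    - exact: supp_rest.
    - by eexists; apply: nb_rest (@y1 R) _; apply/nb_supP => j; exact: nb_point neta.
    - by exists i.
    - move=> j hj; rewrite act_rest_Nat0// eeta// eta1 mulr0 if_same subr0.
      by rewrite /delta; case: eqP => // jj; move: hj; rewrite jj.
  apply/eqP; apply: contrapT => /negP e0; apply: h; exists 0.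
  by rewrite restE.
have [d' d'0 hG'] := inv_Good cj c0 ba (hb ca).
have [z [_ ez nz]] := proj1 hG' (delta R 0) [:: 0] isT (@delta_out _) (@supp_setT R _).
have [K nK] : exists K, nb q eta K.
  eexists; apply: (nb_l1 q1) => J uJ; have := proj1 (nb_sumP _ ltr01 (nb_ge0 _ neta)) neta J uJ.
  rewrite powRr1; last exact: nb_ge0 neta.
  by under eq_bigr do rewrite powRr1 ?cabs_ge0//; exact.
(* [z (- 1)] and [eta 0] are the same entry of the inverse, in row -1 and column 0. *)
have z1 : z (- 1) = 0.
  have := pairing cj ba nz nK (@supp_setT R _) (@supp_setT R _) eeta ez
    (J := [:: -1]) (J' := [:: 0]) isT isT (@delta_out _) (@delta_out _).
  by rewrite cond_pairing_delta big_seq1 eta0 mulr0.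
exists (rest Nat0 z), (d' * lpn p (delta R 0)); split.
- exact: supp_rest.
- exact: nb_rest.
- by move=> i i0; rewrite act_rest_Nat0// ez// z1 mulr0 if_same subr0.
Qed.

(** Truncating the bi-infinite solution spoils row 0 only, and [solve_delta0] repairs it. *)
Lemma solve_half p q y M : conj_exp p q -> supp Nat0 y -> nb p y M -> exists z K,
  [/\ supp Nat0 z, nb p z K & forall i, 0 <= i -> act a z i = y i].
Proof.
move=> cj sy ny; have [p1 q1 _] := cj.
have [c c0 hc] := Cls_bnd cU cV cW; have ba := hc a ca.
have [d d0 [hS _]] := inv_Good cj c0 ba (hb ca).
have [t [_ et nt]] := fsolve_solve p1 d0 hS (@supp_setT R y) ny.
have [z [K [sz nz ez]]] := solve_delta0 cj.
have := nb_add p1 (nb_rest Nat0 p1 nt) (nb_scale (lo a 0 * t (- 1)) p1 nz) => nn.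
eexists; eexists; split; [|exact: nn|move=> i i0].
  by move=> i i0; rewrite rest_out// sz// mulr0 addr0.
rewrite actD actZ act_rest_Nat0// et// ez// /delta.
by case: eqP => _; rewrite ?mulr1 ?subrK// mulr0 subr0 addr0.
Qed.

(** The bi-infinite solution in l^p for the residual of [x] agrees with [x], by injectivity on
    l^oo. *)
Lemma kernel_lp p q : conj_exp p q -> exists K, nb p x K.
Proof.
move=> cj; have [p1 q1 _] := cj; have [sx [Mx bx] x0 ex] := kx.
have [c c0 hc] := Cls_bnd cU cV cW; have ba := hc a ca.
have [d d0 [hS _]] := inv_Good cj c0 ba (hb ca).
have [d' d'0 hG] := inv_Good conj_expy1 c0 ba (hb ca).
have sJ i : i \notin [:: -1] -> up a (- 1) * x 0 * delta R (- 1) i = 0.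
  by move=> /delta_out ->; rewrite mulr0.
have [t [_ et nt]] := hS _ [:: -1] isT sJ (@supp_setT R _).
eexists; apply: (nb_dom p1 _ nt) => i; have e : x i - t i = 0; last first.
  by move/eqP: e; rewrite subr_eq0 => /eqP ->.
have nt' : nb +oo%E t (d * lpn p (fun i => up a (- 1) * x 0 * delta R (- 1) i)).
  by apply/nb_supP => j; exact: nb_point nt.
have nd : nb +oo%E (fun j => x j - t j) (Mx + cabs (-1 : C) * (d * lpn p (fun i => up a (- 1) * x 0 * delta R (- 1) i))).
  have := nb_add (@y1 R) bx (nb_scale (-1) (@y1 R) nt').
  by apply: (nb_dom (@y1 R)) => j; rewrite mulN1r.
apply: (BB_inj (@y1 R) (Good_BB conj_expy1 ba d'0 hG) (@supp_setT R _) nd) => j _.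
by rewrite actB et// act_kernel subrr.
Qed.

End Kernel.

Lemma kernel_ext a b x : (forall i, 0 <= i -> [/\ lo a i = lo b i, di a i = di b i & up a i = up b i]) ->
  kernel Nat0 a x -> kernel Nat0 b x.
Proof.
move=> h [sx bx x0 ex]; split=> // i hi; have [e1 e2 e3] := h i hi.
by rewrite -(ex i hi) /act e1 e2 e3.
Qed.

(** One row and column are put in front. The old rows can be solved for any leading entry s and any
    multiple r of the old null vector; the new row is one linear equation in (s, r). *)
Lemma kernel_prepend U V W a : ucompact U -> ucompact V -> ucompact W -> biinv U V W ->
  hinj W V U -> Cls U V W a -> hker (shift 1 a) -> hker a.
Proof.
move=> cU cV cW hb hh ca [x kx]; have [sx [Mx bx] [k xk] ex] := kx.
have [z [K [sz nz ez]]] := solve_delta0 cU cV cW hb hh (Cls_shift 1 ca) kx conj_expy1.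
set l := lo a 1.
have [s [r [e sr]]] := solve_linear2 (di a 0 - up a 0 * l * z 0) (up a 0 * x 0).
(* The part with [z] cancels what the new entry s adds to the old row 0 through the coefficient
   [l]. *)
pose f i := r * x i + (- (s * l)) * z i.
have sf : supp Nat0 f by move=> i hi; rewrite /f sx// sz// !mulr0 addr0.
have af i : 0 <= i -> act (shift 1 a) f i = - (s * l) * delta R 0 i.
  by move=> i0; rewrite actD !actZ ex// ez// mulr0 add0r.
pose t i := s * delta R 0 i + f (i - 1).
have f1 : f (0 - 1) = 0 by exact: sf.
have at0 i : act a t i = s * act a (delta R 0) i + act (shift 1 a) f (i - 1).
  rewrite actD actZ act_shift subrK; congr (_ + _).
exists t; split.
- move=> i hi; rewrite /t /delta sf; last by move: hi; rewrite /Nat0 /=; clear; lia.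
  by case: eqP => [e0|]; [case: hi; rewrite e0|rewrite mulr0 addr0].
- have := nb_add (@y1 R) (nb_scale r (@y1 R) bx) (nb_scale (- (s * l)) (@y1 R) nz) => nf.
  have := nb_add (@y1 R) (nb_scale s (@y1 R) (@nb_delta R _ 0 (@y1 R))) (nb_comp (@y1 R) (addIr (-1)) nf).
  by eexists; eassumption.
- have [s0|s0] := eqVneq s 0; last first.
    by exists 0; rewrite /t f1 addr0 /delta eqxx mulr1.
  rewrite s0 eqxx /= in sr; exists (k + 1).
  by rewrite /t addrK s0 mul0r add0r /f s0 mul0r oppr0 mul0r addr0 mulf_neq0.
- move=> i i0; rewrite at0.
  have d1 : delta R 0 (0 - 1) = 0 by [].
  have [ii|ni] := eqVneq i 0.
    have -> : act (shift 1 a) f (i - 1) = up a 0 * f 0.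
      rewrite ii /act /= (sf (0 - 1 - 1))// f1 !mulr0 !add0r.
      by have -> : 0 - 1 + 1 = 0 :> int by clear; lia.
    have d2 : delta R 0 (0 + 1) = 0 by [].
    have d3 : delta R 0 0 = 1 by [].
    by rewrite ii /act d1 d2 d3 -[RHS]e /f; ring.
  rewrite af; last by move: i0 ni; rewrite /Nat0 /=; clear; lia.
  have d2 : delta R 0 i = 0 by rewrite /delta (negbTE ni).
  have d3 : delta R 0 (i + 1) = 0.
    rewrite /delta; have -> // : (i + 1 == 0) = false.
    by move: i0; rewrite /Nat0 /=; clear; lia.
  rewrite /act d2 d3.
  have [i1|i1] := eqVneq i 1; first by rewrite i1 /l; ring.
  have -> : delta R 0 (i - 1) = 0; last by ring.
  by rewrite /delta subr_eq0 (negbTE i1).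
Qed.

(** Keep the first N rows of [b] and continue with [a]: prepending row by row gives this matrix a
    null vector. Then let N tend to infinity. *)
Lemma kernel_all U V W a : ucompact U -> ucompact V -> ucompact W -> biinv U V W ->
  hinj W V U -> Cls U V W a -> hker a -> forall b, Cls U V W b -> hker b.
Proof.
move=> cU cV cW hb hh ca ha.
have key (N : nat) : forall b, Cls U V W b -> exists b', [/\ Cls U V W b',
    forall i, i < N%:Z -> [/\ lo b' i = lo b i, di b' i = di b i & up b' i = up b i] & hker b'].
  elim: N => [|N IH] b cb.
    exists (Tri (fun i => if i < 0 then lo b i else lo a i)
                (fun i => if i < 0 then di b i else di a i)
                (fun i => if i < 0 then up b i else up a i)); split.
    - by move=> i /=; case: ifP.
    - by move=> i /= ->.
    - have [x kx] := ha; exists x; apply: kernel_ext kx => i i0 /=.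
      by rewrite ltNge i0.
  have [b1 [cb1 eb1 [x kx]]] := IH _ (Cls_shift 1 cb).
  pose b' := Tri (fun i => if i < 1 then lo b i else lo b1 (i - 1))
                (fun i => if i < 1 then di b i else di b1 (i - 1))
                (fun i => if i < 1 then up b i else up b1 (i - 1)).
  have cb' : Cls U V W b'.
    by move=> i /=; case: ifP => // _; exact: cb1.
  exists b'; split=> //.
    move=> i hi; rewrite /b' /=; case: ifPn => // i1.
    have hi' : i - 1 < N%:Z by clear -hi i1; lia.
    by have := eb1 _ hi'; rewrite /= subrK.
  apply: (kernel_prepend cU cV cW hb hh cb'); exists x; apply: kernel_ext kx => i i0 /=.
  have -> : (i + 1 < 1) = false by clear -i0; lia.
  by rewrite addrK.
move=> b cb.
pose bn n := projT1 (cid (key n b cb)).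
have bnP n : [/\ Cls U V W (bn n),
    forall i, i < n%:Z -> [/\ lo (bn n) i = lo b i, di (bn n) i = di b i & up (bn n) i = up b i]
    & hker (bn n)] by rewrite /bn; case: cid.
have hx n : exists x, kernel Nat0 (bn n) x by have [] := bnP n.
pose xn n := projT1 (cid (hx n)).
have xnP n : kernel Nat0 (bn n) (xn n) by rewrite /xn; case: cid.
apply: (kernel_of_limit cU cV cW (biinv_binj cU cV cW hb) (an := bn) (xn := xn) (en := fun=> 0)).
- by move=> n; have [] := bnP n.
- have h i : ev (fun n => [/\ lo (bn n) i = lo b i, di (bn n) i = di b i & up (bn n) i = up b i]).
    apply: ev_mono (ev_ge (absz i).+1) => n hn; have [_ h _] := bnP n; apply: h.
    by clear -hn; lia.
  by move=> i; split; apply: ulim_ev_cst; apply: ev_mono (h i) => n [].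
- by move=> n; have [sx bx x0 _] := xnP n.
- by move=> n; rewrite lexx invr_ge0 ler0n.
- move=> n; rewrite mul0r; apply: nb_dom (nb_zero (@y1 R) (lexx 0)); first exact: y1.
  move=> i; rewrite /rest; case: ifPn => //; rewrite inE => hi.
  by have [_ _ _ ->] := xnP n.
Qed.

(** The cases correspond to the indices 0, 1 and -1. *)
Lemma index_trichotomy U V W : U !=set0 -> V !=set0 -> W !=set0 ->
  ucompact U -> ucompact V -> ucompact W -> biinv U V W ->
  [\/ exists2 d, 0 <= d & forall a, Cls U V W a -> Good +oo%E 1%E Nat0 a d,
      hinj W V U /\ forall a, Cls U V W a -> hker a |
      hinj U V W /\ forall a, Cls W V U a -> hker a].
Proof.
move=> U0 V0 W0 cU cV cW hb; have hb' := biinv_swap hb.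
have b1 := biinv_binj cU cV cW hb; have b2 := biinv_binj cW cV cU hb'.
case: (pselect (hinj U V W)) => h1; case: (pselect (hinj W V U)) => h2.
- by constructor 1; exact: uniform_Good.
- constructor 3; split=> //.
  have [a [ca ha]] : exists a, Cls W V U a /\ hker a.
    by apply: contrapT => h; apply: h2 => a ca ha; apply: h; exists a.
  exact: kernel_all cW cV cU hb' h1 ca ha.
- constructor 2; split=> //.
  have [a [ca ha]] : exists a, Cls U V W a /\ hker a.
    by apply: contrapT => h; apply: h1 => a ca ha; apply: h; exists a.
  exact: kernel_all cU cV cW hb h2 ca ha.
- by exfalso; case: (coburn U0 V0 W0 b1).
Qed.

End Index.

(** * Translation between matrices and coefficient sequences *)

Section Transport.
Variable R : realType.
Local Notation C := R[i].
Implicit Types (p q : \bar R) (a : tri R) (U V W : set C).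

Definition mat a (i j : int) : C :=
  if i == j + 1 then lo a i else if i == j then di a i else if j == i + 1 then up a i else 0.

Section Index.
Variables (K : choiceType) (pos : K -> int).
Hypothesis pos_inj : injective pos.

Definition represents a (A : K -> K -> C) : Prop := forall k l, A k l = mat a (pos k) (pos l).

Lemma tridiagonal_coefs U V W (A : K -> K -> C) : U !=set0 -> V !=set0 -> W !=set0 ->
  tridiagonal pos U V W A -> exists2 a, Cls U V W a & represents a A.
Proof.
move=> [u0 Uu] [v0 Vv] [w0 Ww] tA.
(* Coefficients that correspond to no matrix entry get a default value in the class. *)
pose f (s : int) (e : C) (i : int) : C := if pselect (exists kl : K * K, pos kl.1 = i /\ pos kl.2 = i + s)
  is left h then A (projT1 (cid h)).1 (projT1 (cid h)).2 else e.
have fE s e k l : pos l = pos k + s -> f s e (pos k) = A k l.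
  move=> hl; rewrite /f; case: pselect => [h|[]]; last by exists (k, l).
  by case: cid => -[k' l'] /= [/pos_inj -> e']; congr (A _ _); apply: pos_inj; rewrite e'.
exists (Tri (f (-1) u0) (f 0 v0) (f 1 w0)).
  move=> i; split; rewrite /= /f; case: pselect => // h; case: cid => -[k l] /= [e1 e2];
    have [h1 h2 h3 _] := tA k l.
  - by apply: h1; rewrite e1 e2; clear; lia.
  - by apply: h2; rewrite e1 e2; clear; lia.
  - by apply: h3; rewrite e1 e2.
move=> k l; rewrite /mat /=; have [h1 h2 h3 h4] := tA k l.
case: eqP => [e|n1]; first by rewrite (fE (-1) _ k l)// e; clear; lia.
case: eqP => [e|n2]; first by rewrite (fE 0 _ k l)// e; clear; lia.
case: eqP => [e|n3]; first by rewrite (fE 1 _ k l)// e; clear; lia.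
by rewrite h4//; move: n1 n2 n3; clear; lia.
Qed.

Lemma coefs_tridiagonal U V W a : Cls U V W a ->
  tridiagonal pos U V W (fun k l => mat a (pos k) (pos l)).
Proof.
move=> ca k l; have [h1 h2 h3] := ca (pos k); rewrite /mat; split=> [e|e|e|h].
- by rewrite e eqxx -e.
- by rewrite e; have -> : (pos l == pos l + 1) = false by [clear; lia]; rewrite eqxx -e.
- rewrite e; have -> : (pos k == pos k + 1 + 1) = false by clear; lia.
  by have -> : (pos k == pos k + 1) = false by [clear; lia]; rewrite eqxx.
- have -> : (pos k == pos l + 1) = false by clear -h; lia.
  have -> : (pos k == pos l) = false by clear -h; lia.
  by have -> : (pos l == pos k + 1) = false by clear -h; lia.
Qed.

(** The sum reduces to the at most three columns adjacent to row k; neighbours outside the range of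
    [pos] contribute zero through [push]. *)
Lemma mxactE a (A : K -> K -> C) (x : K -> C) k : represents a A ->
  mxact A x k = act a (push pos x) (pos k).
Proof.
move=> hA.
have hs (t : int) : exists s : seq K, [/\ uniq s, forall l, (l \in s) = (pos l == t) &
    forall c : C, \sum_(l <- s) c * x l = c * push pos x t].
  case: (pselect (range pos t)) => [[l0 _ <-]|nt].
    exists [:: l0]; split=> // [l|c]; first by rewrite inE (inj_eq pos_inj).
    by rewrite big_seq1 pushE.
  exists [::]; split=> // [l|c]; last by rewrite big_nil push0// mulr0.
  by rewrite in_nil; apply/esym/eqP => lt; apply: nt; exists l.
have [s1 [u1 m1 e1]] := hs (pos k - 1).
have [s2 [u2 m2 e2]] := hs (pos k).
have [s3 [u3 m3 e3]] := hs (pos k + 1).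
have us : uniq (s1 ++ s2 ++ s3).
  rewrite !cat_uniq u1 u2 u3 /= andbT; apply/andP; split; apply/hasPn => l.
    by rewrite mem_cat m2 m3 m1; clear; lia.
  by rewrite m3 m2; clear; lia.
rewrite /mxact -(@fsbig_widen _ _ _ _ [set` s1 ++ s2 ++ s3] [set: K]) //; last first.
  move=> l [_ /= /negP]; rewrite !mem_cat m1 m2 m3 hA /mat !negb_or => /and3P[n1 n2 n3].
  have -> : (pos k == pos l + 1) = false by move: n1; clear; lia.
  have -> : (pos k == pos l) = false by rewrite eq_sym (negbTE n2).
  by rewrite (negbTE n3) mul0r.
rewrite -fsbig_seq// !big_cat /= /act -e1 -e2 -e3 addrA.
congr (_ + _ + _); apply: eq_big_seq => l.
- rewrite m1 => /eqP h; rewrite hA /mat h.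
  by have -> : (pos k == pos k - 1 + 1) by clear; lia.
- rewrite m2 => /eqP h; rewrite hA /mat h eqxx.
  by have -> : (pos k == pos k + 1) = false by clear; lia.
- rewrite m3 => /eqP h; rewrite hA /mat h eqxx.
  have -> : (pos k == pos k + 1 + 1) = false by clear; lia.
  by have -> : (pos k == pos k + 1) = false by clear; lia.
Qed.

Lemma lpP p (x : K -> C) : lp p x <-> exists2 M, 0 <= M & nb p x M.
Proof.
rewrite /lp /nb /=; split=> [|[M _ h]]; last by apply: le_lt_trans h _; exact: ltry.
case: (lpnorm p x) => [r||]// _; last by exists 0; rewrite ?leNye.
by exists (Num.max 0 r); rewrite ?le_max ?lexx// lee_fin le_max lexx orbT.
Qed.

Lemma push_zero : push pos (fun=> 0 : C) = fun=> 0.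
Proof. by apply/funext => i; rewrite /push; case: pselect. Qed.

Lemma mxact_zero a (A : K -> K -> C) : represents a A -> mxact A (fun=> 0) = fun=> 0.
Proof. by move=> rA; apply/funext => k; rewrite (mxactE _ _ rA) push_zero act0. Qed.

Lemma lp_zero p : (1 <= p)%E -> lp p (fun _ : K => 0 : C).
Proof.
by move=> p1; apply/lpP; exists 0 => //; rewrite -(nb_push pos_inj)// push_zero; exact: nb_zero.
Qed.

Definition pull (x : int -> C) : K -> C := fun k => x (pos k).

Lemma push_pull (x : int -> C) : push pos (pull x) = rest (range pos) x.
Proof.
apply/funext => i; case: (pselect (range pos i)) => [[k _ <-]|ni].
  by rewrite pushE// restE.
by rewrite push0// rest_out.
Qed.

Lemma supp_push (x : K -> C) : supp (range pos) (push pos x).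
Proof. by move=> i /push0 ->. Qed.

Lemma BB_mxact p a (A : K -> K -> C) d x M : (1 <= p)%E -> 0 <= d -> represents a A ->
  BB p (range pos) a d -> lp p x -> 0 <= M -> nb p (mxact A x) M -> nb p x (d * M).
Proof.
move=> p1 d0 hA hB /lpP[N N0 nx] M0 ny.
rewrite -(nb_push pos_inj) ?mulr_ge0//.
apply: (hB _ N) (@supp_push _) _ _; first by rewrite nb_push.
rewrite (_ : rest _ _ = push pos (mxact A x)); first by rewrite nb_push.
apply/funext => i; case: (pselect (range pos i)) => [[k _ <-]|ni].
  by rewrite pushE// restE// -(mxactE _ _ hA).
by rewrite push0// rest_out.
Qed.

Lemma BB_inverse p a (A : K -> K -> C) T d : (1 <= p)%E -> 0 <= d -> represents a A ->
  BB p (range pos) a d -> (forall x, lp p x -> lp p (T x) /\ mxact A (T x) = x) ->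
  (opnorm p T <= d%:E)%E.
Proof.
move=> p1 d0 hA hB hT; apply: ge_ereal_sup => _ [y /= ny <-].
have [|l AT] := hT y; first by apply/lpP; exists 1.
by have := BB_mxact p1 d0 hA hB l ler01; rewrite AT mulr1; exact.
Qed.

(** A bounded inverse gives a lower bound, and its values at unit vectors are the required
    solutions. Conversely an inverse is chosen pointwise among solutions, and the lower bound makes
    it unique and bounded. *)
Lemma invnormP p q a (A : K -> K -> C) c d : conj_exp p q -> 0 <= d -> bnd a c ->
  represents a A -> (invnorm p A <= d%:E)%E <-> Good p q (range pos) a d.
Proof.
move=> cj d0 ba hA; have [p1 q1 _] := cj; split.
  rewrite /invnorm; case: pselect => // e; case: cid => T /= [_ hT] nT.
  have hB : BB p (range pos) a d.
    move=> x K0 M sx nx nM; apply: nb_approx => e0 e00.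
    (* [opnorm] tests the unit ball, so [x] is divided by a bound of its image; the extra summand
       makes this bound positive and costs at most e0. *)
    pose M' := M + e0 / (d + 1).
    have M0 := nb_ge0 p1 nM.
    have M'0 : 0 < M' by rewrite ltr_wpDl// divr_gt0//; lra.
    have hM' : d * M' <= d * M + e0.
      rewrite /M' mulrDr lerD2l mulrCA ler_piMr//; first exact: ltW.
      by rewrite ler_pdivrMr; lra.
    pose t : C := (M'^-1)%:C%C.
    pose x' := pull (fun i => t * x i).
    have px' : push pos x' = fun i => t * x i.
      by rewrite push_pull; apply/funext => i; rewrite rest_supp//; exact: supp_scale.
    have lx' : lp p x'.
      apply/lpP; exists (cabs t * K0); first by rewrite mulr_ge0 ?cabs_ge0 ?(nb_ge0 p1 nx).
      rewrite -(nb_push pos_inj) ?px'//; first exact: nb_scale.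
      by rewrite mulr_ge0 ?cabs_ge0 ?(nb_ge0 p1 nx).
    have tE : cabs t = M'^-1 by rewrite cabs_real ger0_norm// invr_ge0 ltW.
    have ny : nb p (mxact A x') 1.
      rewrite -(nb_push pos_inj)// ?ler01//.
      have := nb_scale t p1 nM; rewrite tE => h.
      apply: nb_le (_ : M'^-1 * M <= 1) _.
        by rewrite mulrC ler_pdivrMr// mul1r lerDl divr_ge0//; lra.
      apply: nb_dom p1 _ h => i; case: (pselect (range pos i)) => [[k _ <-]|ni].
        by rewrite pushE// (mxactE _ _ hA) px' restE// actZ.
      by rewrite push0// cabs0 cabs_ge0.
    have [_ Tx _] := hT x' lx'.
    have nx' : nb p x' d.
      apply: le_trans nT; rewrite -{1}Tx; apply: ereal_sup_ubound.
      by exists (mxact A x').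
    have := (proj2 (nb_push pos_inj x' p1 d0)) nx'; rewrite px' => h.
    have := nb_scale (t^-1) p1 h; rewrite cabsV tE invrK [M' * d]mulrC => h'.
    apply: nb_le hM' _; apply: nb_dom p1 _ h' => i.
    by rewrite mulKf// -cabs_gt0 tE invr_gt0.
  apply: (BB_Good cj d0 hB) => k [k0 _ kk].
  have ld : lp p (pull (delta R k)).
    apply/lpP; exists 1 => //; rewrite -(nb_push pos_inj)// push_pull.
    by apply: (nb_rest _ p1); exact: nb_delta.
  have [/lpP[M M0 nTy] _ AT] := hT _ ld.
  exists (push pos (T (pull (delta R k)))); split.
  - exact: supp_push.
  - by move=> _ [l _ <-]; rewrite -(mxactE _ _ hA) AT.
  - by exists M; rewrite nb_push.
move=> hG; have hB := Good_BB cj ba d0 hG.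
have uniqA (x y : K -> C) : lp p x -> lp p y -> mxact A x = mxact A y -> x = y.
  move=> /lpP[M M0 nx] /lpP[N N0 ny] e; apply/funext => k.
  rewrite -(pushE pos_inj x) -(pushE pos_inj y); apply/eqP; rewrite -subr_eq0; apply/eqP.
  move: (pos k); apply: (@BB_inj _ p (range pos) a d _ (M + cabs (-1 : C) * N)) => //.
  - by move=> i ni; rewrite !push0// subr0.
  - have := nb_add p1 (proj2 (nb_push pos_inj x p1 M0) nx)
      (nb_scale (-1) p1 (proj2 (nb_push pos_inj y p1 N0) ny)).
    by apply: (nb_dom p1) => i; rewrite mulN1r.
  - by move=> _ [l _ <-]; rewrite actB -!(mxactE _ _ hA) e subrr.
have solA (y : K -> C) : lp p y -> exists x, lp p x /\ mxact A x = y.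
  move=> /lpP[M M0 ny].
  have [x [sx ex nx]] := fsolve_solve p1 d0 (proj1 hG) (supp_push y)
    (proj2 (nb_push pos_inj y p1 M0) ny).
  have px : push pos (pull x) = x by rewrite push_pull; apply/funext => i; rewrite rest_supp.
  exists (pull x); split.
    apply/lpP; exists (d * M); first by rewrite mulr_ge0.
    by rewrite -(nb_push pos_inj) ?px// mulr_ge0.
  by apply/funext => k; rewrite (mxactE _ _ hA) px ex ?pushE.
pose T y := if pselect (exists x, lp p x /\ mxact A x = y) is left h
  then projT1 (cid h) else y.
have TP y : (exists x, lp p x /\ mxact A x = y) -> lp p (T y) /\ mxact A (T y) = y.
  by rewrite /T; case: pselect => // h _; case: cid.
have Tinv : is_inverse p A T.
  have h x : lp p x -> [/\ lp p (T x), T (mxact A x) = x & mxact A (T x) = x].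
    move=> lx; have [l1 e1] := TP _ (solA _ lx).
    have [l2 e2] := TP (mxact A x) (ex_intro _ x (conj lx erefl)).
    by split=> //; exact: uniqA.
  split=> //; apply: le_lt_trans (ltry d); apply: (BB_inverse p1 d0 hA hB).
  by move=> x /h [].
rewrite /invnorm; case: pselect => [e|[]]; last by exists T.
case: cid => T' /= [_ hT']; apply: (BB_inverse p1 d0 hA hB).
by move=> x /hT' [].
Qed.

Lemma tridiagonal_shift U V W (A : K -> K -> C) lam : tridiagonal pos U V W A ->
  tridiagonal pos U [set v - lam | v in V] W (mxshift A lam).
Proof.
move=> tA k l; have [h1 h2 h3 h4] := tA k l; rewrite /mxshift; split=> h.
- have -> : (k == l) = false by apply/negP => /eqP kl; move: h; rewrite kl; clear; lia.
  by rewrite subr0; exact: h1.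
- by rewrite (pos_inj h) eqxx; exists (A l l) => //; move: h2; rewrite (pos_inj h); exact.
- have -> : (k == l) = false by apply/negP => /eqP kl; move: h; rewrite kl; clear; lia.
  by rewrite subr0; exact: h3.
- have -> : (k == l) = false.
    by apply/negP => /eqP kl; move: h; rewrite kl subrr normr0.
  by rewrite h4// subr0.
Qed.

Lemma mxshiftK (A : K -> K -> C) lam : mxshift (mxshift A (- lam)) lam = A.
Proof.
apply/funext => k; apply/funext => l; rewrite /mxshift.
by case: ifP => _; rewrite ?opprK ?addrK// !subr0.
Qed.

Lemma shift_setK V (lam : C) : [set v - - lam | v in [set v - lam | v in V]] = V.
Proof.
apply/seteqP; split=> [_ [_ [v Vv <-] <-]|v Vv]; first by rewrite opprK subrK.
by exists (v - lam); [exists v|rewrite opprK subrK].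
Qed.

Lemma pspec_family p q U V W c (lam : C) eps : conj_exp p q -> 0 < eps ->
  U !=set0 -> V !=set0 -> W !=set0 ->
  let V' := [set v - lam | v in V] in
  (forall a, Cls U V' W a -> bnd a c) ->
  (\bigcup_(A in [set A | tridiagonal pos U V W A]) pspec eps p A) lam <->
  exists2 a, Cls U V' W a & ~ Good p q (range pos) a eps^-1.
Proof.
move=> cj e0 U0 V0 W0 V' hc; have ei0 : 0 <= eps^-1 by rewrite invr_ge0 ltW.
have V'0 : V' !=set0 by have [v Vv] := V0; exists (v - lam), v.
split=> [[A /= tA hA]|[a ca nG]].
  have [a ca ra] := tridiagonal_coefs U0 V'0 W0 (tridiagonal_shift lam tA).
  exists a => // hG; move: hA; rewrite /pspec /= ltNge => /negP; apply.
  by apply/(invnormP cj ei0 (hc a ca) ra).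
exists (mxshift (fun k l => mat a (pos k) (pos l)) (- lam)) => /=.
  by rewrite -(shift_setK V lam); exact/tridiagonal_shift/coefs_tridiagonal.
rewrite /pspec /= mxshiftK ltNge; apply/negP.
by move/(invnormP cj ei0 (hc a ca) (fun k l => erefl)).
Qed.

Lemma invertible_inv a (A : K -> K -> C) c : bnd a c ->
  represents a A -> invertible 2%:E A <-> inv (range pos) a.
Proof.
move=> ba hA; split=> [e|[d d0 hG]].
  have : (invnorm 2%:E A < +oo)%E.
    by rewrite /invnorm; case: pselect => // e'; case: cid => T [].
  move=> h; have : exists2 d, 0 <= d & (invnorm 2%:E A <= d%:E)%E.
    move: h; case: (invnorm _ _) => [r||]// _; last by exists 0; rewrite ?leNye.
    by exists (Num.max 0 r); rewrite ?le_max ?lexx// lee_fin le_max lexx orbT.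
  by move=> [d d0 hd]; exists d => //; apply/(invnormP (conj_exp2 R) d0 ba hA).
have : (invnorm 2%:E A <= d%:E)%E by apply/(invnormP (conj_exp2 R) d0 ba hA).
by rewrite /invnorm; case: pselect.
Qed.

End Index.

Lemma Posz_inj : injective Posz. Proof. by move=> ? ? []. Qed.

Lemma range_Posz : range Posz = Nat0.
Proof.
apply/seteqP; split=> [_ [n _ <-] //|i hi]; exists (absz i) => //.
by move: hi; rewrite /Nat0 /=; lia.
Qed.

Lemma range_id : range (@id int) = [set: int].
Proof. by apply/seteqP; split=> // i _; exists i. Qed.

Lemma ord_inj_int n : injective (fun i : 'I_n => Posz i).
Proof. by move=> i j [/ord_inj]. Qed.

Lemma range_ord n : range (fun i : 'I_n => Posz i) = Fin n.
Proof.
apply/seteqP; split=> [_ [i _ <-]|i hi]; first by rewrite /Fin /=; have := ltn_ord i; lia.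
have h : (absz i < n)%N by move: hi; rewrite /Fin /=; lia.
by exists (Ordinal h) => //=; move: hi; rewrite /Fin /=; lia.
Qed.

End Transport.

(** * Pseudoergodic matrices *)

Section Pseudoergodic.
Variable R : realType.
Local Notation C := R[i].
Implicit Types (p q : \bar R) (a b : tri R) (U V W : set C).

Lemma mxact_delta (K : choiceType) (A : K -> K -> C) k l :
  mxact A (fun j => (j == l)%:R) k = A k l.
Proof.
rewrite /mxact -(@fsbig_widen _ _ _ _ [set l] [set: K])//.
  by rewrite fsbig_set1 eqxx mulr1.
by move=> j [_ /= /eqP/negbTE ->]; rewrite mulr0.
Qed.

Lemma entry_le_opnorm n (D : 'M[C]_n) p (e : R) i j : (1 <= p)%E ->
  (opnorm p (mxact D) < e%:E)%E -> cabs (D i j) <= e.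
Proof.
move=> p1 h; pose x (k : 'I_n) : C := (k == j)%:R.
have nx : nb p x 1.
  rewrite -(nb_push (@ord_inj_int n))// ?ler01//.
  apply: (nb_dom p1 _ (@nb_delta R p j%:Z p1)) => t.
  case: (pselect (range (fun i : 'I_n => Posz i) t)) => [[k _ <-]|nt]; last first.
    by rewrite push0// cabs0 cabs_ge0.
  by rewrite (pushE (@ord_inj_int n)) /delta /x eqz_nat.
have : (lpnorm p (mxact D x) <= opnorm p (mxact D))%E by apply: ereal_sup_ubound; exists x.
move=> /le_lt_trans /(_ h)/ltW ny.
have e0 : 0 <= e.
  have := ny; rewrite -lee_fin; apply: le_trans.
  case: p p1 {h nx ny} => [r||]// _; first exact: poweR_ge0.
  apply: le_trans (ereal_sup_ubound _); last by exists i.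
  by rewrite lee_fin cabs_ge0.
have {}ny : nb p (mxact D x) e := ny.
move: ny; rewrite -(nb_push (@ord_inj_int n))// => ny.
by have := nb_point i%:Z p1 ny; rewrite (pushE (@ord_inj_int n)) mxact_delta.
Qed.

Lemma opnorm_le_entry n (D : 'M[C]_n) p (e : R) : (1 <= p)%E -> 0 <= e ->
  (forall i j, cabs (D i j) <= e) -> (opnorm p (mxact D) <= (n%:R * (n%:R * e))%:E)%E.
Proof.
move=> p1 e0 h; apply: ge_ereal_sup => _ [x /= nx <-].
have {}nx : nb p x 1 := nx.
have hx i : cabs (x i) <= 1.
  move: nx; rewrite -(nb_push (@ord_inj_int n))// ?ler01// => nx.
  by have := nb_point i%:Z p1 nx; rewrite (pushE (@ord_inj_int n)).
have hy i : cabs (mxact D x i) <= n%:R * e.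
  have -> : mxact D x i = \sum_(j <- enum 'I_n) D i j * x j.
    rewrite /mxact -(@fsbig_widen _ _ _ _ [set` enum 'I_n] [set: 'I_n])//; last first.
      by move=> k [_ /=]; rewrite mem_enum.
    by rewrite -fsbig_seq ?enum_uniq.
  apply: le_trans (cabs_sum _ _ _) _.
  apply: (@le_trans _ _ (\sum_(j <- enum 'I_n) e)).
    by apply: ler_sum => j _; rewrite cabsM -[leRHS]mulr1 ler_pM ?cabs_ge0.
  by rewrite big_const_seq count_predT iter_addr addr0 -[leLHS]mulr_natl -cardE card_ord.
have M0 : 0 <= n%:R * (n%:R * e) by rewrite !mulr_ge0.
change (nb p (mxact D x) (n%:R * (n%:R * e))).
rewrite -(nb_push (@ord_inj_int n))//.
pose J := [seq j%:Z | j <- iota 0 n].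
have uJ : uniq J by rewrite map_inj_uniq ?iota_uniq// => ? ? [].
have hJ t : cabs (push (fun i : 'I_n => Posz i) (mxact D x) t) <= n%:R * e.
  case: (pselect (range (fun i : 'I_n => Posz i) t)) => [[k _ <-]|nt].
    by rewrite (pushE (@ord_inj_int n)).
  by rewrite push0// cabs0 mulr_ge0.
have := @nb_fin _ p (push (fun i : 'I_n => Posz i) (mxact D x)) J p1 uJ.
move=> h'; apply: (nb_le _ (h' _)).
  apply: (@le_trans _ _ (\sum_(j <- J) n%:R * e)); first by apply: ler_sum => j _.
  by rewrite big_const_seq count_predT iter_addr addr0 size_map size_iota [leRHS]mulr_natl.
move=> t tJ; apply: push0 => -[k _ kt]; move/negP: tJ; apply; apply/mapP.
by exists (k : nat); [rewrite mem_iota; have := ltn_ord k; clear; lia|rewrite kt].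
Qed.

(** The blocks of [b] with rows -n to n occur approximately in [A]. Their centres in [A] are at n or
    beyond, so the edge of the half-line recedes. *)
Lemma PsiE_limit U V W (A : nat -> nat -> C) a : PsiE_plus U V W A ->
  represents Posz a A -> forall b, Cls U V W b -> exists kn : nat -> int,
    (forall n, n%:Z <= kn n) /\ tri_lim (fun n => shift (kn n) a) b.
Proof.
move=> [_ hA] ra b cb.
have ex n : exists k : nat, forall t : int, `|t| < n%:Z ->
    [/\ cabs (lo a (t + (k + n)%N%:Z) - lo b t) <= n.+1%:R^-1,
        cabs (di a (t + (k + n)%N%:Z) - di b t) <= n.+1%:R^-1
      & cabs (up a (t + (k + n)%N%:Z) - up b t) <= n.+1%:R^-1].
  pose N := (2 * n).+1.
  pose B : 'M[C]_N := \matrix_(i, j) mat (shift (- n%:Z) b) i%:Z j%:Z.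
  have MB : M_n U V W B.
    rewrite /M_n /=; have := coefs_tridiagonal (fun i : 'I_N => Posz i) (Cls_shift (- n%:Z) cb).
    by move=> h i j; have := h i j; rewrite mxE.
  have e0 : (0 : R) < n.+1%:R^-1 by rewrite invr_gt0.
  have [k hk] := hA N isT B MB _ e0; exists k => t ht.
  have entry (s : int) : - 1 <= s <= 1 ->
      cabs (mat a (t + (k + n)%N%:Z) (t + s + (k + n)%N%:Z) - mat b t (t + s)) <= n.+1%:R^-1.
    move=> hs.
    have hi : (absz (t + n%:Z)%R < N)%N by rewrite /N; clear -ht; lia.
    have hj : (absz (t + s + n%:Z)%R < N)%N by rewrite /N; clear -ht hs; lia.
    have := entry_le_opnorm (Ordinal hi) (Ordinal hj) (p := 2%:E) _ hk.
    rewrite !mxE /= ra -cabsN opprB => h.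
    have e1 : Posz (absz (t + n%:Z)) = t + n%:Z by clear -ht; lia.
    have e2 : Posz (absz (t + s + n%:Z)) = t + s + n%:Z by clear -ht hs; lia.
    have e3 : Posz (k + absz (t + n%:Z)%R)%N = t + (k + n)%N%:Z by clear -ht; lia.
    have e4 : Posz (k + absz (t + s + n%:Z)%R)%N = t + s + (k + n)%N%:Z by clear -ht hs; lia.
    move: h; rewrite e1 e2 e3 e4.
    have -> : mat (shift (- n%:Z) b) (t + n%:Z) (t + s + n%:Z) = mat b t (t + s).
      rewrite /mat /= !addrK.
      have -> : (t + n%:Z == t + s + n%:Z + 1) = (t == t + s + 1) by clear; lia.
      have -> : (t + n%:Z == t + s + n%:Z) = (t == t + s) by clear; lia.
      by have -> : (t + s + n%:Z == t + n%:Z + 1) = (t + s == t + 1) by clear; lia.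
    by apply; rewrite lee_fin ler1n.
  split.
  - have := entry (-1) isT; rewrite /mat.
    have -> : (t + (k + n)%N%:Z == t - 1 + (k + n)%N%:Z + 1) by clear; lia.
    by have -> : (t == t - 1 + 1) by clear; lia.
  - have := entry 0 isT; rewrite /mat addr0 !eqxx.
    have -> : (t + (k + n)%N%:Z == t + (k + n)%N%:Z + 1) = false by clear; lia.
    by have -> : (t == t + 1) = false by clear; lia.
  - have := entry 1 isT; rewrite /mat.
    have -> : (t + (k + n)%N%:Z == t + 1 + (k + n)%N%:Z + 1) = false by clear; lia.
    have -> : (t == t + 1 + 1) = false by clear; lia.
    have -> : (t + (k + n)%N%:Z == t + 1 + (k + n)%N%:Z) = false by clear; lia.
    have -> : (t == t + 1) = false by clear; lia.
    have -> : (t + 1 + (k + n)%N%:Z == t + (k + n)%N%:Z + 1) by clear; lia.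
    by rewrite eqxx.
exists (fun n => (projT1 (cid (ex n)) + n)%N%:Z); split=> [n|]; first by lia.
have kP n t : `|t| < n%:Z -> let K := (projT1 (cid (ex n)) + n)%N%:Z in
    [/\ cabs (lo a (t + K) - lo b t) <= n.+1%:R^-1,
        cabs (di a (t + K) - di b t) <= n.+1%:R^-1
      & cabs (up a (t + K) - up b t) <= n.+1%:R^-1] by case: cid => k /=; exact.
move=> t; split=> e e0; apply: ev_mono (ev_and (ev_small e0) (ev_ge (absz t).+1)) => n [h1 h2];
  have ht : `|t| < n%:Z by [clear -h2; lia]; have [k1 k2 k3] := kP n t ht;
  apply: le_trans h1 => //.
Qed.

(** Norm bounds pass to limits of translates, whose index sets exhaust Z. *)
Lemma PsiE_Good p q U V W (A : nat -> nat -> C) a d : conj_exp p q -> 0 <= d ->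
  PsiE_plus U V W A -> represents Posz a A ->
  Good p q Nat0 a d \/ Good p q [set: int] a d ->
  forall b, Cls U V W b -> Good p q [set: int] b d.
Proof.
move=> cj d0 hA ra hG b cb; have [kn [hk hl]] := PsiE_limit hA ra cb.
have [I [hI hI']] : exists I, Good p q I a d /\ (forall i, 0 <= i -> I i).
  by case: hG => h; [exists Nat0|exists setT].
apply: (Good_limit (In := fun n => [set i | I (i + kn n)]) cj d0 _ _ hl) => [i []//|i _|].
  apply: ev_mono (ev_ge (absz i)) => n hn; apply: hI'; have := hk n; clear -hn; lia.
by apply: ev_all => n; exact: Good_shift.
Qed.

Lemma PsiE_mxshift U V W (A : nat -> nat -> C) lam : PsiE_plus U V W A ->
  PsiE_plus U [set v - lam | v in V] W (mxshift A lam).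
Proof.
move=> [tA hA]; split; first exact: tridiagonal_shift Posz_inj _ _ _ _ _ tA.
move=> n n0 B MB e e0.
pose B' : 'M[C]_n := \matrix_(i, j) mxshift B (- lam) i j.
have MB' : M_n U V W B'.
  have := tridiagonal_shift (@ord_inj_int n) (- lam) MB; rewrite shift_setK.
  by move=> h i j; have := h i j; rewrite mxE.
have [k hk] := hA n n0 B' MB' e e0; exists k => /=.
rewrite (_ : B - _ = B' - \matrix_(i, j) A (k + i)%N (k + j)%N)//.
apply/matrixP => i j; rewrite !mxE /mxshift eqn_add2l (inj_eq val_inj).
by case: ifP => _; ring.
Qed.

(** For each rational point and each tolerance one nearby point of S is picked, if there is one;
    [unpickle] enumerates these choices. *)
Lemma dense_sequence (S : set C) : S !=set0 -> exists f : nat -> C, (forall n, S (f n)) /\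
  forall z, S z -> forall e : R, 0 < e -> exists n, cabs (f n - z) <= e.
Proof.
move=> [s0 Ss0].
pose Q (t : rat * rat * nat) (s : C) :=
  S s /\ cabs (s - Complex (ratr t.1.1) (ratr t.1.2)) <= t.2.+1%:R^-1.
pose f n := if unpickle n is Some t then
   (if pselect (exists s, Q t s) is left h then projT1 (cid h) else s0) else s0.
exists f; split=> [n|z Sz e e0].
  rewrite /f; case: unpickle => // t; case: pselect => // h; by case: cid => s [].
have ei : 0 <= 2%:R / e by rewrite divr_ge0// ltW.
pose k := Num.bound (2%:R / e); have hk := archi_boundP ei; rewrite -/k in hk.
have kp : (0 : R) < k.+1%:R^-1 by rewrite invr_gt0 ltr0n.
have ke : 2%:R * k.+1%:R^-1 <= e.
  rewrite ler_pdivrMr ?ltr0n// mulrC -ler_pdivrMr//; apply: ltW; apply: lt_le_trans hk _.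
  by rewrite ler_nat.
have rat_near (r h0 : R) : 0 < h0 -> exists q : rat, `|r - ratr q| <= h0 / 2%:R.
  move=> h00; have h : r - h0 / 2%:R < r + h0 / 2%:R by lra.
  have [q] := rat_in_itvoo h; rewrite in_itv /= => /andP[h1 h2]; exists q.
  by rewrite ler_norml; apply/andP; split; lra.
have [q1 h1] := rat_near (complex.Re z) _ kp; have [q2 h2] := rat_near (complex.Im z) _ kp.
have hz : cabs (z - Complex (ratr q1) (ratr q2)) <= k.+1%:R^-1.
  apply: le_trans (cabs_ReIm _) _; move: h1 h2; case: z {Sz} => x y /=.
  by move: (k.+1%:R^-1 : R) => kk; lra.
exists (pickle ((q1, q2, k) : rat * rat * nat)); rewrite /f pickleK.
case: pselect => [h|[]]; last by exists z.
case: cid => s /= [Ss hs]; apply: le_trans ke.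
have -> : s - z = (s - Complex (ratr q1) (ratr q2)) - (z - Complex (ratr q1) (ratr q2)) by ring.
by apply: le_trans (cabsB _ _) _; rewrite mulr_natl mulr2n lerD.
Qed.

(** A spare natural number in the code gives each word arbitrarily large codes. *)
Lemma pickle_large (T : countType) (s : T) n :
  exists k : nat, (n <= pickle ((k, s) : nat * T))%N.
Proof.
apply: contrapT => h.
have hk k : (pickle ((k, s) : nat * T) < n)%N.
  by rewrite ltnNge; apply/negP => h'; apply: h; exists k.
have u : uniq [seq pickle ((k, s) : nat * T) | k <- iota 0 n.+1].
  rewrite map_inj_uniq ?iota_uniq// => k l /(pcan_inj (@pickleK _)) [].
  by [].
have := uniq_leq_size (s2 := iota 0 n) u; rewrite size_map !size_iota ltnn => h'.
suff : false by []; apply: h' => m /mapP[k _ ->]; by rewrite mem_iota /= hk.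
Qed.

(** The positions from 2^m on spell the word with code m, in letters from dense sequences. Each word
    has a code m at least its length, so it fits before 2^(m+1). *)
Lemma PsiE_exists U V W : U !=set0 -> V !=set0 -> W !=set0 -> exists A, PsiE_plus U V W A.
Proof.
move=> /dense_sequence[fu [Uf hu]] /dense_sequence[fv [Vf hv]] /dense_sequence[fw [Wf hw]].
pose word (m : nat) : seq (nat * nat * nat) :=
  oapp snd [::] (unpickle m : option (nat * seq (nat * nat * nat))).
pose letter (i : int) := let m := trunc_log 2 (absz i) in
  nth (0, 0, 0)%N (word m) (absz i - 2 ^ m)%N.
pose a := Tri (fun i => fu (letter i).1.1) (fun i => fv (letter i).1.2) (fun i => fw (letter i).2).
have ca : Cls U V W a by move=> i; split; [exact: Uf|exact: Vf|exact: Wf].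
exists (fun k l => mat a k%:Z l%:Z); split; first exact: coefs_tridiagonal.
move=> n n0 B MB e e0.
(* [opnorm_le_entry] loses the factor n^2; the 2 makes the final inequality strict. *)
pose eta := e / (2%:R * (n%:R * n%:R)).
have np : (0 : R) < n%:R by rewrite ltr0n.
have eta0 : 0 < eta by rewrite divr_gt0// !mulr_gt0.
have [b cb rb] := tridiagonal_coefs (@ord_inj_int n) (ex_intro _ _ (Uf 0%N))
  (ex_intro _ _ (Vf 0%N)) (ex_intro _ _ (Wf 0%N)) MB.
have ex t : exists l : nat * nat * nat, [/\ cabs (fu l.1.1 - lo b t) <= eta,
    cabs (fv l.1.2 - di b t) <= eta & cabs (fw l.2 - up b t) <= eta].
  have [b1 b2 b3] := cb t.
  have [l1 h1] := hu _ b1 _ eta0; have [l2 h2] := hv _ b2 _ eta0; have [l3 h3] := hw _ b3 _ eta0.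
  by exists (l1, l2, l3).
pose g (t : nat) := projT1 (cid (ex t%:Z)).
have gP (t : nat) : [/\ cabs (fu (g t).1.1 - lo b t) <= eta,
    cabs (fv (g t).1.2 - di b t) <= eta & cabs (fw (g t).2 - up b t) <= eta].
  by rewrite /g; case: cid.
pose s := [seq g t | t <- iota 0 n].
have [k hk] := pickle_large s n; set m := pickle _ in hk.
have hl (t : nat) : (t < n)%N -> letter (2 ^ m + t)%N%:Z = g t.
  move=> tn; rewrite /letter absz_nat.
  have tm : (t < 2 ^ m)%N.
    by apply: leq_trans tn _; apply: leq_trans hk _; exact: ltnW (ltn_expl _ _).
  have -> : trunc_log 2 (2 ^ m + t) = m.
    apply: trunc_log_eq => //; rewrite leq_addr /= expnS mul2n -addnn ltn_add2l.
    exact: tm.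
  rewrite addKn /word /m pickleK /= (nth_map 0%N) ?size_iota// nth_iota//.
exists (2 ^ m)%N => /=; set D : 'M[C]_n := _ - _.
have hD i j : cabs (D i j) <= eta.
  rewrite /D !mxE rb -cabsN opprB /mat -!PoszD.
  have [h1 h2 h3] := gP i; have hi := hl i (ltn_ord i).
  have E1 : (Posz (2 ^ m + i) == Posz (2 ^ m + j + 1)) = (Posz i == Posz j + 1) by clear; lia.
  have E2 : (Posz (2 ^ m + i) == Posz (2 ^ m + j)) = (Posz i == Posz j) by clear; lia.
  have E3 : (Posz (2 ^ m + j) == Posz (2 ^ m + i + 1)) = (Posz j == Posz i + 1) by clear; lia.
  rewrite E1 E2 E3; case: ifP => _ /=; first by rewrite hi.
  case: ifP => _ /=; first by rewrite hi.
  case: ifP => _ /=; first by rewrite hi.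
  by rewrite subrr cabs0 ltW.
have p2 : (1 <= 2%:E :> \bar R)%E by rewrite lee_fin ler1n.
apply: le_lt_trans (opnorm_le_entry p2 (ltW eta0) hD) _.
rewrite lte_fin; have -> : n%:R * (n%:R * eta) = e / 2%:R; last by lra.
by rewrite /eta; field; rewrite gt_eqF.
Qed.

End Pseudoergodic.

(** * Toeplitz operators and the roots of their symbols *)

Section Toeplitz.
Variable R : realType.
Local Notation C := R[i].
Implicit Types (u v w z t : C).
Local Open Scope complex_scope.
Local Notation "z ^*" := (conjc z) : ring_scope.

Definition tz u v w : tri R := Tri (fun=> u) (fun=> v) (fun=> w).

Lemma act_tz u v w x i : act (tz u v w) x i = u * x (i - 1) + v * x i + w * x (i + 1).
Proof. by []. Qed.

Lemma conjM (y z : C) : (y * z)^* = y^* * z^*. Proof. exact: rmorphM. Qed.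
Lemma conjD (y z : C) : (y + z)^* = y^* + z^*. Proof. exact: rmorphD. Qed.
Lemma conjB (y z : C) : (y - z)^* = y^* - z^*. Proof. exact: rmorphB. Qed.

Lemma mulzJ z : z * z^* = ((cabs z) ^+ 2)%:C.
Proof. by rewrite rmorphXn /= cabsE sqr_normc. Qed.

(** Factorization u + v t + w t^2 = w (t - t1) (t - t2). *)
Lemma quadratic_roots u v w : w != 0 -> exists t1 t2, v = - (w * (t1 + t2)) /\ u = w * t1 * t2.
Proof.
move=> w0; pose r := sqrtc ((v / w) ^+ 2 - 4%:R * (u / w)).
have hr : r ^+ 2 = (v / w) ^+ 2 - 4%:R * (u / w) by exact: sqr_sqrtc.
exists ((- (v / w) + r) / 2%:R), ((- (v / w) - r) / 2%:R); split.
  by field.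
have -> : w * ((- (v / w) + r) / 2%:R) * ((- (v / w) - r) / 2%:R) =
  w * ((v / w) ^+ 2 - r ^+ 2) / 4%:R by field.
by rewrite hr; field.
Qed.

Lemma bounded_powers (r B : R) : 0 <= r -> (forall k, r ^+ k <= B) -> r <= 1.
Proof.
move=> r0 h; rewrite leNgt; apply/negP => r1.
have bern k : 1 + k%:R * (r - 1) <= r ^+ k.
  elim: k => [|k IH]; first by rewrite mul0r addr0 expr0.
  have k0 : 0 <= k%:R * (r - 1) by rewrite mulr_ge0// subr_ge0 ltW.
  rewrite exprS -natr1; apply: le_trans (ler_wpM2l r0 IH).
  by have := mulr_ge0 k0 (_ : 0 <= r - 1); rewrite subr_ge0 ltW// => /(_ isT); nra.
have d0 : 0 < r - 1 by rewrite subr_gt0.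
have B0 : 0 <= B / (r - 1).
  by rewrite divr_ge0 ?(ltW d0)//; have := h 0%N; rewrite expr0; lra.
have := archi_boundP B0; rewrite ltr_pdivrMr// => hk.
by have := le_trans (bern _) (h (Num.bound (B / (r - 1)))); lra.
Qed.

Lemma unimodular_kernel u v w t : cabs t = 1 -> u + v * t + w * t ^+ 2 = 0 ->
  kernel [set: int] (tz u v w) (fun i => t ^ i).
Proof.
move=> t1 e; have t0 : t != 0 by rewrite -cabs_gt0 t1.
have ct (i : int) : cabs (t ^ i) = 1.
  by case: i => n; rewrite ?NegzE ?exprzN -?exprnP ?cabsV cabsX t1 expr1n ?invr1.
split=> [i []//|||i _].
- by exists 1; apply/nb_supP => i; rewrite ct.
- by exists 0; rewrite expr0z oner_neq0.
- rewrite act_tz; have -> : t ^ i = t ^ (i - 1) * t.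
    by rewrite -{3}[t]expr1z -expfzDr// subrK.
  have -> : t ^ (i + 1) = t ^ (i - 1) * t ^+ 2.
    by rewrite -[t ^+ 2]/(t ^ 2%:Z) -expfzDr//; congr (t ^ _); lia.
  rewrite -[RHS](mulr0 (t ^ (i - 1))) -e; ring.
Qed.

(** The null vector consists of the complete homogeneous symmetric polynomials in t1 and t2, a form
    that also covers t1 = t2. *)
Lemma toeplitz_kernel w t1 t2 : cabs t1 < 1 -> cabs t2 <= 1 ->
  hker (tz (w * t1 * t2) (- (w * (t1 + t2))) w).
Proof.
move=> h1 h2.
pose h := fix h n := if n is m.+1 then t1 * h m + t2 ^+ m.+1 else 1.
have hB n : cabs (h n) <= (1 - cabs t1)^-1.
  have d0 : 0 < 1 - cabs t1 by rewrite subr_gt0.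
  elim: n => [|n IH].
    by rewrite /= cabs1 invf_ge1// gerBl cabs_ge0.
  apply: le_trans (cabsD _ _) _; rewrite cabsM cabsX.
  have p2 : cabs t2 ^+ n.+1 <= 1 by rewrite exprn_ile1 ?cabs_ge0.
  apply: le_trans (lerD (ler_wpM2l (cabs_ge0 t1) IH) p2) _.
  by rewrite le_eqVlt; apply/orP; left; apply/eqP; field; rewrite gt_eqF.
pose x (i : int) : C := if 0 <= i then h (absz i) else 0.
have xE (n : nat) : x n%:Z = h n by [].
exists x; split.
- by move=> i /negP hi; rewrite /x ifF//; apply/negbTE.
- exists (1 - cabs t1)^-1; apply/nb_supP => i; rewrite /x; case: ifP => // _.
  by rewrite cabs0 invr_ge0 subr_ge0 ltW.
- by exists 0; rewrite (xE 0%N) oner_neq0.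
- case=> [[|n]|//] _; rewrite act_tz.
    rewrite (_ : x (0%:Z - 1) = 0)// (xE 0%N) (_ : 0%:Z + 1 = 1%:Z)// (xE 1%N) /=.
    by rewrite expr1; ring.
  have -> : n.+1%:Z - 1 = n%:Z by lia.
  have -> : n.+1%:Z + 1 = n.+2%:Z by lia.
  by rewrite !xE /= !exprS; ring.
Qed.

(** Splitting off the factor t - t1 of the recursion leaves a geometric sequence of ratio t2, which
    must be bounded. *)
Lemma kernel_root_bound w t1 t2 x : w != 0 ->
  kernel Nat0 (tz (w * t1 * t2) (- (w * (t1 + t2))) w) x -> cabs t2 <= 1.
Proof.
move=> w0 [sx [M bx] [i0 xi0] ex].
have rec (n : nat) : x n.+1%:Z = (t1 + t2) * x n%:Z - t1 * t2 * x (n%:Z - 1).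
  have := ex n%:Z isT; rewrite act_tz => e; apply: (mulfI w0).
  have -> : n.+1%:Z = n%:Z + 1 by lia.
  rewrite -[LHS]addr0 -[in LHS]oppr0 -[X in - X]e; ring.
have xm1 : x (-1) = 0 by exact: sx.
have x0 : x 0 != 0.
  apply/eqP => x00.
  have z (n : nat) : x n%:Z = 0 /\ x n.+1%:Z = 0.
    elim: n => [|n [h1 h2]].
      by split=> //; rewrite rec x00 (_ : 0%:Z - 1 = -1)// xm1; ring.
    by split=> //; rewrite rec h2 (_ : n.+1%:Z - 1 = n%:Z) ?h1 ?mulr0 ?subr0//; lia.
  have i00 : 0 <= i0 := supp_ge0 sx xi0.
  by move: xi0; rewrite -(gez0_abs i00) (proj1 (z _)) eqxx.
have d (n : nat) : x n%:Z - t1 * x (n%:Z - 1) = t2 ^+ n * x 0.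
  elim: n => [|n IH]; first by rewrite (_ : 0%:Z - 1 = -1)// xm1 mulr0 subr0 expr0 mul1r.
  have -> : n.+1%:Z - 1 = n%:Z by lia.
  by rewrite rec exprS -[t2 * _ * _]mulrA -IH; ring.
apply: (@bounded_powers _ ((M + cabs t1 * M) / cabs (x 0)) (cabs_ge0 _)) => n.
have x0p : 0 < cabs (x 0) by rewrite cabs_gt0.
rewrite ler_pdivlMr// -cabsX -cabsM -d; apply: le_trans (cabsB _ _) _.
by rewrite cabsM lerD ?ler_wpM2l ?cabs_ge0 ?(nb_point _ (@y1 R) bx).
Qed.

(** The equation and its conjugate form a linear system for z and its conjugate, with determinant 1
    - |t1 t2|^2. The bound |z| < 1 comes down to (1 - |t1|) (1 - |t2|) > 0. *)
Lemma ellipse_center_solve t1 t2 : cabs t1 < 1 -> cabs t2 < 1 ->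
  exists2 z, cabs z < 1 & z + t1 * t2 * z^* = t1 + t2.
Proof.
move=> h1 h2; have a0 := cabs_ge0 t1; have b0 := cabs_ge0 t2.
pose D : R := 1 - (cabs t1 * cabs t2) ^+ 2.
have ab : cabs t1 * cabs t2 < 1 by nra.
have D0 : 0 < D.
  by rewrite /D subr_gt0 expr_lte1// mulr_ge0.
have DC : D%:C = 1 - (t1 * t1^*) * (t2 * t2^*).
  by rewrite !mulzJ /D rmorphB rmorph1 exprMn rmorphM.
have D1 : D%:C != 0 :> C by rewrite fmorph_eq0 gt_eqF.
pose nm := t1 * (1 - t2 * t2^*) + t2 * (1 - t1 * t1^*).
have nmE : nm = t1 * (1 - cabs t2 ^+ 2)%:C + t2 * (1 - cabs t1 ^+ 2)%:C.
  by rewrite /nm !mulzJ !rmorphB !rmorph1.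
exists (nm / D%:C).
  rewrite cabsM cabsV cabs_real (ger0_norm (ltW D0)) ltr_pdivrMr// mul1r nmE.
  apply: le_lt_trans (cabsD _ _) _; rewrite !cabsM !cabs_real.
  rewrite !ger0_norm ?subr_ge0 ?expr_le1 ?(ltW h1) ?(ltW h2)//.
  rewrite /D; move: (cabs t1) (cabs t2) h1 h2 a0 b0 ab => a b h1 h2 a0 b0 ab.
  have -> : a * (1 - b ^+ 2) + b * (1 - a ^+ 2) = (a + b) * (1 - a * b) by ring.
  have -> : 1 - (a * b) ^+ 2 = (1 + a * b) * (1 - a * b) by ring.
  by rewrite ltr_pM2r ?subr_gt0//; nra.
have JD : ((D%:C)^-1)^* = (D%:C)^-1 by rewrite conjc_inv conjc_real.
have -> : (nm / D%:C)^* = (t1^* * (1 - t2^* * t2) + t2^* * (1 - t1^* * t1)) / D%:C.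
  by rewrite conjM JD /nm conjD !conjM !conjB !conjM conjc1 !conjcK.
apply: (mulIf D1); rewrite mulrDl -[_ * (_ / _) * _]mulrA !divfK// DC /nm; ring.
Qed.

Lemma conj_solve (z t1 t2 : C) w : z + t1 * t2 * z^* = t1 + t2 ->
  - (w * (t1 + t2)) + w * z + w * t1 * t2 * z^* = 0.
Proof. by move=> e; rewrite -e; ring. Qed.

(** A bounded half-line null vector puts both roots in the closed disc, and a unimodular root would
    give the bi-infinite null vector t^i. *)
Lemma kernel_disc u v w x : kernel Nat0 (tz u v w) x -> ~ (exists y, kernel [set: int] (tz u v w) y) ->
  cabs u < cabs w /\ exists2 z, cabs z < 1 & v + w * z + u * z^* = 0.
Proof.
move=> kx nk; have w0 : w != 0.
  apply/eqP => w0; have [sx bx [i xi] ex] := kx.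
  have i0 : 0 <= i := supp_ge0 sx xi.
  have [v0|v0] := eqVneq v 0.
    have [u0|u0] := eqVneq u 0.
      apply: nk; exists (fun=> 1); split=> [j []//|||j _].
      - by exists 1; apply/nb_supP => j; rewrite cabs1.
      - by exists 0; rewrite oner_neq0.
      - by rewrite act_tz u0 v0 w0 !mul0r !addr0.
    have := ex (i + 1); rewrite act_tz addrK v0 w0 !mul0r !addr0 => h.
    have /eqP := h (addr_ge0 i0 ler01 : Nat0 (i + 1)).
    by rewrite mulf_eq0 (negbTE u0) (negbTE xi).
  have z (n : nat) : x n%:Z = 0.
    elim: n => [|n IH].
      have := ex 0%:Z isT; rewrite act_tz w0 mul0r addr0 sx// mulr0 add0r => /eqP.
      by rewrite mulf_eq0 (negbTE v0) => /eqP.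
    have := ex n.+1%:Z isT; rewrite act_tz w0 mul0r addr0.
    have -> : n.+1%:Z - 1 = n%:Z by lia.
    by rewrite IH mulr0 add0r => /eqP; rewrite mulf_eq0 (negbTE v0) => /eqP.
  by move: xi; rewrite -(gez0_abs i0) z eqxx.
have [t1 [t2 [ev_ eu]]] := quadratic_roots u v w0; subst v u.
have unim t : t = t1 \/ t = t2 -> cabs t != 1.
  move=> ht; apply/eqP => tt; apply: nk; exists (fun i => t ^ i).
  by apply: (unimodular_kernel tt); case: ht => ->; ring.
have h2 : cabs t2 < 1 by rewrite lt_neqAle unim; [exact: kernel_root_bound w0 kx|right].
have h1 : cabs t1 < 1.
  rewrite lt_neqAle unim; [|by left]; apply: (kernel_root_bound (t1 := t2) w0).
  by move: kx; rewrite -mulrA [t1 * t2]mulrC [t1 + t2]addrC mulrA; exact.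
split.
  rewrite !cabsM -mulrA -[ltRHS]mulr1 ltr_pM2l ?cabs_gt0//.
  by have := cabs_ge0 t1; have := cabs_ge0 t2; nra.
have [z z1 ez] := ellipse_center_solve h1 h2; exists z => //; exact: conj_solve.
Qed.

(** Cases by the position of the roots: one on the circle, both inside, or both outside, when their
    inverses belong to the transpose. One inside and one outside contradicts |z| <= 1. *)
Lemma disc_kernel u v w z : cabs z <= 1 -> v + w * z + u * z^* = 0 ->
  [\/ exists x, kernel [set: int] (tz u v w) x, hker (tz u v w) | hker (tz w v u)].
Proof.
move=> z1 e; have [w0|w0] := eqVneq w 0.
  have [u0|u0] := eqVneq u 0.
    constructor 1; exists (fun=> 1); split=> [j []//|||j _].
    - by exists 1; apply/nb_supP => j; rewrite cabs1.
    - by exists 0; rewrite oner_neq0.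
    - by move: e; rewrite act_tz u0 w0 !mul0r !addr0 => ->; rewrite add0r mul0r.
  constructor 3; have h0 : cabs (0 : C) < 1 by rewrite cabs0.
  have := @toeplitz_kernel u 0 z^* h0 _; rewrite cabs_conj z1 => /(_ isT).
  rewrite !mulr0 mul0r add0r w0.
  suff -> : - (u * z^*) = v by [].
  by apply/eqP; rewrite eq_sym -subr_eq0 opprK -[X in _ == X]e w0 mul0r addr0.
have [t1 [t2 [ev_ eu]]] := quadratic_roots u v w0.
have unim t : t = t1 \/ t = t2 -> cabs t = 1 -> exists x, kernel [set: int] (tz u v w) x.
  move=> ht tt; exists (fun i => t ^ i).
  by apply: (unimodular_kernel tt); rewrite ev_ eu; case: ht => ->; ring.
(* Moebius transformations of the disc: |z - s1| <= |1 - s1 conj z|. *)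
have mixed s1 s2 : v = - (w * (s1 + s2)) -> u = w * s1 * s2 -> cabs s1 < 1 -> 1 < cabs s2 -> False.
  move=> ev1 eu1 h1 h2; have e1 : z - s1 = s2 * (1 - s1 * z^*).
    apply: (mulfI w0); apply/eqP; rewrite -subr_eq0; apply/eqP; rewrite -[RHS]e ev1 eu1; ring.
  pose A := cabs (z - s1); pose B := cabs (1 - s1 * z^*).
  have B0 : 0 < B.
    have := cabs_sub_lower 1 (s1 * z^*); rewrite cabs1 cabsM cabs_conj -/B.
    by have := cabs_ge0 z; have := cabs_ge0 s1; nra.
  have AB : A = cabs s2 * B by rewrite /A e1 cabsM.
  have mob : B ^+ 2 - A ^+ 2 = (1 - cabs s1 ^+ 2) * (1 - cabs z ^+ 2).
    have e2 : (B ^+ 2)%:C - (A ^+ 2)%:C = (1 - (cabs s1 ^+ 2)%:C) * (1 - (cabs z ^+ 2)%:C).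
      by rewrite /A /B -!mulzJ !conjB conjc1 conjM conjcK; ring.
    by apply: complexI; rewrite rmorphB [RHS]rmorphM !rmorphB !rmorph1; exact: e2.
  have : 0 <= B ^+ 2 - A ^+ 2.
    by rewrite mob mulr_ge0// subr_ge0 expr_le1 ?cabs_ge0// ltW.
  have lt : B < A by rewrite AB ltr_pMl.
  by have B0' := ltW B0; nra.
case: (ltgtP (cabs t1) 1) => h1; last by constructor 1; apply: (unim t1) => //; left.
- case: (ltgtP (cabs t2) 1) => h2; last by constructor 1; apply: (unim t2) => //; right.
    constructor 2; rewrite ev_ eu; exact: toeplitz_kernel (ltW h2).
  by exfalso; exact: mixed ev_ eu h1 h2.
- case: (ltgtP (cabs t2) 1) => h2; last by constructor 1; apply: (unim t2) => //; right.
    exfalso; apply: (mixed t2 t1) => //; first by rewrite addrC.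
    by rewrite eu -!mulrA [t1 * t2]mulrC.
  constructor 3.
  have t10 : t1 != 0 by rewrite -cabs_gt0; apply: lt_trans h1.
  have t20 : t2 != 0 by rewrite -cabs_gt0; apply: lt_trans h2.
  have g1 : cabs t1^-1 < 1 by rewrite cabsV invf_lt1// (lt_trans _ h1).
  have g2 : cabs t2^-1 <= 1 by rewrite ltW// cabsV invf_lt1// (lt_trans _ h2).
  have := toeplitz_kernel u g1 g2.
  have -> : u * t1^-1 * t2^-1 = w by rewrite eu; field; rewrite t10 t20.
  have -> // : - (u * (t1^-1 + t2^-1)) = v by rewrite ev_ eu; field; rewrite t10 t20.
Qed.

End Toeplitz.

(** * Filled ellipses as images of the unit disc *)

Section Ellipse.
Variable R : realType.
Local Notation C := R[i].
Implicit Types (u v w z t lam : C) (U V W : set C).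
Local Open Scope complex_scope.
Local Notation "z ^*" := (conjc z) : ring_scope.

Lemma convE (l : {i01 C}) (x y : convex_lmodType C^o) :
  conv l x y = (l%:num : C) * (x : C) + (1 - (l%:num : C)) * (y : C).
Proof. by []. Qed.

(** The image of the disc under this real-affine map is convex and contains the ellipse: take z =
    t^-1. *)
Lemma conv_hull_disc u v w lam : conv_hull (ellipse u v w) lam ->
  exists2 z, cabs z <= 1 & lam = v + w * z + u * z^*.
Proof.
pose X : set C := [set lam | exists2 z, cabs z <= 1 & lam = v + w * z + u * z^*].
apply: (smallest_sub (X := X)).
  move=> x y l; rewrite !inE => -[z1 h1 ->] [z2 h2 ->].
  have [s s0 s1] : exists2 s : R, 0 <= s <= 1 & l%:num = s%:C.
    have l0 : 0 <= l%:num :> C by [].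
    have l1 : l%:num <= 1 :> C by [].
    move: l0 l1; case: (l%:num) => a b; rewrite !lecE /= => /andP[/eqP b0 a0] /andP[_ a1].
    by exists a; [rewrite a0|rewrite b0].
  exists (l%:num * z1 + (1 - l%:num) * z2).
    rewrite s1; apply: le_trans (cabsD _ _) _; rewrite -(rmorph1 (real_complex R)) -rmorphB !cabsM !cabs_real.
    by case/andP: s0 => s0 s0'; rewrite !ger0_norm ?subr_ge0//; nra.
  rewrite convE s1 conjD !conjM conjB conjc1 !conjc_real; ring.
move=> _ [t /= t1 <-]; have ct : cabs t = 1 by rewrite /cabs t1.
have t0 : t != 0 by rewrite -cabs_gt0 ct.
have tJ : t^* = t^-1.
  by apply: (mulfI t0); rewrite mulzJ ct expr1n mulfV.
exists t^-1; first by rewrite cabsV ct invr1.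
by rewrite -tJ conjcK; ring.
Qed.

Lemma disc_conv_hull u v w z : cabs z <= 1 -> conv_hull (ellipse u v w) (v + w * z + u * z^*).
Proof.
move=> z1.
have [e e1 ze] : exists2 e : C, cabs e = 1 & z = (cabs z)%:C * e.
  have [->|z0] := eqVneq z 0; first by exists 1; rewrite ?cabs1// cabs0 mul0r.
  exists (z / (cabs z)%:C).
    by rewrite cabsM cabsV cabs_real ger0_norm ?cabs_ge0// mulfV// cabs_eq0.
  by rewrite mulrC divfK// fmorph_eq0 cabs_eq0.
have on (f : C) : cabs f = 1 -> ellipse u v w (v + w * f + u * f^*).
  move=> f1; have f0 : f != 0 by rewrite -cabs_gt0 f1.
  have fJ : f^* = f^-1 by apply: (mulfI f0); rewrite mulzJ f1 expr1n mulfV.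
  exists f^*; first by rewrite /= normcJ -cabsE f1.
  by rewrite [in LHS]fJ invrK -fJ; ring.
move=> A [cA sA].
(* [z] lies on the segment from -e to e, and [s] is the weight of [e]. *)
pose s : C := ((1 + cabs z) / 2%:R)%:C.
have c0 := cabs_ge0 z.
have s0 : 0 <= s by rewrite ler0c; lra.
have s1 : s <= 1 by rewrite -(rmorph1 (real_complex R)) lecR; lra.
have := cA (v + w * e + u * e^*) (v + w * (- e) + u * (- e)^*) (Itv01 s0 s1).
rewrite !inE => /(_ (sA _ (on _ e1))) h.
have eN : cabs (- e) = 1 by rewrite cabsN.
move: (h (sA _ (on _ eN))); rewrite convE /= => {}h.
suff <- : s * (v + w * e + u * e^*) + (1 - s) * (v + w * (- e) + u * (- e)^*) =
  v + w * z + u * z^* by exact: h.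
have sE : 2%:R * s = 1 + (cabs z)%:C.
  rewrite /s -(rmorph1 (real_complex R)) -rmorphD -(rmorph_nat (real_complex R)) -rmorphM /=.
  by congr (_%:C); field.
rewrite [in RHS]ze conjM conjc_real (_ : (- e)^* = - e^*); last exact: rmorphN.
have -> : (cabs z)%:C = 2%:R * s - 1 by rewrite sE; ring.
ring.
Qed.

(** The real-linear map z -> w z + u conj z has determinant |w|^2 - |u|^2, nonzero by hypothesis, so
    a small ball around the image of z stays in the image of the disc. *)
Lemma disc_ellipse_interior u v w z : cabs u != cabs w -> cabs z < 1 ->
  ellipse_interior u v w (v + w * z + u * z^*).
Proof.
move=> uw z1; rewrite /ellipse_interior /interior /=.
have cu := cabs_ge0 u; have cw := cabs_ge0 w.
pose D : R := cabs w ^+ 2 - cabs u ^+ 2.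
have D0 : D != 0.
  by rewrite /D subr_sqr mulf_neq0// ?subr_eq0 1?eq_sym//; apply/eqP => h; move/eqP: uw; lra.
have DC : D%:C = w * w^* - u * u^* by rewrite !mulzJ rmorphB.
have D1 : D%:C != 0 :> C by rewrite fmorph_eq0.
pose k : R := `|D| / (cabs w + cabs u).
have wu : 0 < cabs w + cabs u.
  by rewrite lt_def addr_ge0// andbT; apply/eqP => h; move/eqP: uw; lra.
have Dp : 0 < `|D| by rewrite normr_gt0.
(* The distance of z to the circle, divided by the norm bound (|w| + |u|) / |D| of the inverse
   map. *)
pose ep : R := (1 - cabs z) * `|D| / (cabs w + cabs u).
have ep0 : 0 < ep by rewrite divr_gt0// mulr_gt0// subr_gt0.
have ep0C : 0 < ep%:C :> C by rewrite ltcR.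
suff key (mu : C) : cabs (mu - (v + w * z + u * z^*)) < ep -> conv_hull (ellipse u v w) mu.
  apply/nbhs_ballP; exists ep%:C => //= mu; rewrite /ball /= distrC -cabs_lt.
  exact: key.
have solve (y : C) : w * ((w^* * y - u * y^*) / D%:C) + u * ((w^* * y - u * y^*) / D%:C)^* = y.
  have -> : ((w^* * y - u * y^*) / D%:C)^* = (w * y^* - u^* * y) / D%:C.
    by rewrite conjM conjB !conjM conjc_inv conjc_real !conjcK.
  by apply: (mulIf D1); rewrite mulrDl -!mulrA !mulVf// !mulr1 DC; ring.
move=> hmu; have [y ymu] : exists y, y = mu - (v + w * z + u * z^*) by eexists.
have -> : mu = v + w * (z + (w^* * y - u * y^*) / D%:C) + u * (z + (w^* * y - u * y^*) / D%:C)^*.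
  rewrite (conjD z) !mulrDr; have := solve y.
  move: (w * (_ / _)) (u * (_ / _)^*) => X Y XY.
  have -> : mu = y + (v + w * z + u * z^*) by rewrite ymu; ring.
  by rewrite -XY; ring.
apply: disc_conv_hull; apply: le_trans (cabsD _ _) _.
rewrite cabsM cabsV cabs_real; rewrite -lerBrDl ler_pdivrMr//.
apply: le_trans (cabsB _ _) _; rewrite !cabsM !cabs_conj -mulrDl.
move: hmu; rewrite -ymu /ep ltr_pdivlMr// mulrC => /ltW; exact: le_trans.
Qed.

End Ellipse.

(** * Favourable exponents and the Fredholm index *)

Section Favourable.
Variable R : realType.
Local Notation C := R[i].
Implicit Types (x y z : int -> C) (p q : \bar R) (I : set int) (a b : tri R) (U V W : set C).

Lemma ratio_scale p I a x K (th : R) : (1 <= p)%E -> 0 <= th -> nb p x K ->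
  nb p (rest I (act a x)) (th * lpn p x) -> forall (r : C) M,
  nb p (fun i => r * x i) M -> nb p (rest I (act a (fun i => r * x i))) (th * M).
Proof.
move=> p1 th0 nx nA r M nM; have M0 := nb_ge0 p1 nM.
have rM : cabs r * lpn p x <= M.
  have [->|r0] := eqVneq r 0; first by rewrite cabs0 mul0r.
  rewrite mulrC -ler_pdivlMr ?cabs_gt0//; apply: lpn_le => //.
  have := nb_scale r^-1 p1 nM; rewrite cabsV mulrC; apply: (nb_dom p1) => i.
  by rewrite mulKf.
have le1 : cabs r * (th * lpn p x) <= th * M by rewrite mulrCA ler_wpM2l.
apply: (nb_dom p1 _ (nb_le le1 (nb_scale r p1 nA))) => i.
by rewrite /rest; case: ifP => _; rewrite ?mulr0// actZ.
Qed.

(* For p = q = 2 a half-line operator and its transpose have inverses of the same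
   norm, so near-null vectors of both can be glued into one of a bi-infinite
   operator. *)
Lemma halfline_Good2 U V W c d : U !=set0 -> V !=set0 -> W !=set0 -> 0 <= d ->
  (forall a, Cls U V W a -> bnd a c) ->
  (forall a, Cls U V W a -> inv Nat0 a) ->
  (forall b, Cls U V W b -> Good 2%:E 2%:E [set: int] b d) ->
  forall a, Cls U V W a -> Good 2%:E 2%:E Nat0 a d.
Proof.
move=> [u Uu] [v Vv] [w Ww] d0 hc hi hG a ca.
have cj := conj_exp2 R; have [p1 _ _] := cj.
(* Solutions for unit vectors exist with some bound, so only the lower bound can fail. *)
have notBB b : inv Nat0 b -> ~ Good 2%:E 2%:E Nat0 b d -> ~ BB 2%:E Nat0 b d.
  move=> [d' d'0 [hS _]] nG hB; apply: nG; apply: (BB_Good cj d0 hB) => k Ik.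
  have [x [sx ex nx]] := hS (delta R k) [:: k] isT (@delta_out R k) (@delta_supp R Nat0 k Ik).
  by exists x; split=> //; eexists; exact: nx.
apply: contrapT => nG.
(* At the exponents (2, 2) [Good] is symmetric under transposition, so the transpose fails too and
   supplies the left half. *)
have nG' : ~ Good 2%:E 2%:E Nat0 (tr a) d by move=> /Good_tr; rewrite trK.
have [x [th1 [sx [K1 nx] [i xi] [th10 dth1] nA1]]] := notBB_ratio p1 d0 (notBB _ (hi a ca) nG).
have [y [th2 [sy [K2 ny] [j yj] [th20 dth2] nA2]]] :=
  notBB_ratio p1 d0 (notBB _ (inv_tr (hi a ca)) nG').
pose th := Num.max th1 th2.
have th0 : 0 <= th by rewrite le_max th10.
have dth : d * th < 1 by rewrite /th; case: (leP th1 th2).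
have up1 (t : int -> C) : nb 2%:E t (th1 * lpn 2%:E x) -> nb 2%:E t (th * lpn 2%:E x).
  by move=> h; apply: nb_le h; rewrite ler_wpM2r ?(lpn_ge0 p1 nx)// le_max lexx.
have up2 (t : int -> C) : nb 2%:E t (th2 * lpn 2%:E y) -> nb 2%:E t (th * lpn 2%:E y).
  by move=> h; apply: nb_le h; rewrite ler_wpM2r ?(lpn_ge0 p1 ny)// le_max lexx orbT.
have rs1 := ratio_scale p1 th0 nx (up1 _ nA1).
have rs2 := ratio_scale p1 th0 ny (up2 _ nA2).
(* These coefficients annihilate the middle row. *)
have [s [r [e sr]]] := solve_linear2 (u * y 0) (w * x 0).
have sx' := supp_scale r sx; have sy' := supp_scale s sy.
pose z := gluev (fun i => r * x i) (fun i => s * y i).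
have nz := nb_gluev p1 (nb_scale r p1 nx) (nb_scale s p1 ny).
have cg := Cls_glue ca (Cls_tr ca) Uu Vv Ww.
have hB := Good_BB cj (hc _ cg) d0 (hG _ cg).
have ag t := act_glue a (tr a) u v w sx' sy' t.
have fi : injective (fun t : int => -1 - t) := inv_inj (@subKint (-1)).
have z0 : forall t, z t = 0.
  apply: (BB_ratio p1 d0 dth hB _ nz) => [t []//|].
  (* The blocks are the two halves and the middle row; each half carries one scaled near-null
     vector. *)
  apply: (nb_blocks (b := fun t : int => Num.sg t) p1 th0 _ (nb_lpn p1 nz)) => k M nM.
  have M0 := nb_ge0 p1 nM.
  have n1 : k = 1 -> nb 2%:E (fun t => r * x t) M.
    move=> k1; apply: (nb_dom p1 _ (nb_comp p1 (addIr 1) nM)) => t /=.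
    case: (lerP 0 t) => t0; last by rewrite sx' ?cabs0 ?cabs_ge0// /Nat0 /=; clear -t0; lia.
    rewrite restE /=; last by rewrite k1 gtr0_sg//; clear -t0; lia.
    rewrite /z /gluev addrK sy' ?addr0//.
    by rewrite /Nat0 /=; clear -t0; lia.
  have n2 : k = -1 -> nb 2%:E (fun t => s * y t) M.
    move=> k1; apply: (nb_dom p1 _ (nb_comp p1 fi nM)) => t /=.
    case: (lerP 0 t) => t0; last by rewrite sy' ?cabs0 ?cabs_ge0// /Nat0 /=; clear -t0; lia.
    rewrite restE /=; last by rewrite k1 ltr0_sg//; clear -t0; lia.
    rewrite /z /gluev subKr sx' ?add0r//.
    by rewrite /Nat0 /=; clear -t0; lia.
  have [k1|k1] := eqVneq k 1.
    apply: (nb_dom p1 _ (nb_comp p1 (addIr (-1)) (rs1 r M (n1 k1)))) => t /=.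
    rewrite {1}/rest; case: ifPn => [|_]; last by rewrite cabs0 cabs_ge0.
    rewrite inE /= k1 => /eqP; rewrite sgr_cp0 => t0; rewrite restE// ag t0 restE//.
    by rewrite /Nat0 /=; clear -t0; lia.
  have [k2|k2] := eqVneq k (-1).
    apply: (nb_dom p1 _ (nb_comp p1 fi (rs2 s M (n2 k2)))) => t /=.
    rewrite {1}/rest; case: ifPn => [|_]; last by rewrite cabs0 cabs_ge0.
    rewrite inE /= k2 => /eqP; rewrite sgr_cp0 => t0; rewrite restE// ag ltNge (ltW t0) t0 /= restE//.
    by rewrite /Nat0 /=; clear -t0; lia.
  apply: (nb_dom p1 _ (nb_zero p1 (mulr_ge0 th0 M0))) => t.
  rewrite {1}/rest; case: ifPn => // ; rewrite inE /= => tk.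
  have t0 : t = 0.
    by apply/eqP; move: k1 k2; rewrite -tk; case: (sgrP t).
  by rewrite t0 restE// ag ltxx -[in leRHS]e /= !mulrA [u * s]mulrC [w * r]mulrC -!mulrA
     [y 0 * s]mulrC [x 0 * r]mulrC !mulrA [u * s]mulrC [w * r]mulrC.
have i0 := supp_ge0 sx xi; have j0 := supp_ge0 sy yj.
have [s0|s0] := eqVneq s 0.
  rewrite s0 eqxx /= in sr; have := z0 (i + 1); rewrite /z /gluev addrK s0 mul0r addr0.
  by move/eqP; rewrite mulf_eq0 (negbTE sr) (negbTE xi).
have := z0 (- 1 - j); rewrite /z /gluev sx' ?add0r ?subKr.
  by move/eqP; rewrite mulf_eq0 (negbTE s0) (negbTE yj).
by rewrite /Nat0 /=; clear -j0; lia.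
Qed.

(** Reflecting the transpose preserves both the class and Z. *)
Lemma bi_dual p q U V W d : conj_exp p q ->
  (forall a, Cls U V W a -> Good p q [set: int] a d) ->
  forall a, Cls U V W a -> Good q p [set: int] a d.
Proof.
move=> cj h a ca; have := Good_flip 0 cj (h _ (Cls_flip 0 (Cls_tr ca))).
rewrite flipK => /Good_tr; rewrite trK.
by rewrite (_ : [set i | _] = setT)//; apply/seteqP; split.
Qed.

Section Fredholm.
Variables (U V W : set C) (c : R).
Hypotheses (U0 : U !=set0) (V0 : V !=set0) (W0 : W !=set0).
Hypotheses (cU : ucompact U) (cV : ucompact V) (cW : ucompact W).
Hypothesis hc : forall a, Cls U V W a -> bnd a c.

Lemma Cls_nonempty : exists a, Cls U V W a.
Proof.
by have [[u Uu] [v Vv] [w Ww]] := And3 U0 V0 W0; exists (tz u v w) => i.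
Qed.

Lemma compatibleP : compatible U V W <-> biinv U V W.
Proof.
split=> [h a ca|h B tB].
  have := h _ (coefs_tridiagonal id ca).
  by rewrite (invertible_inv (@inj_id int) (hc ca) (fun k l => erefl)) range_id.
have [a ca ra] := tridiagonal_coefs (@inj_id int) U0 V0 W0 tB.
by rewrite (invertible_inv (@inj_id int) (hc ca) ra) range_id; exact: h.
Qed.

Lemma invertible_kappa0 : (forall a, Cls U V W a -> inv Nat0 a) -> has_kappa U V W 0.
Proof.
move=> h B tB; have [a ca ra] := tridiagonal_coefs Posz_inj U0 V0 W0 tB.
have : invertible 2%:E B.
  by rewrite (invertible_inv Posz_inj (hc ca) ra) range_Posz; exact: h.
have [p1 _ _] := conj_exp2 R.
move=> [T [_ hT]]; exists 0%N, 0%N; split; last by [].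
- have z0 := lp_zero Posz_inj p1; have B0 := mxact_zero Posz_inj ra.
  rewrite /ker_dim; exists (fun _ _ => 0); split=> [k|x lx ex]; first by have := ltn_ord k; rewrite ltn0.
  have [_ e1 _] := hT x lx; have [_ e2 _] := hT _ z0.
  exists 0; split=> [|c' _]; last by apply/matrixP => ? k; have := ltn_ord k; rewrite ltn0.
  by apply/funext => i; rewrite big_ord0 -e1 ex -B0 e2.
- rewrite /coker_dim; exists (fun _ _ => 0); split=> [k|y ly]; first by have := ltn_ord k; rewrite ltn0.
  have [l1 _ e1] := hT y ly.
  exists 0; split=> [|c' _]; last by apply/matrixP => ? k; have := ltn_ord k; rewrite ltn0.
  by exists (T y) => //; apply/funext => i; rewrite big_ord0 addr0 e1.
Qed.

(** If 0 and every unit vector are coordinates of the same object, uniqueness leaves no coordinate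
    at all. *)
Lemma basis_trivial (m : nat) (P : 'rV[C]_m -> Prop) :
  (exists! r, P r) -> P 0 -> (forall k, P (delta_mx ord0 k)) -> m = 0%N.
Proof.
case: m P => // m P [r [_ u]] p0 pd.
have := u _ p0; rewrite (u _ (pd ord0)) => /matrixP/(_ ord0 ord0)/eqP.
by rewrite !mxE !eqxx oner_eq0.
Qed.

Lemma sum_delta_mx (m : nat) k (f : 'I_m -> C) : 
  \sum_(l < m) (delta_mx ord0 k : 'rV[C]_m) ord0 l * f l = f k.
Proof.
rewrite (bigD1 k)//= mxE !eqxx mul1r big1 ?addr0// => l lk.
by rewrite mxE (negbTE lk) andbF mul0r.
Qed.

(** In the other two cases of the trichotomy either kernel or cokernel is trivial, so by index 0
    both are. This contradicts the null vector of the matrix or of its transpose. *)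
Lemma kappa0_Good : biinv U V W -> has_kappa U V W 0 ->
  exists2 d, 0 <= d & forall a, Cls U V W a -> Good +oo%E 1%E Nat0 a d.
Proof.
move=> hb hk; have [a ca] := Cls_nonempty; have cj := conj_exp2 R; have [p1 _ _] := cj.
pose A (k l : nat) := mat a k%:Z l%:Z.
have rA : represents Posz a A by [].
have mA (x : nat -> C) k : mxact A x k = act a (push Posz x) k%:Z := mxactE Posz_inj x k rA.
have pushNat0 (x : nat -> C) : supp Nat0 (push Posz x) by rewrite -range_Posz; exact: supp_push.
have pushpull x : supp Nat0 x -> push Posz (pull Posz x) = x.
  by move=> sx; rewrite (push_pull Posz_inj) range_Posz; apply/funext => i; rewrite rest_supp.
have lpush (x : nat -> C) : lp 2%:E x -> exists M, nb 2%:E (push Posz x) M.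
  by move=> /lpP[M M0 nM]; exists M; exact: (proj2 (nb_push Posz_inj x p1 M0)).
have lpull x M : supp Nat0 x -> nb 2%:E x M -> lp 2%:E (pull Posz x).
  move=> sx nM; apply/lpP; exists M; first exact: nb_ge0 nM.
  by rewrite -(nb_push Posz_inj) ?pushpull// (nb_ge0 p1 nM).
have [n [m [[e [he he']] [f [hf hf']] nm]]] := hk _ (coefs_tridiagonal Posz ca).
rewrite -/A in he he' hf'.
have z0 := lp_zero Posz_inj p1; have A0 := mxact_zero Posz_inj rA.
case: (index_trichotomy U0 V0 W0 cU cV cW hb) => // -[hh hker_all]; exfalso.
- have [x kx] := hker_all a ca.
  have surj (y : nat -> C) : lp 2%:E y -> exists2 z, lp 2%:E z & mxact A z = y.
    move=> /lpush[M nM].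
    have [z [K [sz nz ez]]] := solve_half cU cV cW hb hh ca kx cj (pushNat0 y) nM.
    exists (pull Posz z); first exact: lpull nz.
    by apply/funext => k; rewrite mA pushpull// ez// (pushE Posz_inj).
  have m0 : m = 0%N.
    case: m f hf hf' nm => // m f hf hf' _.
    apply: (basis_trivial (hf' (fun=> 0) z0)).
      by exists (fun=> 0) => //; apply/funext => i; rewrite A0 big1 ?addr0// => k _; rewrite mxE mul0r.
    move=> k; have lf : lp 2%:E (fun i => - f k i).
      have [M nM] := lpush _ (hf k).
      have := nb_scale (-1) p1 nM => nN.
      have -> : (fun i => - f k i) = pull Posz (fun i => -1 * push Posz (f k) i).
        by apply/funext => i; rewrite /pull (pushE Posz_inj) mulN1r.
      by apply: lpull nN; apply: supp_scale.
    have [z lz ez] := surj _ lf; exists z => //; apply/funext => i.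
    by rewrite ez sum_delta_mx addNr.
  have n0 : n = 0%N by move: nm; rewrite m0; clear; lia.
  have [sx _ [i xi] ex] := kx; have [K nK] := kernel_lp cU cV cW hb ca kx cj.
  have Ax : mxact A (pull Posz x) = fun=> 0.
    by apply/funext => k; rewrite mA pushpull// ex.
  subst n; have [c' [e' _]] := he' _ (lpull _ _ sx nK) Ax.
  have i0 := supp_ge0 sx xi.
  have : pull Posz x (absz i) = 0 by rewrite e' big_ord0.
  by rewrite /pull gez0_abs// => xi0; rewrite xi0 eqxx in xi.
- have e0 k : e k = fun=> 0.
    have [/lpush[M nM] ek] := he k; apply/funext => i; rewrite -(pushE Posz_inj (e k)).
    apply/eqP/negP => /negP ei; apply: (hh a ca); exists (push Posz (e k)); split.
    - exact: pushNat0.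
    - by exists M; apply/nb_supP => j; exact: nb_point nM.
    - by exists i%:Z.
    - move=> [j|//] _; by rewrite -mA ek.
  have n0 : n = 0%N.
    apply: (basis_trivial (he' (fun=> 0) z0 A0)).
      by apply/funext => i; rewrite big1// => k _; rewrite mxE mul0r.
    by move=> k; apply/funext => i; rewrite big1// => l _; rewrite e0 mulr0.
  have m0 : m = 0%N by move: nm; rewrite n0; clear; lia.
  have [y ky] := hker_all _ (Cls_tr ca).
  have [sy _ [i yi] ey] := ky.
  have [K nK] := kernel_lp cW cV cU (biinv_swap hb) (Cls_tr ca) ky cj.
  have i0 := supp_ge0 sy yi.
  have sd : supp Nat0 (delta R i) by exact: delta_supp.
  subst m; have [c' [[x lx ex] _]] := hf' _ (lpull _ _ sd (@nb_delta R _ i p1)).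
  have [M nM] := lpush _ lx.
  have ax t : Nat0 t -> act a (push Posz x) t = delta R i t.
    case: t => [t|//] _; rewrite -mA; have := congr1 (fun g => g t) ex.
    by rewrite big_ord0 addr0 => <-.
  have := pairing cj (hc ca) nM nK (pushNat0 x) sy ey ax (J := [::]) (J' := [:: i])
    isT isT (fun _ _ => erefl) (@delta_out R i).
  rewrite big_nil big_seq1 /delta eqxx mul1r => y0.
  by rewrite -y0 eqxx in yi.
Qed.

End Fredholm.
End Favourable.

(** * Alternatives for the shifted triple *)

Section Resolvent.
Variable R : realType.
Local Notation C := R[i].
Implicit Types (p q : \bar R) (a b : tri R) (U V W : set C).
Local Notation "z ^*" := (conjc z) : ring_scope.

Section Triple.
Variables (U V W : set C) (c : R).
Hypotheses (U0 : U !=set0) (V0 : V !=set0) (W0 : W !=set0).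
Hypotheses (cU : ucompact U) (cV : ucompact V) (cW : ucompact W).
Hypotheses (c0 : 0 <= c) (hc : forall a, Cls U V W a -> bnd a c).

(** With lambda moved to 0: the origin lies inside every ellipse, which is expressed through a point
    z of the open disc. *)
Definition clockwise : Prop := forall u v w, U u -> V v -> W w ->
  cabs u < cabs w /\ exists2 z, cabs z < 1 & v + w * z + u * z^* = 0.

Definition counterclockwise : Prop := forall u v w, U u -> V v -> W w ->
  cabs w < cabs u /\ exists2 z, cabs z < 1 & v + w * z + u * z^* = 0.

Lemma Cls_tz u v w : U u -> V v -> W w -> Cls U V W (tz u v w).
Proof. by []. Qed.

Lemma half_inv : biinv U V W -> has_kappa U V W 0 -> forall a, Cls U V W a -> inv Nat0 a.
Proof.
move=> hb hk a ca; have [d d0 hd] := kappa0_Good U0 V0 W0 cU cV cW hc hb hk.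
exact: Good_inv (conj_expy1 R) c0 (hc ca) d0 (hd a ca).
Qed.

Lemma no_kernel_half a : inv Nat0 a -> Cls U V W a -> ~ hker a /\ ~ hker (tr a).
Proof.
move=> ia ca; split; first exact: inv_not_kernel c0 (hc ca) ia.
exact: inv_not_kernel c0 (bnd_tr (hc ca)) (inv_tr ia).
Qed.

(** Index 0 excludes null vectors of the Toeplitz members and of their transposes, so 0 lies in no
    filled ellipse. *)
Lemma half_inv_disc u v w (z : C) : biinv U V W -> has_kappa U V W 0 -> U u -> V v -> W w ->
  cabs z <= 1 -> v + w * z + u * z^* = 0 -> False.
Proof.
move=> hb hk Uu Vv Ww z1 e; have ct := Cls_tz Uu Vv Ww.
have [n1 n2] := no_kernel_half (half_inv hb hk ct) ct.
by case: (disc_kernel z1 e) => //; exact: inv_not_kernel c0 (hc ct) (hb _ ct).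
Qed.

Lemma index_alternative : biinv U V W -> ~ has_kappa U V W 0 ->
  (forall a, Cls U V W a -> ~ inv Nat0 a) /\ (clockwise \/ counterclockwise).
Proof.
move=> hb nk; case: (index_trichotomy U0 V0 W0 cU cV cW hb) => [[d d0 hd]|[_ hk]|[_ hk]].
- exfalso; apply: nk; apply: (invertible_kappa0 U0 V0 W0 hc) => a ca.
  exact: Good_inv (conj_expy1 R) c0 (hc ca) d0 (hd a ca).
- split=> [a ca ia|]; first by have [n1 _] := no_kernel_half ia ca; exact: n1 (hk a ca).
  left=> u v w Uu Vv Ww; have ct := Cls_tz Uu Vv Ww; have [x kx] := hk _ ct.
  exact: kernel_disc kx (inv_not_kernel c0 (hc ct) (hb _ ct)).
- split=> [a ca ia|].
    by have [_ n2] := no_kernel_half ia ca; exact: n2 (hk _ (Cls_tr ca)).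
  right=> u v w Uu Vv Ww; have ct := Cls_tz Uu Vv Ww; have [x kx] := hk _ (Cls_tr ct).
  have nk' : ~ exists y, kernel setT (tr (tz u v w)) y.
    exact: inv_not_kernel c0 (bnd_tr (hc ct)) (inv_tr (hb _ ct)).
  have [h [z z1 e]] := kernel_disc kx nk'; split=> //.
  by exists z^*; [rewrite cabs_conj|rewrite conjcK -[RHS]e; ring].
Qed.

Lemma PsiE_represents A : PsiE_plus U V W A -> exists2 a, Cls U V W a & represents Posz a A.
Proof. by move=> [tA _]; exact: (tridiagonal_coefs Posz_inj U0 V0 W0 tA). Qed.

(** A bound for one pseudoergodic half-line matrix makes all bi-infinite matrices invertible; as the
    index is not 0, no half-line matrix is then invertible. *)
Lemma half_plus_PsiE p q a A d : conj_exp p q -> 0 <= d -> PsiE_plus U V W A ->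
  Cls U V W a -> represents Posz a A -> ~ (biinv U V W /\ has_kappa U V W 0) ->
  ~ Good p q Nat0 a d.
Proof.
move=> cj d0 hA ca ra nI hG.
have hb : biinv U V W.
  move=> b cb; apply: (Good_inv cj c0 (hc cb) d0).
  by apply: (PsiE_Good cj d0 hA ra) cb; left.
have [h _] := index_alternative hb (fun hk => nI (conj hb hk)).
exact: (h a ca) (Good_inv cj c0 (hc ca) d0 hG).
Qed.

Lemma bi_alternative p q d : conj_exp p q -> 0 <= d -> ~ (biinv U V W /\ has_kappa U V W 0) ->
  ~ (forall a, Cls U V W a -> Good p q [set: int] a d) \/ (clockwise \/ counterclockwise).
Proof.
move=> cj d0 nI; case: (pselect (forall a, Cls U V W a -> Good p q [set: int] a d)) => h.
  right; have hb : biinv U V W.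
    by move=> b cb; exact: Good_inv cj c0 (hc cb) d0 (h b cb).
  by have [_] := index_alternative hb (fun hk => nI (conj hb hk)).
by left.
Qed.

Lemma favourable_Good p q d a A : conj_exp p q -> 0 <= d -> favourable U V W p ->
  PsiE_plus U V W A -> Cls U V W a -> represents Posz a A ->
  (Good p q Nat0 a d <-> forall b, Cls U V W b -> Good p q Nat0 b d) /\
  (Good p q Nat0 a d <-> forall b, Cls U V W b -> Good p q [set: int] b d).
Proof.
move=> cj d0 hf hA ca ra; have [[_ ub1] [[B tB eB] ub2]] := hf A hA.
have hP b B' : represents Posz b B' -> Cls U V W b ->
    (invnorm p B' <= d%:E)%E <-> Good p q Nat0 b d.
  by move=> rb cb; rewrite (invnormP Posz_inj cj d0 (hc cb) rb) range_Posz.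
have hZ b B' : represents id b B' -> Cls U V W b ->
    (invnorm p B' <= d%:E)%E <-> Good p q [set: int] b d.
  by move=> rb cb; rewrite (invnormP (@inj_id int) cj d0 (hc cb) rb) range_id.
split; split=> [h|h]; last 1 first.
- have [b cb rb] := tridiagonal_coefs (@inj_id int) U0 V0 W0 tB.
  by apply/(hP _ _ ra ca); rewrite -eB; apply/(hZ _ _ rb cb); exact: h.
- move=> b cb; apply/(hP b (fun k l => mat b k%:Z l%:Z) (fun k l => erefl) cb).
  apply: le_trans (proj2 (hP _ _ ra ca) h); apply: ub1.
  by exists (fun k l => mat b k%:Z l%:Z) => //; exact: coefs_tridiagonal.
- exact: h.
- move=> b cb; apply/(hZ b (mat b) (fun k l => erefl) cb).
  apply: le_trans (proj2 (hP _ _ ra ca) h); apply: ub2.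
  by exists (mat b) => //; exact: (coefs_tridiagonal id).
Qed.

(** The bound of A passes to every bi-infinite matrix by translation, and from there to every
    half-line matrix by [halfline_Good2]. *)
Lemma favourable2 : biinv U V W -> has_kappa U V W 0 -> favourable U V W 2%:E.
Proof.
move=> hb hk A hA; have cj := conj_exp2 R; have [p1 _ _] := cj.
have [a ca ra] := PsiE_represents hA.
have hi := half_inv hb hk.
have fin (K : choiceType) (pos : K -> int) b B : injective pos -> represents pos b B ->
    Cls U V W b -> inv (range pos) b -> exists2 d, 0 <= d & (invnorm 2%:E B <= d%:E)%E.
  move=> pI rb cb [d d0 hd]; exists d => //.
  by apply/(invnormP pI cj d0 (hc cb) rb).
have ge0 (K : choiceType) (k : K) (B : K -> K -> C) : (0 <= invnorm 2%:E B)%E.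
  rewrite /invnorm; case: pselect => // e; case: cid => T _ /=.
  have n0 : nb 2%:E (fun _ : K => 0 : C) 1.
    apply/nb_sumP => // J _; rewrite big1 ?powR_ge0// => i _.
    by rewrite cabs0 powR0// pnatr_eq0.
  apply: le_trans (ereal_sup_ubound _); last by exists (fun=> 0).
  exact: poweR_ge0.
have val (K : choiceType) (k : K) (pos : K -> int) b B : injective pos -> represents pos b B ->
    Cls U V W b -> inv (range pos) b ->
    exists2 d, 0 <= d & invnorm 2%:E B = d%:E.
  move=> pI rb cb ib; have [d d0 hd] := fin _ _ _ _ pI rb cb ib.
  exists (fine (invnorm 2%:E B)); first exact/fine_ge0/ge0.
  by rewrite fineK// ge0_fin_numE ?ge0// (le_lt_trans hd)// ltry.
have iN b : Cls U V W b -> inv (range Posz) b by rewrite range_Posz; exact: hi.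
have iZ b : Cls U V W b -> inv (range (@id int)) b by rewrite range_id; exact: hb.
have [d d0 eA] := val _ 0%N _ _ _ Posz_inj ra ca (iN a ca).
have gA : Good 2%:E 2%:E Nat0 a d.
  by rewrite -range_Posz; apply/(invnormP Posz_inj cj d0 (hc ca) ra); rewrite eA.
have gZ := PsiE_Good cj d0 hA ra (or_introl gA).
have gN := halfline_Good2 U0 V0 W0 d0 hc hi gZ.
have tZ b : Cls U V W b -> (invnorm 2%:E (mat b) <= d%:E)%E.
  move=> cb; apply/(invnormP (@inj_id int) cj d0 (hc cb) (fun k l => erefl)).
  by rewrite range_id; exact: gZ.
split; split.
- by exists A => //; case: hA.
- move=> _ [B tB <-]; have [b cb rb] := tridiagonal_coefs Posz_inj U0 V0 W0 tB.
  by rewrite eA; apply/(invnormP Posz_inj cj d0 (hc cb) rb); rewrite range_Posz; exact: gN.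
(* The maximum is attained at the continuation of A to Z: its translates have the same limits, so
   its own bound returns to A. *)
- exists (mat a); first exact: (coefs_tridiagonal id).
  apply/eqP; rewrite eq_le; apply/andP; split; first by rewrite eA tZ.
  have [d' d'0 eB] := val _ 0 _ _ _ (@inj_id int) (fun k l => erefl) ca (iZ a ca).
  have gB : Good 2%:E 2%:E [set: int] a d'.
    by rewrite -range_id; apply/(invnormP (@inj_id int) cj d'0 (hc ca) (fun k l => erefl)); rewrite eB.
  have gZ' := PsiE_Good cj d'0 hA ra (or_intror gB).
  have gN' := halfline_Good2 U0 V0 W0 d'0 hc hi gZ'.
  by rewrite eB; apply/(invnormP Posz_inj cj d'0 (hc ca) ra); rewrite range_Posz; exact: gN'.
- move=> _ [B tB <-]; have [b cb rb] := tridiagonal_coefs (@inj_id int) U0 V0 W0 tB.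
  by rewrite eA; apply/(invnormP (@inj_id int) cj d0 (hc cb) rb); rewrite range_id; exact: gZ.
Qed.

End Triple.

(** * Extreme moduli, and pseudospectra in terms of [Good] *)

Lemma max_abs_attained (S : set C) : S !=set0 -> ucompact S ->
  exists2 s, S s & max_abs S <= cabs s.
Proof.
move=> [s0 Ss0] cS; have [B hB] := ucompact_bounded cS.
have hs : has_sup [set cabs z | z in S].
  by split; [exists (cabs s0), s0|exists B => _ [z Sz <-]; exact: hB].
have ex n : exists s, S s /\ max_abs S - n.+1%:R^-1 < cabs s.
  have e0 : (0 : R) < n.+1%:R^-1 by rewrite invr_gt0 ltr0n.
  by have [_ [s Ss <-] h] := sup_adherent e0 hs; exists s.
have [l Sl hl] := cS (fun n => projT1 (cid (ex n))) (fun n => proj1 (projT2 (cid (ex n)))).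
exists l => //; apply/ler_addgt0Pr => e e0; have e2 : 0 < e / 2 by lra.
have [n [h1 h3]] := ev_ex (ev_and (hl _ e2) (ev_small e2)).
move: h1; case: cid => s [Ss hs'] /= h1.
have := le_trans (cabs_sub_lower s l) h1.
by move: h3 hs'; move: (n.+1%:R^-1 : R) => x; lra.
Qed.

Lemma min_abs_attained (S : set C) : S !=set0 -> ucompact S ->
  exists2 s, S s & cabs s <= min_abs S.
Proof.
move=> [s0 Ss0] cS.
have hs : has_inf [set cabs z | z in S].
  by split; [exists (cabs s0), s0|exists 0 => _ [z Sz <-]; exact: cabs_ge0].
have ex n : exists s, S s /\ cabs s < min_abs S + n.+1%:R^-1.
  have e0 : (0 : R) < n.+1%:R^-1 by rewrite invr_gt0 ltr0n.
  by have [_ [s Ss <-] h] := inf_adherent e0 hs; exists s.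
have [l Sl hl] := cS (fun n => projT1 (cid (ex n))) (fun n => proj1 (projT2 (cid (ex n)))).
exists l => //; apply/ler_addgt0Pr => e e0; have e2 : 0 < e / 2 by lra.
have [n [h1 h3]] := ev_ex (ev_and (hl _ e2) (ev_small e2)).
move: h1; case: cid => s [Ss hs'] /= h1.
rewrite -cabsN opprB in h1; have := le_trans (cabs_sub_lower l s) h1.
by move: h3 hs'; move: (n.+1%:R^-1 : R) => x; lra.
Qed.

Lemma Sigma_finE p q U V W c (lam : C) eps : conj_exp p q -> 0 < eps ->
  U !=set0 -> V !=set0 -> W !=set0 ->
  (forall a, Cls U [set v - lam | v in V] W a -> bnd a c) ->
  Sigma_fin U V W eps p lam <-> exists n a,
    [/\ (0 < n)%N, Cls U [set v - lam | v in V] W a & ~ Good p q (Fin n) a eps^-1].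
Proof.
move=> cj e0 U0 V0 W0 hc.
have fam n := pspec_family (@ord_inj_int n) cj e0 U0 V0 W0 hc.
split=> [[n /= n0 [F MF hF]]|[n [a [n0 ca nG]]]].
  have [a ca nG] : exists2 a, Cls U [set v - lam | v in V] W a &
      ~ Good p q (range (fun i : 'I_n => Posz i)) a eps^-1 by apply/fam; exists F.
  by exists n, a; rewrite -range_ord.
have [A tA hA] : (\bigcup_(A in [set A | tridiagonal (fun i : 'I_n => Posz i) U V W A])
    pspec eps p A) lam by apply/fam; exists a => //; rewrite range_ord.
exists n => //; exists (\matrix_(i, j) A i j).
  by move=> i j; have := tA i j; rewrite !mxE.
have -> // : fun_of_matrix (\matrix_(i, j) A i j) = A.
by apply/funext => i; apply/funext => j; rewrite mxE.
Qed.

Lemma not_forall_Cls U V W (P : tri R -> Prop) :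
  (exists2 a, Cls U V W a & ~ P a) <-> ~ forall a, Cls U V W a -> P a.
Proof.
split=> [[a ca nP] h|h]; first exact: nP (h a ca).
by apply: contrapT => n; apply: h => a ca; apply: contrapT => nP; apply: n; exists a.
Qed.

Lemma Sigma_plusE p q U V W c (lam : C) eps : conj_exp p q -> 0 < eps ->
  U !=set0 -> V !=set0 -> W !=set0 ->
  (forall a, Cls U [set v - lam | v in V] W a -> bnd a c) ->
  Sigma_plus_eps U V W eps p lam <->
  ~ forall a, Cls U [set v - lam | v in V] W a -> Good p q Nat0 a eps^-1.
Proof.
move=> cj e0 U0 V0 W0 hc; rewrite -not_forall_Cls -range_Posz.
exact: (pspec_family Posz_inj cj e0 U0 V0 W0 hc).
Qed.

Lemma Sigma_epsE p q U V W c (lam : C) eps : conj_exp p q -> 0 < eps ->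
  U !=set0 -> V !=set0 -> W !=set0 ->
  (forall a, Cls U [set v - lam | v in V] W a -> bnd a c) ->
  Sigma_eps U V W eps p lam <->
  ~ forall a, Cls U [set v - lam | v in V] W a -> Good p q [set: int] a eps^-1.
Proof.
move=> cj e0 U0 V0 W0 hc; rewrite -not_forall_Cls -range_id.
exact: (pspec_family (@inj_id int) cj e0 U0 V0 W0 hc).
Qed.

Lemma Sigma_fin_union p q U V W eps : conj_exp p q -> 0 < eps ->
  U !=set0 -> V !=set0 -> W !=set0 -> ucompact U -> ucompact V -> ucompact W ->
  Sigma_fin U V W eps p = Sigma_plus_eps U V W eps p `|` Sigma_plus_eps U V W eps q.
Proof.
move=> cj e0 U0 V0 W0 cU cV cW; apply/funext => lam; apply/propext.
have [c c0 hc] := Cls_bnd cU (ucompact_shift (lam := lam) cV) cW.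
have d0 : 0 <= eps^-1 by rewrite invr_ge0 ltW.
rewrite /setU /= (Sigma_finE cj e0 U0 V0 W0 hc) (Sigma_plusE cj e0 U0 V0 W0 hc).
rewrite (Sigma_plusE (conj_exp_sym cj) e0 U0 V0 W0 hc).
split=> [[n [a [n0 ca nG]]]|h].
  apply: contrapT => /not_orP[/contrapT h1 /contrapT h2]; apply: nG.
  exact: (fin_of_plus cj d0 U0 W0 hc h1 h2).
apply: contrapT => nf.
have hfin n a : (0 < n)%N -> Cls U [set v - lam | v in V] W a -> Good p q (Fin n) a eps^-1.
  by move=> n0 ca; apply: contrapT => nG; apply: nf; exists n, a.
by case: h; apply=> a ca; have [] := plus_of_fin cj d0 hfin ca.
Qed.

Lemma pspec_PsiE p q U V W c (lam : C) eps A a : conj_exp p q -> 0 < eps ->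
  (forall a, Cls U [set v - lam | v in V] W a -> bnd a c) ->
  Cls U [set v - lam | v in V] W a -> represents Posz a (mxshift A lam) ->
  pspec eps p A lam <-> ~ Good p q Nat0 a eps^-1.
Proof.
move=> cj e0 hc ca ra; have d0 : 0 <= eps^-1 by rewrite invr_ge0 ltW.
rewrite -range_Posz /pspec /= ltNge; split=> [/negP h hG|h].
  by apply: h; apply/(invnormP Posz_inj cj d0 (hc a ca) ra).
by apply/negP => /(invnormP Posz_inj cj d0 (hc a ca) ra).
Qed.

Lemma E_pm1_sub_cap U V W : E_pm1 U V W `<=` E_cap U V W.
Proof. by move=> lam [[]|[]]. Qed.

Lemma E_cap_sub_cup U V W : U !=set0 -> V !=set0 -> W !=set0 -> E_cap U V W `<=` E_cup U V W.
Proof.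
move=> [u Uu] [v Vv] [w Ww] lam /(_ u v w Uu Vv Ww) h.
by exists u => //; exists v => //; exists w => //; exact: interior_subset h.
Qed.

Lemma orientation_E_pm1 U V W (lam : C) : U !=set0 -> V !=set0 -> W !=set0 ->
  let V' := [set v - lam | v in V] in
  clockwise U V' W \/ counterclockwise U V' W -> E_pm1 U V W lam.
Proof.
move=> U0 [v0 Vv0] W0 V'.
have inner u v w z : cabs u != cabs w -> cabs z < 1 -> v - lam + w * z + u * z^* = 0 ->
    ellipse_interior u v w lam.
  move=> uw z1 e; have -> : lam = v + w * z + u * z^*.
    by apply/eqP; rewrite eq_sym -subr_eq0; apply/eqP; rewrite -[RHS]e; ring.
  exact: disc_ellipse_interior.
have V'v v : V v -> V' (v - lam) by move=> Vv; exists v.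
case=> h; [right|left]; split.
- move=> u v w Uu Vv Ww; have [uw [z z1 e]] := h u _ w Uu (V'v v Vv) Ww.
  by apply: inner z1 e; rewrite lt_eqF.
- by move=> u w Uu Ww; have [] := h u _ w Uu (V'v v0 Vv0) Ww.
- move=> u v w Uu Vv Ww; have [uw [z z1 e]] := h u _ w Uu (V'v v Vv) Ww.
  by apply: inner z1 e; rewrite gt_eqF.
- by move=> u w Uu Ww; have [] := h u _ w Uu (V'v v0 Vv0) Ww.
Qed.

End Resolvent.

(** * The pseudospectral identities *)

Theorem corollary4p14 (R : realType) (U V W : set R[i])
  (U0 : U !=set0) (V0 : V !=set0) (W0 : W !=set0)
  (cU : compact (U : set R[i]^o))
  (cV : compact (V : set R[i]^o))
  (cW : compact (W : set R[i]^o)) :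
  (forall (eps : R) (p q : \bar R), 0 < eps ->
     (1 <= p)%E -> (1 <= q)%E -> (p^-1 + q^-1 = 1)%E ->
     Sigma_fin U V W eps p =
       Sigma_plus_eps U V W eps p `|` Sigma_plus_eps U V W eps q)
  /\
  [/\ forall (eps : R) (p q : \bar R), 0 < eps ->
       (1 <= p)%E -> (1 <= q)%E -> (p^-1 + q^-1 = 1)%E ->
       favourable_shifts U V W p -> favourable_shifts U V W q ->
       forall G : set R[i],
       [\/ G = E_pm1 U V W, G = E_cap U V W,
           G = E_cup U V W | G = Sigma_plus U V W] ->
       [/\ Sigma_fin U V W eps p = Sigma_plus_eps U V W eps p,
           Sigma_plus_eps U V W eps p = Sigma_eps U V W eps p `|` G,
           Sigma_eps U V W eps p `|` G = Sigma_eps U V W eps q `|` G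
         & Sigma_eps U V W eps q `|` G = Sigma_plus_eps U V W eps q]
       /\
       forall A B, PsiE_plus U V W A -> PsiE_plus U V W B ->
         Sigma_fin U V W eps p = pspec eps p A /\
         Sigma_fin U V W eps p = pspec eps q B,
      favourable_shifts U V W 2%:E
    & min_abs W <= max_abs U -> min_abs U <= max_abs W ->
      E_pm1 U V W = set0].
Proof.
have kU := ucompactP cU; have kV := ucompactP cV; have kW := ucompactP cW.
have V'0 lam : [set v - lam | v in V] !=set0 by have [v Vv] := V0; exists (v - lam), v.
split=> [eps p q e0 p1 q1 pq|]; first by apply: Sigma_fin_union => //; split.
split; last 2 first.
- move=> lam V' hcomp hk.
  have kV' := ucompact_shift (lam := lam) kV; have [c c0 hc] := Cls_bnd kU kV' kW.
  have hb : biinv U V' W by apply/(compatibleP U0 (V'0 lam) W0 hc).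
  exact: favourable2 U0 (V'0 lam) W0 kU kV' kW c0 hc hb hk.
- move=> wu uw; apply/seteqP; split=> // lam; case=> -[_ h].
    have [u Uu hu] := min_abs_attained U0 kU; have [w Ww hw] := max_abs_attained W0 kW.
    by have := lt_le_trans (le_lt_trans hw (h u w Uu Ww)) (le_trans hu uw); rewrite ltxx.
  have [u Uu hu] := max_abs_attained U0 kU; have [w Ww hw] := min_abs_attained W0 kW.
  by have := lt_le_trans (le_lt_trans hu (h u w Uu Ww)) (le_trans hw wu); rewrite ltxx.
move=> eps p q e0 p1 q1 pq fp fq G hG.
have cj : conj_exp p q by split.
have cj' := conj_exp_sym cj.
have d0 : 0 <= eps^-1 by rewrite invr_ge0 ltW.
(* Serves for the identities that mention no pseudoergodic matrix. *)
have [A0 hA0] := PsiE_exists U0 V0 W0.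
(* At a fixed lambda membership in each of the sets reduces to one and the same proposition P. *)
suff key lam A B : PsiE_plus U V W A -> PsiE_plus U V W B -> exists P : Prop,
    [/\ Sigma_plus_eps U V W eps p lam <-> P, Sigma_plus_eps U V W eps q lam <-> P,
        Sigma_eps U V W eps p lam \/ G lam <-> P, Sigma_eps U V W eps q lam \/ G lam <-> P
      & (pspec eps p A lam <-> P) /\ (pspec eps q B lam <-> P)].
  have fin lam : Sigma_fin U V W eps p lam <->
      Sigma_plus_eps U V W eps p lam \/ Sigma_plus_eps U V W eps q lam.
    by rewrite (Sigma_fin_union cj e0 U0 V0 W0 kU kV kW).
  split.
    split; apply/funext => lam; apply/propext; rewrite ?fin;
      have [P [h1 h2 h3 h4 _]] := key lam A0 A0 hA0 hA0; rewrite /setU /=; tauto.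
  move=> A B hA hB; split; apply/funext => lam; apply/propext; rewrite fin;
    have [P [h1 h2 h3 h4 [h5 h6]]] := key lam A B hA hB; tauto.
move=> hA hB; set V' := [set v - lam | v in V].
have kV' := ucompact_shift (lam := lam) kV; have [c c0 hc] := Cls_bnd kU kV' kW.
have [a ca ra] := PsiE_represents U0 (V'0 lam) W0 (PsiE_mxshift lam hA).
have [b cb rb] := PsiE_represents U0 (V'0 lam) W0 (PsiE_mxshift lam hB).
have Ep : Sigma_plus_eps U V W eps p lam <->
    ~ forall a, Cls U V' W a -> Good p q Nat0 a eps^-1 := Sigma_plusE cj e0 U0 V0 W0 hc.
have Eq : Sigma_plus_eps U V W eps q lam <->
    ~ forall a, Cls U V' W a -> Good q p Nat0 a eps^-1 := Sigma_plusE cj' e0 U0 V0 W0 hc.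
have Bp : Sigma_eps U V W eps p lam <->
    ~ forall a, Cls U V' W a -> Good p q [set: int] a eps^-1 := Sigma_epsE cj e0 U0 V0 W0 hc.
have Bq : Sigma_eps U V W eps q lam <->
    ~ forall a, Cls U V' W a -> Good q p [set: int] a eps^-1 := Sigma_epsE cj' e0 U0 V0 W0 hc.
have Pa := pspec_PsiE cj e0 hc ca ra.
have Pb := pspec_PsiE cj' e0 hc cb rb.
have compat := compatibleP U0 (V'0 lam) W0 hc.
(* At index 0 favourability applies and G contributes nothing; otherwise lambda belongs to every
   set. *)
case: (pselect (biinv U V' W /\ has_kappa U V' W 0)) => [[hb hk]|nI].
  have hcomp : compatible U V' W by apply/compat.
  have [a1 a2] := favourable_Good U0 (V'0 lam) W0 hc cj d0 (fp lam hcomp hk)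
    (PsiE_mxshift lam hA) ca ra.
  have [b1 b2] := favourable_Good U0 (V'0 lam) W0 hc cj' d0 (fq lam hcomp hk)
    (PsiE_mxshift lam hB) cb rb.
  have dual1 := @bi_dual R p q U V' W eps^-1 cj.
  have dual2 := @bi_dual R q p U V' W eps^-1 cj'.
  have nG : ~ G lam.
    have n1 : ~ E_cup U V W lam.
      move=> [u Uu [v Vv [w Ww /conv_hull_disc[z z1 e]]]].
      apply: (half_inv_disc U0 (V'0 lam) W0 kU kV' kW c0 hc hb hk Uu _ Ww z1 (v := v - lam)).
        by exists v.
      by rewrite {1}e; ring.
    have n2 : ~ E_cap U V W lam by move=> /(E_cap_sub_cup U0 V0 W0).
    case: hG => -> //; first by move/E_pm1_sub_cap.
    move=> [M tM]; apply; have [m cm rm] := tridiagonal_coefs Posz_inj U0 (V'0 lam) W0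
      (tridiagonal_shift Posz_inj lam tM).
    apply/(invertible_inv Posz_inj (hc m cm) rm); rewrite range_Posz.
    exact: half_inv U0 (V'0 lam) W0 kU kV' kW c0 hc hb hk _ cm.
  exists (~ Good p q Nat0 a eps^-1).
  have ab : Good p q Nat0 a eps^-1 <-> Good q p Nat0 b eps^-1.
    by split=> [/a2/dual1/b2|/b2/dual2/a2].
  by split; tauto.
have nA := half_plus_PsiE U0 (V'0 lam) W0 kU kV' kW c0 hc cj d0 (PsiE_mxshift lam hA) ca ra nI.
have nA' := half_plus_PsiE U0 (V'0 lam) W0 kU kV' kW c0 hc cj' d0 (PsiE_mxshift lam hA) ca ra nI.
have nB := half_plus_PsiE U0 (V'0 lam) W0 kU kV' kW c0 hc cj' d0 (PsiE_mxshift lam hB) cb rb nI.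
have Eg : clockwise U V' W \/ counterclockwise U V' W -> E_pm1 U V W lam.
  exact: orientation_E_pm1.
have Gl : E_pm1 U V W lam -> ~ inv Nat0 a -> G lam.
  move=> h na; case: hG => ->; [by []|exact: E_pm1_sub_cap| |].
    exact/(E_cap_sub_cup U0 V0 W0)/E_pm1_sub_cap.
  exists A; first by case: hA.
  by rewrite /spec /= (invertible_inv Posz_inj (hc a ca) ra) range_Posz.
(* If all bi-infinite matrices satisfy the bound, the index exists and is nonzero, so the ellipses
   put lambda in G. *)
have alt r s : conj_exp r s -> ~ (forall a, Cls U V' W a -> Good r s [set: int] a eps^-1) \/ G lam.
  move=> cjr; case: (bi_alternative U0 (V'0 lam) W0 kU kV' kW c0 hc cjr d0 nI) => [|h]; first by left.
  case: (pselect (inv Nat0 a)) => [ia|na]; last by right; exact: Gl (Eg h) na.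
  left=> hall; have hb : biinv U V' W.
    by move=> t ct; exact: Good_inv cjr c0 (hc t ct) d0 (hall t ct).
  have [h' _] := index_alternative U0 (V'0 lam) W0 kU kV' kW c0 hc hb (fun hk => nI (conj hb hk)).
  exact: h' ca ia.
have altp := alt p q cj; have altq := alt q p cj'.
have nEp : ~ forall a, Cls U V' W a -> Good p q Nat0 a eps^-1.
  by move=> h; exact: nA (h a ca).
have nEq : ~ forall a, Cls U V' W a -> Good q p Nat0 a eps^-1.
  by move=> h; exact: nA' (h a ca).
exists True; split; tauto.
Qed.
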